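(* Let $\mathbf S=\{\mathbf S_{i,j}\}$ be the universal model associated with the abstract noncommutative variety $\mathcal V^{\mathbf m}_{\mathbf f,J}$, let $\mathcal H$ be a Hilbert space, and let $\mathcal M\subset\mathcal N_J\otimes\mathcal H$ be an invariant subspace under the operators $\mathbf S_{i,j}\otimes I_{\mathcal H}$ for any $i\in\{1,\dots,k\}$, $j\in\{1,\dots,n_i\}$. Then $\mathcal M$ is a Beurling type invariant subspace if and only if $$\Delta^{\mathbf p}_{\mathbf f,\mathbf S\otimes I_{\mathcal H}}(P_{\mathcal M})\ge0\qquad\text{for any }\mathbf p\in\mathbb Z_+^k,\ \mathbf p\le\mathbf m,$$ where $P_{\mathcal M}$ is the orthogonal projection of $\mathcal N_J\otimes\mathcal H$ onto $\mathcal M$.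
   Context: Fix $k\ge 1$ and $(n_1,\dots,n_k)$, $\mathbf m=(m_1,\dots,m_k)$ in $\mathbb N^k$, $\mathbb N=\{1,2,\dots\}$. Hilbert spaces are complex and separable; inequalities in $\mathbb Z_+^k$ are componentwise. $\mathbb F^+_{n_i}$ is the free unital semigroup on generators $g^i_1,\dots,g^i_{n_i}$ with identity $g^i_0$; $|\alpha|$ is word length. For $X_i=(X_{i,1},\dots,X_{i,n_i})$ and $\alpha=g^i_{j_1}\cdots g^i_{j_p}$ put $X_{i,\alpha}=X_{i,j_1}\cdots X_{i,j_p}$, $X_{i,g^i_0}=I$. $\mathbf f=(f_1,\dots,f_k)$, where each $f_i=\sum_{\alpha\in\mathbb F^+_{n_i}}a_{i,\alpha}Z_{i,\alpha}$ is a positive regular free holomorphic function: $a_{i,\alpha}\ge0$, $a_{i,g^i_0}=0$, $a_{i,g^i_j}>0$ for $1\le j\le n_i$, and $\limsup_{p\to\infty}(\sum_{|\alpha|=p}|a_{i,\alpha}|^2)^{1/2p}<\infty$. For $\mathbf X=(X_1,\dots,X_k)$ put $\Phi_{f_i,X_i}(Y)=\sum_{|\alpha|\ge1}a_{i,\alpha}X_{i,\alpha}YX_{i,\alpha}^*$ (weak operator convergence) and $\Delta^{\mathbf p}_{\mathbf f,\mathbf X}=(id-\Phi_{f_1,X_1})^{p_1}\circ\cdots\circ(id-\Phi_{f_k,X_k})^{p_k}$ for $\mathbf p\in\mathbb Z_+^k$. $\mathbf S\otimes I_{\mathcal H}$ denotes the tuple $\{\mathbf S_{i,j}\otimes I_{\mathcal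 H}\}$. $F^2(H_{n_i})=\mathbb C1\oplus\bigoplus_{p\ge1}H_{n_i}^{\otimes p}$ is the full Fock space over an $n_i$-dimensional Hilbert space, with orthonormal basis $\{e^i_\alpha\}_{\alpha\in\mathbb F^+_{n_i}}$, $e^i_{g^i_0}=1$. Set $b^{(m_i)}_{i,g^i_0}=1$ and $b^{(m_i)}_{i,\alpha}=\sum_{p=1}^{|\alpha|}\sum_{\gamma_1\cdots\gamma_p=\alpha,\,|\gamma_s|\ge1}a_{i,\gamma_1}\cdots a_{i,\gamma_p}\binom{p+m_i-1}{m_i-1}$ for $|\alpha|\ge1$; $W_{i,j}e^i_\alpha=\sqrt{b^{(m_i)}_{i,\alpha}/b^{(m_i)}_{i,g^i_j\alpha}}\;e^i_{g^i_j\alpha}$; $\mathbf W_{i,j}=I\otimes\cdots\otimes W_{i,j}\otimes\cdots\otimes I$ ($i$-th factor) on $\otimes_{i=1}^kF^2(H_{n_i})$. $\mathbb C[Z_{i,j}]$ is the algebra of polynomials in indeterminates $Z_{i,j}$, where $Z_{i,1},\dots,Z_{i,n_i}$ are noncommuting and $Z_{s,j},Z_{t,l}$ commute for $s\ne t$; $\mathbb C[\mathbf W_{i,j}]$ is the algebra of polynomials in the $\mathbf W_{i,j}$ and $I$; $\mathcal A(\mathbf D^{\mathbf m}_{\mathbf f})$ is its norm closure; $F^\infty(\mathbf D^{\mathbf m}_{\mathbf f})$ is its sequential SOT- (equivalently WOT-, $w^*$-) closure. $J$ is a left ideal in one of these four algebras. $\mathcal M_J$ is the closed linear span of the ranges of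 $g(\mathbf W)$, $g\in J$; $\mathcal N_J=[\otimes_iF^2(H_{n_i})]\ominus\mathcal M_J$, always assumed $\ne\{0\}$; it is invariant under each $\mathbf W_{i,j}^*$, and the universal model of $\mathcal V^{\mathbf m}_{\mathbf f,J}$ is given by $\mathbf S_{i,j}=P_{\mathcal N_J}\mathbf W_{i,j}|_{\mathcal N_J}$. An operator $M:\mathcal N_J\otimes\mathcal E\to\mathcal N_J\otimes\mathcal H$ is multi-analytic with respect to $\mathbf S$ if $M(\mathbf S_{i,j}\otimes I_{\mathcal E})=(\mathbf S_{i,j}\otimes I_{\mathcal H})M$ for all $i,j$, and inner multi-analytic if it is also a partial isometry. $\mathcal M\subset\mathcal N_J\otimes\mathcal H$ is a Beurling type invariant subspace (under the $\mathbf S_{i,j}\otimes I_{\mathcal H}$) if there are a Hilbert space $\mathcal E$ and an inner multi-analytic operator $\Psi:\mathcal N_J\otimes\mathcal E\to\mathcal N_J\otimes\mathcal H$ with $\mathcal M=\Psi(\mathcal N_J\otimes\mathcal E)$. *)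

(* Defs.v *)
From HB Require Import structures.
From mathcomp Require Import all_boot all_order all_algebra.
From mathcomp.real_closed Require Import complex.
From mathcomp Require Import sesquilinear.
From mathcomp Require Import all_classical all_reals all_analysis.
From mathcomp Require Import ring lra.
Set Implicit Arguments.
Unset Strict Implicit.
Unset Printing Implicit Defensive.
Import Order.TTheory GRing.Theory Num.Theory numFieldNormedType.Exports.
Local Open Scope classical_set_scope.
Local Open Scope ring_scope.

Section DotNorm.
Context {R : realType} {V : lmodType R[i]}.
Implicit Type dot : {dot V for @Num.conj R[i]}.

Definition dot_norm dot (x : V) : R := Num.sqrt (complex.Re (dot x x)).

Definition dot_cauchy dot (u : nat -> V) : Prop :=
  forall e : R, 0 < e ->
    exists N : nat, forall p q : nat,
      (N <= p)%N -> (N <= q)%N -> dot_norm dot (u p - u q) < e.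

Definition dot_cvg dot (u : nat -> V) (l : V) : Prop :=
  (fun n => dot_norm dot (u n - l)) @ \oo --> (0 : R).

End DotNorm.

(* The library's [{dot _ for _}] is linear in its first argument and
   conjugate-linear in the second. *)
HB.mixin Record isHilbert (R : realType) V of GRing.Lmodule R[i] V := {
  hdot : {dot V for @Num.conj R[i]};
  hilbert_complete : forall u : nat -> V,
    dot_cauchy hdot u -> exists l, dot_cvg hdot u l;
  hilbert_separable : exists u : nat -> V, forall (x : V) (e : R), 0 < e ->
    exists n, dot_norm hdot (x - u n) < e
}.

#[short(type="hilbertType")]
HB.structure Definition Hilbert (R : realType) :=
  {V of isHilbert R V & GRing.Lmodule R[i] V}.

Notation "''[' x , y ]" := (hdot x%R y%R) : ring_scope.
Notation hnorm := (dot_norm hdot).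
Notation hcvg := (dot_cvg hdot).

Section HilbertFacts.
Context {R : realType} {V : hilbertType R}.
Implicit Types x y z : V.

Lemma hdot_ge0 x : 0 <= '[x, x].
Proof. exact: dnorm_ge0. Qed.

Lemma hdotC x y : '[y, x] = ('[x, y])^*.
Proof. by rewrite hermC expr0 mul1r. Qed.

Lemma hnorm_ge0 x : 0 <= hnorm x.
Proof. exact: sqrtr_ge0. Qed.

Lemma hnorm_sqr x : ((hnorm x) ^+ 2)%:C%C = '[x, x].
Proof.
have /= := hdot_ge0 x; rewrite lecE /= => /andP[/eqP im0 re0].
by rewrite sqr_sqrtr //; case: ('[x, x]) im0 => a b /= ->.
Qed.

Lemma hnorm0 : hnorm (0 : V) = 0.
Proof. by rewrite /dot_norm linear0r sqrtr0. Qed.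

Lemma hnorm_opp x : hnorm (- x) = hnorm x.
Proof. by rewrite /dot_norm sesquilinear.hnormN. Qed.

Lemma hnormBC x y : hnorm (x - y) = hnorm (y - x).
Proof. by rewrite -hnorm_opp opprB. Qed.

Lemma hnorm_eq0 x : hnorm x = 0 -> x = 0.
Proof.
move=> h; have := hnorm_sqr x; rewrite h expr0n /= => /esym h0.
by apply/eqP; rewrite -(dnorm_eq0 (hdot : {dot V for @Num.conj R[i]})) h0.
Qed.

Lemma hdot_schwarz x y : `|'[x, y]| <= (hnorm x * hnorm y)%:C%C.
Proof.
have [->|y0] := eqVneq y 0.
  by rewrite linear0r normr0 hnorm0 mulr0 lexx.
have yy : 0 < '[y, y] by rewrite dnorm_gt0.
have xy0 : 0 <= (hnorm x * hnorm y)%:C%C by rewrite ler0c mulr_ge0 ?hnorm_ge0.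
rewrite -(@ler_pXn2r _ 2) ?nnegrE ?normr_ge0 //.
have -> : ((hnorm x * hnorm y)%:C%C ^+ 2 : R[i]) = '[x, x] * '[y, y].
  by rewrite -!hnorm_sqr !(rmorphM, rmorphXn) /= exprMn.
have := hdot_ge0 ('[y, y] *: x - '[x, y] *: y).
rewrite dnormB !dnormZ /= linearZl_LR linearZr_LR /=.
rewrite (ger0_norm (ltW yy)) !normCK.
set a := '[x, x]; set b := '[y, y]; set c := '[x, y].
have bC : b^* = b by rewrite conj_Creal // ger0_real // ltW.
rewrite !rmorphM /= conjCK bC.
have -> : b ^+ 2 * a + c * c^* * b - (b * (c^* * c) + b * (c * c^*)) =
          b * (a * b - c * c^*) by ring.
by rewrite pmulr_rge0 // subr_ge0.
Qed.

Lemma hnorm_leD x y : hnorm (x + y) <= hnorm x + hnorm y.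
Proof.
rewrite -(@ler_pXn2r _ 2) ?nnegrE ?addr_ge0 ?hnorm_ge0 //.
have -> : hnorm (x + y) ^+ 2 =
    hnorm x ^+ 2 + hnorm y ^+ 2 + 2 * complex.Re ('[x, y]).
  apply: complexI; rewrite hnorm_sqr dnormD.
  rewrite !rmorphD /= !hnorm_sqr rmorphM rmorph_nat /=.
  by congr (_ + _); exact: addcJ.
have le_xy : complex.Re ('[x, y]) <= hnorm x * hnorm y.
  rewrite -lecR; apply: le_trans (hdot_schwarz x y).
  by apply: le_trans (normc_ge_Re _); rewrite lecR ler_norm.
by rewrite sqrrD; lra.
Qed.

Lemma hnorm_triangle z x y : hnorm (x - y) <= hnorm (x - z) + hnorm (z - y).
Proof. by apply: le_trans (hnorm_leD _ _); rewrite addrA subrK. Qed.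

End HilbertFacts.

Record closedSubspace (R : realType) (V : hilbertType R) := ClosedSubspace {
  cs_set :> set V;
  cs_zero : cs_set 0;
  cs_linear : forall (c : R[i]) x y, cs_set x -> cs_set y -> cs_set (c *: x + y);
  cs_closed : forall (u : nat -> V) l,
    (forall n, cs_set (u n)) -> hcvg u l -> cs_set l
}.

(* A closed subspace as a Hilbert space in its own right, with inner product
   inherited from the ambient space; [val] is the inclusion. *)
Section SubspaceHilbert.
Context {R : realType} {V : hilbertType R} (A : closedSubspace V).

Definition hsubspace_pred : {pred V} := fun x => x \in (A : set V).

Lemma hsubspace_pred_closed : subsemimod_closed hsubspace_pred.
Proof.
split.
  split=> [|x y]; rewrite /hsubspace_pred !unfold_in !in_setE.
    exact: cs_zero.
  by rewrite -{2}[x]scale1r; exact: cs_linear.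
move=> c x; rewrite /hsubspace_pred !unfold_in !in_setE => Ax.
by rewrite -[c *: x]addr0; apply: cs_linear => //; exact: cs_zero.
Qed.

HB.instance Definition _ :=
  GRing.isSubmodClosed.Build R[i] V hsubspace_pred hsubspace_pred_closed.

Definition hsubspace : Type := {x : V | x \in hsubspace_pred}.

HB.instance Definition _ := SubChoice.on hsubspace.
HB.instance Definition _ := [SubChoice_isSubLmodule of hsubspace by <:].

Definition hsubspace_dot (x y : hsubspace) : R[i] := '[val x, val y].

Lemma hsubspace_dot_bilinear :
  bilinear_for *%R (GRing.Scale.Law.clone _ _ (@Num.conj R[i] \; *%R) _)
    hsubspace_dot.
Proof.
have valL (c : R[i]) (x y : hsubspace) : val (c *: x + y) = c *: val x + val y.
  by rewrite linearP.
by split=> [y c x x'|x c y y']; rewrite /hsubspace_dot valL ?linearPl ?linearPr.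
Qed.

HB.instance Definition _ :=
  bilinear_isBilinear.Build _ _ _ _ _ _ hsubspace_dot hsubspace_dot_bilinear.

Lemma hsubspace_dot_herm (x y : hsubspace) :
  hsubspace_dot x y = (-1) ^+ false * (hsubspace_dot y x)^*.
Proof. by rewrite expr0 mul1r /hsubspace_dot hdotC. Qed.

HB.instance Definition _ :=
  isHermitianSesquilinear.Build _ _ _ _ hsubspace_dot hsubspace_dot_herm.

Lemma hsubspace_dot_gt0 (x : hsubspace) : x != 0 -> 0 < hsubspace_dot x x.
Proof. by move=> x0; rewrite /hsubspace_dot dnorm_gt0. Qed.

HB.instance Definition _ :=
  isDotProduct.Build _ _ hsubspace_dot hsubspace_dot_gt0.

Lemma hsubspace_val (x : hsubspace) : cs_set A (val x).
Proof. by have := valP x; rewrite unfold_in in_setE. Qed.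

Lemma hsubspace_norm (x : hsubspace) : dot_norm hsubspace_dot x = hnorm (val x).
Proof. by []. Qed.

Lemma hsubspace_complete (u : nat -> hsubspace) :
  dot_cauchy hsubspace_dot u -> exists l, dot_cvg hsubspace_dot u l.
Proof.
move=> cu; have [l ul] : exists l, hcvg (val \o u) l.
  apply: hilbert_complete => e /cu[N uN]; exists N => p q Np Nq.
  by have := uN _ _ Np Nq; rewrite hsubspace_norm raddfB.
have Al : l \in hsubspace_pred.
  by rewrite unfold_in in_setE; apply: cs_closed ul => j; exact: hsubspace_val.
by exists (exist _ l Al).
Qed.

Lemma hsubspace_separable : exists u : nat -> hsubspace,
  forall (x : hsubspace) (e : R), 0 < e ->
    exists j, dot_norm hsubspace_dot (x - u j) < e.
Proof.
have [u du] := hilbert_separable (s := V).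
pose P (j i : nat) := [set x : hsubspace | hnorm (val x - u j) < i.+1%:R^-1].
pose v (s : nat) : hsubspace :=
  if unpickle s is Some (j, i) then xget 0 (P j i) else 0.
exists v => x e e0.
have [i ie] : exists i : nat, i.+1%:R^-1 < e / 2.
  have e20 : 0 < (e / 2)^-1 by rewrite invr_gt0 divr_gt0.
  exists (Num.bound (e / 2)^-1); rewrite -[ltRHS]invrK ltf_pV2 ?posrE //.
  by apply: lt_le_trans (archi_boundP (ltW e20)) _; rewrite ler_nat.
have i0 : (0 : R) < i.+1%:R^-1 by rewrite invr_gt0 ltr0Sn.
have [j xj] := du (val x) _ i0.
exists (pickle (j, i)); rewrite /v pickleK hsubspace_norm raddfB /=.
have Pjx : P j i x by [].
have xgP : hnorm (val (xget 0 (P j i)) - u j) < i.+1%:R^-1.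
  exact: (xgetPex 0 (ex_intro _ x Pjx)).
apply: le_lt_trans (hnorm_triangle (u j) _ _) _.
rewrite [X in _ + X]hnormBC; move: (hnorm _) (hnorm _) (_^-1) xj xgP ie => r1 r2 r3; lra.
Qed.

HB.instance Definition _ :=
  isHilbert.Build R hsubspace hsubspace_complete hsubspace_separable.

(* The orthogonal projection of the ambient space onto the subspace, as a map
   into the subspace. *)
Definition orth_proj (x : V) : hsubspace :=
  xget 0 [set y : hsubspace | forall z : hsubspace, '[x - val y, val z] = 0].

End SubspaceHilbert.

(* The same projection as an operator on the ambient space. *)
Definition projection (R : realType) (V : hilbertType R) (A : closedSubspace V) :
    V -> V := fun x => val (orth_proj A x).

Section Orthogonal.
Context {R : realType} {V : hilbertType R} (A : set V).

Definition orth_set : set V := [set x | forall z, A z -> '[x, z] = 0].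

Lemma orth_set0 : orth_set 0.
Proof. by move=> z _; rewrite linear0l. Qed.

Lemma orth_set_linear (c : R[i]) x y :
  orth_set x -> orth_set y -> orth_set (c *: x + y).
Proof.
move=> ox oy z Az; rewrite linearDl linearZl_LR /=.
by rewrite ox // oy // mulr0 addr0.
Qed.

Lemma orth_set_closed (u : nat -> V) l :
  (forall j, orth_set (u j)) -> hcvg u l -> orth_set l.
Proof.
move=> ou ul z Az; apply/eqP; rewrite -normr_eq0.
have norm_le (j : nat) : `|'[l, z]| <= (hnorm (u j - l) * hnorm z)%:C%C.
  have <- : '[l - u j, z] = '[l, z] by rewrite -[RHS]subr0 -(ou j z Az) linearBl.
  by rewrite hnormBC hdot_schwarz.
rewrite normc_def in norm_le *.
have {}norm_le j := norm_le j; set r := Num.sqrt _ in norm_le *.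
have r_le0 : r <= 0.
  have cvg0 : (fun j => hnorm (u j - l) * hnorm z) @ \oo --> (0 : R).
    by rewrite -[X in _ --> X](mul0r (hnorm z)); apply: cvgM ul (cvg_cst _).
  rewrite -(cvg_lim _ cvg0) //; apply: limr_ge; first exact: cvgP cvg0.
  by apply: nearW => j; have := norm_le j; rewrite lecR.
by have -> : r = 0 by apply/eqP; rewrite eq_le r_le0 sqrtr_ge0.
Qed.

Definition orth_compl : closedSubspace V :=
  ClosedSubspace orth_set0 orth_set_linear orth_set_closed.

End Orthogonal.

Section Spans.
Context {R : realType} {V : hilbertType R}.

Definition lin_span (A : set V) : set V :=
  [set x | exists (d : nat) (c : 'I_d -> R[i]) (v : 'I_d -> V),
    (forall s, A (v s)) /\ x = \sum_(s < d) c s *: v s].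

Definition closed_span (A : set V) : set V :=
  [set x | exists2 u : nat -> V, forall j, lin_span A (u j) & hcvg u x].

Definition orthonormal_basis (I : eqType) (e : I -> V) : Prop :=
  (forall s t, '[e s, e t] = (s == t)%:R) /\ closed_span (range e) = setT.

End Spans.

(* A realization of the Hilbert tensor product of [A] and [B]: the two axioms
   determine it up to a unique unitary respecting elementary tensors.
   Bilinearity of [tmap] follows from [tmap_dot]. *)
Record htensor (R : realType) (A B : hilbertType R) := HTensor {
  htensor_space :> hilbertType R;
  tmap : A -> B -> htensor_space;
  tmap_dot : forall x x' y y', '[tmap x y, tmap x' y'] = '[x, x'] * '[y, y'];
  tmap_total :
    closed_span [set t | exists x y, t = tmap x y] = setT
}.

(* Likewise for a finite family of Hilbert spaces. *)
Record big_htensor (R : realType) (k : nat) (F : 'I_k -> hilbertType R) :=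
  BigHTensor {
  big_htensor_space :> hilbertType R;
  big_tmap : (forall i, F i) -> big_htensor_space;
  big_tmap_dot : forall x y,
    '[big_tmap x, big_tmap y] = \prod_(i < k) '[x i, y i];
  big_tmap_total : closed_span (range big_tmap) = setT
}.

Section Operators.
Context {R : realType}.
Implicit Types U V W : hilbertType R.

Definition bounded_op U V (T : U -> V) : Prop :=
  linear T /\ exists c : R, forall x, hnorm (T x) <= c * hnorm x.

(* The operator with property [P]; only used for properties satisfied by exactly
   one operator in the situations of interest, with junk value 0 otherwise. *)
Definition the_op U V (P : set (U -> V)) : U -> V := xget (fun=> 0) P.

Definition adjoint U V (T : U -> V) : V -> U :=
  the_op [set T' | forall x y, '[T x, y] = '[x, T' y]].

Definition positive_op V (T : V -> V) : Prop := forall x, 0 <= '[T x, x].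

Definition partial_isometry U V (T : U -> V) : Prop :=
  forall x, (forall z, T z = 0 -> '[x, z] = 0) -> hnorm (T x) = hnorm x.

Definition tensor_op A B A' B' (T1 : @htensor R A B) (T2 : @htensor R A' B')
    (f : A -> A') (g : B -> B') : T1 -> T2 :=
  the_op [set T | bounded_op T /\
                  forall x y, T (tmap T1 x y) = tmap T2 (f x) (g y)].

(* I (x) ... (x) T (x) ... (x) I, with T in the i-th position *)
Definition ampliation k (F : 'I_k -> hilbertType R) (K : big_htensor F)
    (i : 'I_k) (T : F i -> F i) : K -> K :=
  the_op [set S : K -> K | bounded_op S /\
    forall x : forall i, F i,
      S (big_tmap K x) = big_tmap K (dfwith x i (T (x i)))].

End Operators.

Arguments tensor_op {R A B A' B'} T1 T2 f g _.
Arguments ampliation {R k F} K i T _.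

(* The free unital semigroup on n generators; its identity is [::]. *)
Definition word (n : nat) := seq 'I_n.

(* A realization of the full Fock space over an n-dimensional Hilbert space, with
   its canonical orthonormal basis e_w; it is determined up to a unique unitary
   matching the bases. *)
Record fock (R : realType) (n : nat) := Fock {
  fock_space :> hilbertType R;
  fock_basis : word n -> fock_space;
  fock_basisP : orthonormal_basis fock_basis
}.

Section OneDomain.
Context {R : realType} {n : nat}.
Implicit Types (a : word n -> R) (m : nat).

Definition positive_regular a : Prop :=
  [/\ forall w, 0 <= a w,
      a [::] = 0,
      forall j : 'I_n, 0 < a [:: j]
    & (limn_esup (fun p =>
        ((\sum_(w : p.-tuple 'I_n) `|a w| ^+ 2) `^ ((2 * p)%N%:R^-1))%:E)
       < +oo)%E].

(* The coefficients b^(m)_w; the inner sum runs over the factorizations of w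
   into p nonempty words. *)
Definition weight a m (w : word n) : R :=
  if w is [::] then 1 else
  \sum_(1 <= p < (size w).+1)
    \sum_(g \in [set g : p.-tuple (word n) |
                   flatten g = w /\ all (fun s => s != [::]) g])
      (\prod_(s <- g) a s) * 'C((p + m - 1)%N, (m - 1)%N)%:R.

Definition weighted_shift a m (F : fock R n) (j : 'I_n) : F -> F :=
  the_op [set T | bounded_op T /\
    forall w, T (fock_basis F w) =
      (Num.sqrt (weight a m w / weight a m (j :: w)))%:C%C
        *: fock_basis F (j :: w)].

Context {V : hilbertType R}.
Implicit Types (X : 'I_n -> V -> V) (Y : V -> V).

Definition word_op X (w : word n) : V -> V := foldr (fun j T => X j \o T) id w.

Definition Phi_partial a X Y (N : nat) : V -> V := fun x =>
  \sum_(1 <= p < N.+1) \sum_(w : p.-tuple 'I_n)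
    (a w)%:C%C *: word_op X w (Y (adjoint (word_op X w) x)).

(* The WOT-sum over all words of positive length, as the limit of the partial
   sums over words of length at most N. *)
Definition Phi a X Y : V -> V :=
  the_op [set Z | bounded_op Z /\ forall x y,
    (fun N => Normc.normc ('[Phi_partial a X Y N x, y] - '[Z x, y])) @ \oo
      --> (0 : R)].

End OneDomain.

Arguments weighted_shift {R n} a m F j _.

Section Polydomain.
Context {R : realType} {k : nat} {n : 'I_k -> nat}.

Definition Delta (a : forall i, word (n i) -> R) (V : hilbertType R)
    (X : forall i, 'I_(n i) -> V -> V) (p : 'I_k -> nat) : (V -> V) -> V -> V :=
  \big[(fun f g => f \o g)/id]_(i < k)
    iter (p i) (fun Y x => Y x - Phi (a i) (X i) Y x).

Definition universal_model (a : forall i, word (n i) -> R) (m : 'I_k -> nat)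
    (F : forall i, fock R (n i)) (K : big_htensor F) :
    forall i, 'I_(n i) -> K -> K :=
  fun i j => ampliation K i (weighted_shift (a i) (m i) (F i) j).

(* The monomials of C[Z_(i,j)]: since Z_(s,j) and Z_(t,l) commute for s <> t,
   these are the k-tuples of words, and C[Z_(i,j)] is the algebra of finitely
   supported complex functions on them, under convolution. *)
Definition mword := {dffun forall i : 'I_k, word (n i)}.

Definition mword_cat (u v : mword) : mword := [ffun i => u i ++ v i].

Definition is_poly (q : mword -> R[i]) : Prop := finite_set [set u | q u != 0].

Definition poly_mul (q r : mword -> R[i]) : mword -> R[i] := fun w =>
  \sum_(uv \in [set uv : mword * mword | mword_cat uv.1 uv.2 = w])
    q uv.1 * r uv.2.

Definition poly_left_ideal (J : set (mword -> R[i])) : Prop :=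
  [/\ J `<=` is_poly, J (fun=> 0),
      forall q r, J q -> J r -> J (fun u => q u + r u)
    & forall q r, is_poly q -> J r -> J (poly_mul q r)].

Context {V : hilbertType R} (W : forall i, 'I_(n i) -> V -> V).

Definition mword_op (u : mword) : V -> V :=
  \big[(fun f g => f \o g)/id]_(i < k) word_op (W (i := i)) (u i).

Definition poly_eval (q : mword -> R[i]) : V -> V := fun x =>
  \sum_(u \in [set: mword]) q u *: mword_op u x.

Definition poly_algebra : set (V -> V) := [set poly_eval q | q in is_poly].

(* A(D) *)
Definition domain_algebra : set (V -> V) :=
  [set T | bounded_op T /\ forall e : R, 0 < e ->
    exists2 S, poly_algebra S & forall x, hnorm (T x - S x) <= e * hnorm x].

(* F^infty(D): the sequential SOT-closure of the polynomials in W, taken as the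
   set of limits of sequences (for the universal model of a polydomain this set
   is already WOT-closed). *)
Definition hardy_algebra : set (V -> V) :=
  [set T | bounded_op T /\ exists2 S : nat -> V -> V,
    forall N, poly_algebra (S N) & forall x, hcvg (fun N => S N x) (T x)].

Definition op_left_ideal (A J : set (V -> V)) : Prop :=
  [/\ J `<=` A, J (fun=> 0),
      forall S T, J S -> J T -> J (fun x => S x + T x)
    & forall S T, A S -> J T -> J (S \o T)].

(* A left ideal in one of C[Z_(i,j)], C[W_(i,j)], A(D) and F^infty(D). *)
Inductive variety_ideal : Type :=
| FreeIdeal (J : set (mword -> R[i])) of poly_left_ideal J
| PolyIdeal (J : set (V -> V)) of op_left_ideal poly_algebra J
| DomainIdeal (J : set (V -> V)) of op_left_ideal domain_algebra J
| HardyIdeal (J : set (V -> V)) of op_left_ideal hardy_algebra J.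

(* {g(W) : g in J} *)
Definition ideal_ops (J : variety_ideal) : set (V -> V) :=
  match J with
  | FreeIdeal J _ => [set poly_eval q | q in J]
  | PolyIdeal J _ | DomainIdeal J _ | HardyIdeal J _ => J
  end.

(* The space M_J. *)
Definition range_span (J : variety_ideal) : set V :=
  closed_span [set y | exists g x, ideal_ops J g /\ y = g x].

(* The space N_J. *)
Definition variety_space (J : variety_ideal) : closedSubspace V :=
  orth_compl (range_span J).

Definition compression (N : closedSubspace V) :
    forall i, 'I_(n i) -> hsubspace N -> hsubspace N :=
  fun i j x => orth_proj N (W j (val x)).

End Polydomain.

Arguments universal_model {R k n} a m {F} K i j _.
Arguments compression {R k n V} W N i j _.

(* The tuple S (x) I *)
Definition tensor_tuple (R : realType) (k : nat) (n : 'I_k -> nat)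
    (N H : hilbertType R) (T : htensor N H)
    (S : forall i, 'I_(n i) -> N -> N) : forall i, 'I_(n i) -> T -> T :=
  fun i j => tensor_op T T (S i j) id.

Arguments tensor_tuple {R k n N H} T S i j _.

Section Beurling.
Context {R : realType} {k : nat} {n : 'I_k -> nat}.

Definition invariant_subspace (V : hilbertType R) (X : forall i, 'I_(n i) -> V -> V)
    (M : set V) : Prop :=
  forall i j x, M x -> M (X i j x).

Definition multi_analytic (N E H : hilbertType R)
    (S : forall i, 'I_(n i) -> N -> N) (TE : htensor N E) (TH : htensor N H)
    (Psi : TE -> TH) : Prop :=
  bounded_op Psi /\
  forall i j x, Psi (tensor_tuple TE S i j x) = tensor_tuple TH S i j (Psi x).

Definition beurling_type (N H : hilbertType R)
    (S : forall i, 'I_(n i) -> N -> N) (TH : htensor N H) (M : set TH) : Prop :=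
  exists (E : hilbertType R) (TE : htensor N E) (Psi : TE -> TH),
    [/\ multi_analytic S Psi, partial_isometry Psi & M = range Psi].

End Beurling.

Arguments beurling_type {R k n N H} S TH M.
Arguments invariant_subspace {R k n V} X M.

(* Main.v *)
Require Import Defs.
From HB Require Import structures.
From mathcomp Require Import all_boot all_order all_algebra.
From mathcomp.real_closed Require Import complex.
From mathcomp Require Import sesquilinear.
From mathcomp Require Import all_classical all_reals all_analysis.
From mathcomp Require Import zify ring lra.

(** Write X for S (x) I on N_J (x) H. The space N_J (x) H has a Parseval frame
    [P e_g (x) h_t] on which X acts as the weighted multishift acts on its basis,
    so every Delta^q applied to Psi Psi^*, with Psi multi-analytic, is diagonal in
    that frame: its symbol is the nonnegative quotient of the weights b^(m-q) and
    b^(m). As P_M = Psi Psi^* for an inner Psi with range M, this gives positivity.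

    Conversely, put D = Delta^m (P_M) >= 0. One variable at a time, positivity of
    the intermediate iterates gives P_M = sum_g b_g X_g D X_g^*: the partial sums
    stay below P_M, and the remainder is dominated by the powers of Phi applied to
    the identity, which tend to 0 in the model. Writing
    <D x, x> = sum_t |<x, d_t>|^2, the operators L_t e_g = sqrt(b_g) X_g d_t
    intertwine W with X. An intertwiner vanishes on M_J: slicing in H turns
    L_t g(W) u into a limit of q(S) applied to a vector of N_J, that is into the
    compression of g(W) itself, which is 0. Hence h |-> (L_t^* h)_t maps into
    l^2(N_J), it has the energy of P_M, and its adjoint is the required inner
    multi-analytic operator; l^2(N_J) is N_J (x) E for any infinite-dimensional E,
    such as the span of the e_w in a Fock space with w a power of one letter. *)

Set Implicit Arguments.
Unset Strict Implicit.
Unset Printing Implicit Defensive.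
Import Order.TTheory GRing.Theory Num.Theory numFieldNormedType.Exports.
Local Open Scope classical_set_scope.
Local Open Scope ring_scope.

(** * Hilbert space preliminaries *)

(** [Phi], adjoints and ampliations are given by choice, with value 0 if nothing fits, so every use
    is preceded by a proof that the series or operator exists. For this reason the calculus runs on
    quadratic forms with values in [\bar R], where nonnegative sums over words can be regrouped
    freely; a form becomes an operator only once it is bounded by a multiple of the squared norm.
    The exponents between 0 and [m] enter through the inversion: undoing [(id - Phi_i)^{m_i}] one
    factor at a time needs every intermediate operator to be positive, and each of these is a
    [Delta^p] with [p <= m]. The vectors [d_t] come from Cholesky elimination along a dense sequence
    and act as the columns of a square root of [D]; the same elimination applied to the identity
    yields orthonormal bases. The space [E] must come with a realization of [N_J (x) E]. Since [H]
    and [N_J] may be finite-dimensional, an infinite orthonormal sequence is taken from a Fock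
    factor, which has one because [n_i >= 1]. *)

Section ComplexModulus.
Context {R : realType}.
Implicit Types z w : R[i].

(** Squared moduli, and later squared norms, are kept in [R] instead of [R[i]], so that estimates
    take place in an ordered field and involve no square roots. *)
Definition abs2 z : R := complex.Re z ^+ 2 + complex.Im z ^+ 2.

Lemma abs2E z : (abs2 z)%:C%C = z * z^*.
Proof. by rewrite -normCK /abs2 add_Re2_Im2. Qed.

Lemma abs2_ge0 z : 0 <= abs2 z.
Proof. by rewrite addr_ge0 ?sqr_ge0. Qed.

Lemma abs2M z w : abs2 (z * w) = abs2 z * abs2 w.
Proof. by case: z w => [a b] [c d]; rewrite /abs2 /=; ring. Qed.

Lemma abs2J z : abs2 z^* = abs2 z.
Proof. by apply: complexI; rewrite !abs2E conjCK mulrC. Qed.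

Lemma abs2N z : abs2 (- z) = abs2 z.
Proof. by case: z => a b; rewrite /abs2 /= !sqrrN. Qed.

Lemma abs2_0 : abs2 0 = 0.
Proof. by rewrite /abs2 /= expr0n addr0. Qed.

Lemma abs2_real (r : R) : abs2 r%:C%C = r ^+ 2.
Proof. by rewrite /abs2 /= [0 ^+ 2]expr0n addr0. Qed.

Lemma abs2_eq0 z : abs2 z = 0 -> z = 0.
Proof.
by move=> h; apply/eqP; have := abs2E z; rewrite h -normCK => /esym/eqP; rewrite expf_eq0 normr_eq0.
Qed.

Lemma ReD z w : complex.Re (z + w) = complex.Re z + complex.Re w.
Proof. by case: z w => [a b] [c d]. Qed.

Lemma ReB z w : complex.Re (z - w) = complex.Re z - complex.Re w.
Proof. by case: z w => [a b] [c d]. Qed.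

Lemma ReJ z : complex.Re z^* = complex.Re z.
Proof. by case: z. Qed.

Lemma ReZ (r : R) z : complex.Re (r%:C%C * z) = r * complex.Re z.
Proof. by case: z => [a b] /=; rewrite mul0r subr0. Qed.

Lemma Re_sum I (r : seq I) (P : pred I) (F : I -> R[i]) :
  complex.Re (\sum_(i <- r | P i) F i) = \sum_(i <- r | P i) complex.Re (F i).
Proof. exact: (big_morph _ ReD). Qed.

End ComplexModulus.

Section LinearMaps.
Context {R : realType} {U V : lmodType R[i]} (T : U -> V).
Hypothesis linT : linear T.

Let TL : {linear U -> V} := HB.pack T (GRing.isLinear.Build _ _ _ _ T linT).

Lemma lin0 : T 0 = 0. Proof. exact: (linear0 TL). Qed.
Lemma linD x y : T (x + y) = T x + T y. Proof. exact: (linearD TL). Qed.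
Lemma linB x y : T (x - y) = T x - T y. Proof. exact: (linearB TL). Qed.
Lemma linZ c x : T (c *: x) = c *: T x. Proof. exact: (linearZ_LR TL). Qed.
Lemma lin_sum I (r : seq I) (P : pred I) (F : I -> U) :
  T (\sum_(i <- r | P i) F i) = \sum_(i <- r | P i) T (F i).
Proof. exact: (linear_sum TL). Qed.

End LinearMaps.

Section SquaredNorm.
Context {R : realType} {V : hilbertType R}.
Implicit Types x y z : V.

Definition nsq x : R := complex.Re '[x, x].

Lemma nsqE x : '[x, x] = (nsq x)%:C%C.
Proof. by rewrite -hnorm_sqr /nsq /= -hnorm_sqr. Qed.

Lemma nsq_hnorm x : nsq x = hnorm x ^+ 2.
Proof. by apply: complexI; rewrite -nsqE hnorm_sqr. Qed.

Lemma nsq_ge0 x : 0 <= nsq x.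
Proof. by rewrite nsq_hnorm sqr_ge0. Qed.

Lemma nsq_eq0 x : nsq x = 0 -> x = 0.
Proof. by rewrite nsq_hnorm => /eqP; rewrite expf_eq0 /= => /eqP/hnorm_eq0. Qed.

Lemma nsq0 : nsq 0 = 0.
Proof. by rewrite nsq_hnorm hnorm0 expr0n. Qed.

Lemma nsq_opp x : nsq (- x) = nsq x.
Proof. by rewrite !nsq_hnorm hnorm_opp. Qed.

Lemma nsqD x y : nsq (x + y) = nsq x + nsq y + complex.Re '[x, y] * 2.
Proof.
rewrite /nsq linearDl !linearDr /= !ReD (hdotC x y) ReJ; ring.
Qed.

Lemma nsqB x y : nsq (x - y) = nsq x + nsq y - complex.Re '[x, y] * 2.
Proof. by rewrite nsqD nsq_opp linearNr /= raddfN /= mulNr. Qed.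

Lemma nsqBC x y : nsq (x - y) = nsq (y - x).
Proof. by rewrite -nsq_opp opprB. Qed.

Lemma nsqZ c x : nsq (c *: x) = abs2 c * nsq x.
Proof.
apply: complexI; rewrite -nsqE linearZl_LR linearZr_LR /= mulrA -abs2E nsqE.
by rewrite [RHS]rmorphM.
Qed.

Lemma nsq_leD x y : nsq (x + y) <= 2 * nsq x + 2 * nsq y.
Proof.
have := nsq_ge0 (x - y); rewrite nsqB nsqD.
move: (complex.Re _) (nsq x) (nsq y) => c a b; lra.
Qed.

Lemma abs2_dot x y : abs2 '[x, y] <= nsq x * nsq y.
Proof.
have := hdot_schwarz x y.
rewrite -(@ler_pXn2r _ 2) ?nnegrE ?normr_ge0 ?ler0c ?mulr_ge0 ?hnorm_ge0 //.
by rewrite normCK -abs2E -rmorphXn /= lecR exprMn -!nsq_hnorm.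
Qed.

Lemma abs2_dotC x y : abs2 '[x, y] = abs2 '[y, x].
Proof. by rewrite hdotC abs2J. Qed.

Lemma nsq_sqrt_lt (e : R) x : 0 < e -> nsq x < e ^+ 2 -> hnorm x < e.
Proof.
by move=> e0; rewrite nsq_hnorm ltr_pXn2r ?nnegrE ?hnorm_ge0 ?ltW.
Qed.

Definition tends (u : nat -> V) l := forall e : R, 0 < e ->
  exists N : nat, forall n, (N <= n)%N -> nsq (u n - l) < e.

Lemma hcvgP (u : nat -> V) l : hcvg u l <-> tends u l.
Proof.
split=> [ul e e0|ul].
  have e0' : 0 < Num.sqrt e by rewrite sqrtr_gt0.
  have /cvgrPdist_lt/(_ _ e0') [N _ uN] := ul.
  exists N => n Nn; have := uN n Nn; rewrite /= sub0r normrN ger0_norm ?hnorm_ge0 // => h.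
  by rewrite nsq_hnorm -[e]sqr_sqrtr ?ltW // ltr_pXn2r ?nnegrE ?hnorm_ge0 ?sqrtr_ge0.
apply/cvgrPdist_lt => e e0.
have [N uN] := ul _ (exprn_gt0 2 e0).
exists N => // n Nn; rewrite /= sub0r normrN ger0_norm ?hnorm_ge0 //.
by apply: nsq_sqrt_lt => //; exact: uN.
Qed.

Lemma nsq_complete (u : nat -> V) :
  (forall e : R, 0 < e -> exists N : nat, forall p q,
     (N <= p)%N -> (N <= q)%N -> nsq (u p - u q) < e) ->
  exists l, tends u l.
Proof.
move=> cu; have [l ul] : exists l, hcvg u l.
  apply: hilbert_complete => e e0; have [N uN] := cu _ (exprn_gt0 2 e0).
  by exists N => p q Np Nq; apply: nsq_sqrt_lt => //; exact: uN.
by exists l; apply/hcvgP.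
Qed.

Lemma nsq_dense : exists u : nat -> V, forall x (e : R), 0 < e ->
  exists n, nsq (x - u n) < e.
Proof.
have [u du] := hilbert_separable (s := V); exists u => x e e0.
have e0' : 0 < Num.sqrt e by rewrite sqrtr_gt0.
have [n xn] := du x _ e0'; exists n.
by rewrite nsq_hnorm -[e]sqr_sqrtr ?ltW // ltr_pXn2r ?nnegrE ?hnorm_ge0 ?sqrtr_ge0.
Qed.

Lemma le_eps (a b : R) (C : R) : (forall e : R, 0 < e -> a <= b + C * e) -> a <= b.
Proof.
move=> h; apply/ler_addgt0Pr => e e0.
have C1 : 0 < `|C| + 1 by rewrite ltr_wpDl.
have := h (e / (`|C| + 1)) (divr_gt0 e0 C1) => /le_trans; apply.
rewrite lerD2l mulrA ler_pdivrMr // mulrC ler_pM2l //.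
by have := ler_norm C; lra.
Qed.

Lemma nsq_eps0 x (C : R) : (forall e : R, 0 < e -> nsq x <= C * e) -> x = 0.
Proof.
move=> h; apply: nsq_eq0; apply/eqP; rewrite eq_le nsq_ge0 andbT.
by apply: (@le_eps _ _ C) => e /h; rewrite add0r.
Qed.

Lemma tends_unique (u : nat -> V) l l' : tends u l -> tends u l' -> l = l'.
Proof.
move=> ul ul'; apply/eqP; rewrite -subr_eq0; apply/eqP.
apply: (@nsq_eps0 _ 4) => e e0.
have [N1 h1] := ul _ e0; have [N2 h2] := ul' _ e0.
have {}h1 := h1 _ (leq_maxl N1 N2); have {}h2 := h2 _ (leq_maxr N1 N2).
have := nsq_leD (l - u (maxn N1 N2)) (u (maxn N1 N2) - l').
rewrite addrA subrK nsqBC in h1 *.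
by move: (nsq _) (nsq _) (nsq _) h1 h2 => a b c; lra.
Qed.

Lemma tends_lin (u v : nat -> V) l l' c : tends u l -> tends v l' ->
  tends (fun n => c *: u n + v n) (c *: l + l').
Proof.
move=> ul vl e e0.
have K0 : 0 < 4 * (abs2 c + 1) by rewrite mulr_gt0 // ltr_wpDl ?abs2_ge0.
have [N1 h1] := ul _ (divr_gt0 e0 K0).
have [N2 h2] := vl _ (divr_gt0 e0 (ltr0Sn R 3)).
exists (maxn N1 N2) => n; rewrite geq_max => /andP[/h1 {}h1 /h2 {}h2].
have -> : c *: u n + v n - (c *: l + l') = c *: (u n - l) + (v n - l').
  by rewrite scalerBr opprD addrACA.
apply: le_lt_trans (nsq_leD _ _) _; rewrite nsqZ.
have a0 := abs2_ge0 c; have n0 := nsq_ge0 (u n - l).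
rewrite ltr_pdivlMr // in h1; rewrite ltr_pdivlMr // in h2.
move: (abs2 c) (nsq _) (nsq _) a0 n0 h1 h2 => a r s a0 n0 h1 h2; nra.
Qed.

Lemma tends_cst l : tends (fun=> l) l.
Proof. by move=> e e0; exists 0%N => n _; rewrite subrr nsq0. Qed.

Lemma tends_dot (u : nat -> V) l y (e : R) : 0 < e -> tends u l ->
  exists N : nat, forall n, (N <= n)%N -> abs2 ('[u n, y] - '[l, y]) < e.
Proof.
move=> e0 ul; have K0 : 0 < nsq y + 1 by rewrite ltr_wpDl ?nsq_ge0.
have [N h] := ul _ (divr_gt0 e0 K0); exists N => n /h {}h.
rewrite -linearBl; apply: le_lt_trans (abs2_dot _ _) _.
rewrite ltr_pdivlMr // in h; have := nsq_ge0 (u n - l).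
by move: (nsq _) (nsq _) h => a b; lra.
Qed.

Lemma abs2_leD (z w : R[i]) : abs2 (z + w) <= 2 * abs2 z + 2 * abs2 w.
Proof.
case: z w => [a b] [c d]; rewrite /abs2 /=.
have := sqr_ge0 (a - c); have := sqr_ge0 (b - d); nra.
Qed.

Lemma abs2_eps0 (z : R[i]) (C : R) : (forall e : R, 0 < e -> abs2 z <= C * e) -> z = 0.
Proof.
move=> h; apply: abs2_eq0; apply/eqP; rewrite eq_le abs2_ge0 andbT.
by apply: (@le_eps _ _ C) => e /h; rewrite add0r.
Qed.

Lemma tends_dot_eq (u : nat -> V) l y c : tends u l ->
  (exists N : nat, forall n, (N <= n)%N -> '[u n, y] = c) -> '[l, y] = c.
Proof.
move=> ul [M uc]; apply/eqP; rewrite -subr_eq0; apply/eqP.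
apply: (@abs2_eps0 _ 1) => e e0; have [N h] := tends_dot y e0 ul.
have := h _ (leq_maxl N M); rewrite uc ?leq_maxr //.
by rewrite -opprB abs2N mul1r => /ltW.
Qed.

Lemma tends_nsq_le (u : nat -> V) l (C : R) : tends u l ->
  (exists N : nat, forall n, (N <= n)%N -> nsq (u n) <= C) -> nsq l <= C.
Proof.
move=> ul [M uC]; have C0 : 0 <= C by apply: le_trans (uC M _); rewrite ?nsq_ge0.
apply: (@le_eps _ _ (C + 1)) => e e0.
have e1 : 0 < 1 + e by rewrite ltr_pwDl ?ltW.
(* The tolerance [e^2 / (1 + e)] makes [(1 + 1/e) nsq (v - l) < e], so Young's inequality gives
   [nsq l <= (1 + e) C + e]; hence the slope [C + 1]. *)
have [N h] := ul _ (divr_gt0 (exprn_gt0 2 e0) e1).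
have := h _ (leq_maxl N M); have := uC _ (leq_maxr N M).
set v := u _ => vC; rewrite ltr_pdivlMr // => vl.
have -> : nsq l = nsq (v - (v - l)) by rewrite opprB addrC subrK.
move: (v - l) vl => w wl; rewrite nsqB.
(* Young's inequality with parameter e *)
have := nsq_ge0 (e%:C%C *: v + w); rewrite nsqD nsqZ linearZl_LR /= ReZ abs2_real.
have := nsq_ge0 v; have := nsq_ge0 w.
move: (nsq v) (nsq w) (complex.Re _) vC wl => a b c aC be b0 a0 h1.
rewrite -(ler_pM2l e0).
have : e * (a * (1 + e)) <= e * (C * (1 + e)) by rewrite ler_pM2l // ler_pM2r.
by move: be h1; rewrite !mulrDr !mulrDl !expr2 => be h1; lra.
Qed.

End SquaredNorm.

Section BoundedOperators.
Context {R : realType}.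
Implicit Types U V W : hilbertType R.

Lemma bounded_opP U V (T : U -> V) : bounded_op T <->
  linear T /\ exists2 c : R, 0 <= c & forall x, nsq (T x) <= c * nsq x.
Proof.
split=> [[lT [c Tc]]|[lT [c c0 Tc]]]; split=> //.
  exists (c ^+ 2) => [|x]; first exact: sqr_ge0.
  rewrite !nsq_hnorm -exprMn ler_sqr ?nnegrE ?hnorm_ge0 //.
  exact: le_trans (hnorm_ge0 _) (Tc x).
exists (Num.sqrt c) => x.
rewrite -(@ler_sqr R) ?nnegrE ?mulr_ge0 ?sqrtr_ge0 ?hnorm_ge0 //.
by rewrite exprMn (sqr_sqrtr c0) -!nsq_hnorm.
Qed.

Lemma bounded_tends U V (T : U -> V) u l : bounded_op T ->
  tends u l -> tends (T \o u) (T l).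
Proof.
move=> /bounded_opP[lT [c c0 Tc]] ul e e0.
have [N h] := ul _ (divr_gt0 e0 (ltr_wpDl c0 (@ltr01 R))).
exists N => n /h {}h; rewrite /= -linB //; apply: le_lt_trans (Tc _) _.
move: h (nsq_ge0 (u n - l)); rewrite ltr_pdivlMr; last by rewrite ltr_wpDl.
move: (nsq _) => a; nra.
Qed.

Lemma bounded_id V : bounded_op (@id V).
Proof. by apply/bounded_opP; split=> //; exists 1 => // x; rewrite mul1r. Qed.

Lemma bounded_zero U V : bounded_op (fun _ : U => 0 : V).
Proof.
apply/bounded_opP; split=> [c x y|]; first by rewrite scaler0 addr0.
by exists 0 => // x; rewrite nsq0 mul0r.
Qed.

Lemma bounded_comp U V W (S : V -> W) (T : U -> V) :
  bounded_op S -> bounded_op T -> bounded_op (S \o T).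
Proof.
move=> /bounded_opP[lS [c c0 Sc]] /bounded_opP[lT [d d0 Td]].
apply/bounded_opP; split=> [a x y|]; first by rewrite /= lT lS.
exists (c * d) => [|x]; first exact: mulr_ge0.
by apply: le_trans (Sc _) _; rewrite -mulrA ler_wpM2l.
Qed.

Lemma bounded_scaleD U V (S T : U -> V) a :
  bounded_op S -> bounded_op T -> bounded_op (fun x => a *: S x + T x).
Proof.
move=> /bounded_opP[lS [c c0 Sc]] /bounded_opP[lT [d d0 Td]].
apply/bounded_opP; split=> [b x y|].
  rewrite lS lT !scalerDr !scalerA -!addrA; congr (_ + _); first by rewrite mulrC.
  by rewrite addrCA.
exists (2 * abs2 a * c + 2 * d) => [|x].
  by rewrite addr_ge0 ?mulr_ge0 ?abs2_ge0.
apply: le_trans (nsq_leD _ _) _; rewrite nsqZ [leRHS]mulrDl lerD //.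
  by rewrite -!mulrA ler_wpM2l // ler_wpM2l ?abs2_ge0.
by rewrite -mulrA ler_wpM2l.
Qed.

Lemma bounded_add U V (S T : U -> V) :
  bounded_op S -> bounded_op T -> bounded_op (fun x => S x + T x).
Proof.
move=> bS bT; have := bounded_scaleD 1 bS bT.
by under eq_fun do rewrite scale1r.
Qed.

Lemma bounded_scale U V (T : U -> V) a :
  bounded_op T -> bounded_op (fun x => a *: T x).
Proof.
move=> bT; have := bounded_scaleD a bT (bounded_zero U V).
by under eq_fun do rewrite addr0.
Qed.

Lemma bounded_sub U V (S T : U -> V) :
  bounded_op S -> bounded_op T -> bounded_op (fun x => S x - T x).
Proof.
move=> bS bT; have := bounded_scaleD (-1) bT bS.
by under eq_fun do rewrite scaleN1r addrC.
Qed.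

Lemma bounded_sum U V I (r : seq I) (P : pred I) (T : I -> U -> V) :
  (forall i, bounded_op (T i)) ->
  bounded_op (fun x => \sum_(i <- r | P i) T i x).
Proof.
move=> bT; elim: r => [|i r IH].
  under eq_fun do rewrite big_nil; exact: bounded_zero.
under eq_fun do rewrite big_cons; case: (P i) => //.
exact: bounded_add.
Qed.

Definition qf V (Y : V -> V) x : R := complex.Re '[Y x, x].

Lemma positive_qf V (Y : V -> V) x : positive_op Y -> '[Y x, x] = (qf Y x)%:C%C.
Proof.
move=> /(_ x); rewrite /qf; case: ('[Y x, x]) => a b; rewrite lecE /=.
by move=> /andP[/eqP -> _].
Qed.

Lemma qf_ge0 V (Y : V -> V) x : positive_op Y -> 0 <= qf Y x.
Proof. by move=> pY; rewrite -ler0c -positive_qf. Qed.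

Lemma positive_id V : positive_op (@id V).
Proof. by move=> x; exact: hdot_ge0. Qed.

Lemma qfB V (Y Z : V -> V) x : qf (fun x => Y x - Z x) x = qf Y x - qf Z x.
Proof. by rewrite /qf linearBl /= ReB. Qed.

Definition hermitian_op V (Y : V -> V) : Prop := forall x y, '[Y x, y] = '[x, Y y].

Lemma hermitian_qf V (Y : V -> V) x : hermitian_op Y -> '[Y x, x] = (qf Y x)%:C%C.
Proof.
move=> hY; have : '[Y x, x] = ('[Y x, x])^* by rewrite {1}hY hdotC.
rewrite /qf; case: ('[Y x, x]) => a b /= /eqP; rewrite eq_complex /= => /andP[_ /eqP h].
by congr Complex; lra.
Qed.

(** Polarization: the form is real at [x + y] and at [x + i y], and the vanishing of these imaginary
    parts gives the two components of the identity. *)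
Lemma positive_hermitian V (Y : V -> V) : linear Y -> positive_op Y -> hermitian_op Y.
Proof.
move=> lY pY x y; rewrite [RHS]hdotC.
have := positive_qf (x + y) pY; have := positive_qf (x + 'i%C *: y) pY.
rewrite !(linD lY) !(linZ lY) !linearDl !linearDr /= !linearZl_LR !linearZr_LR /=.
rewrite (positive_qf x pY) (positive_qf y pY).
case: ('[Y x, y]) => a b; case: ('[Y y, x]) => c d.
move=> /(congr1 (@complex.Im R)) /= h1 /(congr1 (@complex.Im R)) /= h2.
by apply/eqP; rewrite eq_complex /=; apply/andP; split; apply/eqP; lra.
Qed.

(** A vanishing form is positive, so [Y] is hermitian; the value at [x + Y x] is then twice the
    squared norm of [Y x]. *)
Lemma linear_eq0 V (Y : V -> V) : linear Y -> (forall x, '[Y x, x] = 0) ->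
  forall x, Y x = 0.
Proof.
move=> lY Y0; have pY : positive_op Y by move=> x; rewrite Y0.
have hY := positive_hermitian lY pY.
move=> x; apply: nsq_eq0; rewrite /nsq.
have := Y0 (x + Y x); rewrite (linD lY) !linearDl !linearDr /= !Y0 !(add0r, addr0) [X in _ + X]hY.
by move=> /(congr1 (@complex.Re R)); rewrite ReD /=; lra.
Qed.

Lemma qf_inj V (Y Z : V -> V) : linear Y -> linear Z -> hermitian_op Y ->
  hermitian_op Z -> (forall x, qf Y x = qf Z x) -> Y = Z.
Proof.
move=> lY lZ hY hZ YZ; apply/funext => x; apply/eqP; rewrite -subr_eq0; apply/eqP.
apply: (@linear_eq0 V (fun x => Y x - Z x)) => [c u v|{}x].
  by rewrite lY lZ opprD addrACA scalerBr.
by rewrite linearBl /= !hermitian_qf // YZ subrr.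
Qed.

Lemma qf_bound V (Y : V -> V) : bounded_op Y ->
  exists2 c : R, 0 < c & forall x, qf Y x <= c * nsq x.
Proof.
move=> /bounded_opP[lY [c c0 Yc]]; exists (c + 1) => [|x]; first by rewrite ltr_wpDl.
have := nsq_ge0 (Y x - x); rewrite nsqB /qf.
have := Yc x; have := nsq_ge0 x; have := mulr_ge0 c0 (nsq_ge0 x).
move: (nsq x) (nsq _) (complex.Re _) => a b d; rewrite mulrDl mul1r; lra.
Qed.

Lemma ReZr V (c : R) (x y : V) :
  complex.Re '[x, c%:C%C *: y] = c * complex.Re '[x, y].
Proof. by rewrite -[LHS]ReJ -hdotC linearZl_LR /= ReZ hdotC ReJ. Qed.

Lemma qf_combination V (Y : V -> V) (c : R) (x y : V) : linear Y -> hermitian_op Y ->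
  qf Y (c%:C%C *: x - y) = c ^+ 2 * qf Y x + qf Y y - c * complex.Re '[Y x, y] * 2.
Proof.
move=> lY hY; set r := RHS; rewrite /qf (linB lY) (linZ lY) !linearBl !linearBr /= !ReB.
rewrite !linearZl_LR /= !ReZ !ReZr [X in _ - (c * complex.Re X - _)]hY.
by rewrite [X in _ - (c * complex.Re X - _)]hdotC ReJ /r /qf; ring.
Qed.

(* 0 <= <Y (x - s Y x), x - s Y x> with s = 1 / C *)
Lemma nsq_le_qf V (Y : V -> V) (C : R) : linear Y -> positive_op Y -> 0 < C ->
  (forall x, qf Y x <= C * nsq x) -> forall x, nsq (Y x) <= C * qf Y x.
Proof.
move=> lY pY C0 YC x; have hY := positive_hermitian lY pY.
have := qf_ge0 (C%:C%C *: x - Y x) pY; have := YC (Y x).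
rewrite qf_combination // -/(nsq (Y x)) => h1 h2.
rewrite -(ler_pM2l C0); move: h1 h2; move: (qf _ _) (qf _ _) (nsq _) => a b c.
by rewrite expr2; lra.
Qed.

Lemma qf_null V (Y : V -> V) x : bounded_op Y -> positive_op Y ->
  qf Y x = 0 -> Y x = 0.
Proof.
move=> bY pY Y0; have [C C0 YC] := qf_bound bY.
have := nsq_le_qf bY.1 pY C0 YC x; rewrite Y0 mulr0 => h.
by apply: nsq_eq0; apply/eqP; rewrite eq_le nsq_ge0 h.
Qed.

(** Parallelogram law for the form of [Y], with the term at [x - y] dropped by positivity. *)
Lemma qf_leD V (Y : V -> V) x y : linear Y -> positive_op Y ->
  qf Y (x + y) <= 2 * qf Y x + 2 * qf Y y.
Proof.
move=> lY pY; have hY := positive_hermitian lY pY.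
have := qf_ge0 (1%:C%C *: x - y) pY.
have -> : x + y = 1%:C%C *: x - - y by rewrite scale1r opprK.
rewrite !qf_combination // expr1n !mul1r.
have -> : qf Y (- y) = qf Y y.
  rewrite /qf -[- y]sub0r (linB lY) (lin0 lY) !sub0r.
  by rewrite linearNl linearNr /= opprK.
by rewrite linearNr /= raddfN /=; lra.
Qed.

End BoundedOperators.

(** * Orthonormal bases, adjoints and projections *)

Section Cholesky.
Context {R : realType} {V : hilbertType R}.
Implicit Types (D : V -> V) (u x y z d : V).

(** One Gram-Schmidt step for the form of [D]: the normalization makes the rank-one operator of this
    vector agree with [D] at [u]. If [qf D u = 0], the convention [0^-1 = 0] gives the zero vector,
    which is correct since then [D u = 0]. *)
Definition deflation_vector D u : V := ((Num.sqrt (qf D u))^-1)%:C%C *: D u.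

Definition deflation D u : V -> V :=
  fun x => D x - '[x, deflation_vector D u] *: deflation_vector D u.

Lemma rank1_bounded d : bounded_op (fun x : V => '[x, d] *: d).
Proof.
apply/bounded_opP; split=> [c x y|].
  by rewrite linearDl linearZl_LR /= scalerDl scalerA.
exists (nsq d * nsq d) => [|x]; first by rewrite mulr_ge0 ?nsq_ge0.
by rewrite nsqZ mulrAC ler_wpM2r ?nsq_ge0 // mulrC; exact: abs2_dot.
Qed.

Lemma deflation_bounded D u : bounded_op D -> bounded_op (deflation D u).
Proof. by move=> bD; apply: bounded_sub => //; exact: rank1_bounded. Qed.

Lemma deflation_hermitian D u : hermitian_op D -> hermitian_op (deflation D u).
Proof.
move=> hD x y; rewrite /deflation linearBl linearBr /= hD.
by congr (_ - _); rewrite linearZl_LR [RHS]linearZr_LR /= -hdotC mulrC.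
Qed.

Lemma deflation_vec0 D u : bounded_op D -> positive_op D -> deflation D u u = 0.
Proof.
move=> bD pD; have hD := positive_hermitian bD.1 pD.
have [q0|q0] := eqVneq (qf D u) 0.
  by rewrite /deflation /deflation_vector q0 sqrtr0 invr0 scale0r scaler0 subr0 qf_null.
have s0 : Num.sqrt (qf D u) != 0 by rewrite sqrtr_eq0 -ltNge lt_def q0 qf_ge0.
rewrite /deflation /deflation_vector linearZr_LR /= -hD (positive_qf u pD).
rewrite scalerA (_ : _ * _ = 1) ?scale1r ?subrr //.
have -> : (((Num.sqrt (qf D u))^-1)%:C%C : R[i])^* = ((Num.sqrt (qf D u))^-1)%:C%C.
  by rewrite conj_Creal // complex_real.
rewrite -!rmorphM /= -[X in _ * X * _]sqr_sqrtr ?qf_ge0 // expr2 mulrA mulVf // mul1r.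
by rewrite mulfV // rmorph1.
Qed.

(** The deflated operator is [x |-> D (x - c u)] and is zero at [u]; so its form at [x] equals the
    form of [D] at [x - c u]. *)
Lemma deflation_positive D u : bounded_op D -> positive_op D ->
  positive_op (deflation D u).
Proof.
move=> bD pD x; have hD := positive_hermitian bD.1 pD.
set q := qf D u; have [q0|q0] := eqVneq q 0.
  by rewrite /deflation /deflation_vector -/q q0 sqrtr0 invr0 scale0r scaler0 subr0.
set c := '[x, deflation_vector D u] * ((Num.sqrt q)^-1)%:C%C.
have E : deflation D u x = D (x - c *: u).
  by rewrite (linB bD.1) (linZ bD.1) -scalerA.
have E0 : '[deflation D u x, u] = 0.
  by rewrite deflation_hermitian // deflation_vec0 // linear0r.
have -> : '[deflation D u x, x] = '[deflation D u x, x - c *: u].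
  by rewrite linearBr linearZr_LR /= E0 mulr0 subr0.
by rewrite E.
Qed.

Lemma qf_deflation D u x :
  qf (deflation D u) x = qf D x - abs2 '[x, deflation_vector D u].
Proof.
rewrite /qf /deflation linearBl linearZl_LR /= ReB; congr (_ - _).
by rewrite [X in _ * X]hdotC -abs2E.
Qed.

(** The successive Schur complements of [D] along the vectors [u 0, u 1, ...]. *)
Fixpoint cholesky D (u : nat -> V) (n : nat) : V -> V :=
  if n is n'.+1 then deflation (cholesky D u n') (u n') else D.

Definition cholesky_vector D (u : nat -> V) n := deflation_vector (cholesky D u n) (u n).

Section Fixed.
Context (D : V -> V) (u : nat -> V).
Hypotheses (bD : bounded_op D) (pD : positive_op D).
Let Dn := cholesky D u.
Let d := cholesky_vector D u.

Lemma cholesky_bounded n : bounded_op (Dn n).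
Proof. by elim: n => //= n IH; exact: deflation_bounded. Qed.

Lemma cholesky_positive n : positive_op (Dn n).
Proof.
by elim: n => //= n IH; apply: deflation_positive => //; exact: cholesky_bounded.
Qed.

Lemma cholesky_sum N x : Dn N x = D x - \sum_(n < N) '[x, d n] *: d n.
Proof.
elim: N => [|N IH]; first by rewrite big_ord0 subr0.
by rewrite big_ord_recr /= opprD addrA -IH.
Qed.

Lemma qf_cholesky N x : qf (Dn N) x = qf D x - \sum_(n < N) abs2 '[x, d n].
Proof.
elim: N => [|N IH]; first by rewrite big_ord0 subr0.
by rewrite big_ord_recr /= opprD addrA -IH /Dn /= qf_deflation.
Qed.

(** Once the form vanishes at [u n] it stays 0, because later deflations only lower it and keep it
    nonnegative; a positive operator kills the null vectors of its form. *)
Lemma cholesky_vec0 n N : (n < N)%N -> Dn N (u n) = 0.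
Proof.
elim: N => // N IH; rewrite ltnS leq_eqVlt => /predU1P[->|nN].
  by apply: deflation_vec0; [exact: cholesky_bounded|exact: cholesky_positive].
apply: qf_null; [exact: cholesky_bounded|exact: cholesky_positive|].
apply/eqP; rewrite eq_le qf_ge0 ?andbT; last exact: cholesky_positive.
rewrite /Dn /= qf_deflation -/Dn /qf IH // linear0l /= sub0r.
by rewrite oppr_le0 abs2_ge0.
Qed.

End Fixed.

(** Pick [u n] close to [x]. After step [n] the form vanishes at [u n], so its value at [x] is at
    most twice that at [x - u n], where the original bound [C] of [D] applies. *)
Lemma qf_cholesky_lim D (u : nat -> V) x (e : R) : bounded_op D -> positive_op D ->
  (forall y (e : R), 0 < e -> exists n, nsq (y - u n) < e) -> 0 < e ->
  exists N : nat, forall n, (N <= n)%N -> qf (cholesky D u n) x <= e.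
Proof.
move=> bD pD du e0; have [C C0 DC] := qf_bound bD.
have C2 : 0 < 2 * C by rewrite mulr_gt0.
have [n xn] := du x _ (divr_gt0 e0 C2); exists n.+1 => N nN.
have bDN := cholesky_bounded u bD N; have pDN := cholesky_positive u bD pD N.
rewrite -[x](subrK (u n)).
apply: le_trans (qf_leD _ _ bDN.1 pDN) _.
rewrite {2}/qf cholesky_vec0 // linear0l /= mulr0 addr0.
have : qf (cholesky D u N) (x - u n) <= qf D (x - u n).
  by rewrite qf_cholesky gerBl sumr_ge0 // => i _; exact: abs2_ge0.
have := DC (x - u n); rewrite ltr_pdivlMr // in xn.
by move: (qf _ _) (qf _ _) (nsq _) xn => a b c; lra.
Qed.

(* Zero vectors are allowed, so that finite-dimensional spaces have such a basis. *)
Definition onbasis (e : nat -> V) : Prop :=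
  [/\ forall s t, s != t -> '[e s, e t] = 0,
      forall s, e s = 0 \/ '[e s, e s] = 1
    & forall x, tends (fun N => \sum_(n < N) '[x, e n] *: e n) x].

(** Gram-Schmidt, obtained as the elimination of the identity: the deflation vectors are the basis,
    and a redundant [u n] contributes a zero vector. *)
Lemma exists_onbasis : exists e, onbasis e.
Proof.
have [u du] := nsq_dense (V := V).
set D := cholesky id u; pose d := cholesky_vector id u.
have bi := bounded_id V; have pi := @positive_id R V.
have bD n : bounded_op (D n) := cholesky_bounded u bi n.
have pD n : positive_op (D n) := cholesky_positive u bi pi n.
have hD n := positive_hermitian (bD n).1 (pD n).
(* [d m] is a combination of [u m] and earlier [d i], all of which later remainders kill;
   orthogonality follows because [d n] lies in the range of the hermitian [D n]. *)
have Dd m n : (m < n)%N -> D n (d m) = 0.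
  elim/ltn_ind: m => m IH mn; rewrite /d /cholesky_vector /deflation_vector (linZ (bD n).1).
  rewrite (cholesky_sum id u m) (linB (bD n).1) (cholesky_vec0 u bi pi mn : D n (u m) = 0).
  rewrite (lin_sum (bD n).1).
  rewrite big1 ?subrr ?scaler0 // => i _.
  by rewrite (linZ (bD n).1) IH ?scaler0 // (ltn_trans _ mn).
have ort m n : (m < n)%N -> '[d n, d m] = 0.
  move=> mn; rewrite [d n]/d /cholesky_vector /deflation_vector linearZl_LR /=.
  by rewrite -/D hD -/(d m) Dd // linear0r mulr0.
exists d; split=> [s t|s|x e e0].
- case: ltngtP => // [st|ts] _; last exact: ort.
  by rewrite hdotC ort // rmorph0.
- have [q0|q0] := eqVneq (qf (D s) (u s)) 0.
    by left; rewrite /d /cholesky_vector /deflation_vector q0 sqrtr0 invr0 scale0r.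
  right; rewrite nsqE /d /cholesky_vector /deflation_vector nsqZ abs2_real -/D.
  rewrite exprVn sqr_sqrtr ?qf_ge0 //.
  suff -> : nsq (D s (u s)) = qf (D s) (u s) by rewrite mulVf // rmorph1.
  rewrite /nsq [X in '[X, _]]cholesky_sum linearBl /= ReB.
  rewrite (lin_sum (T := hdot^~ _)); last by move=> c y z; rewrite linearPl.
  rewrite big1 ?subr0 => [|i _]; first by rewrite /qf hD.
  by rewrite linearZl_LR /= -hD -/(d i) Dd // linear0l mulr0.
(* The remainder of the expansion is [D n x], and [D n <= id] bounds its squared norm by its form,
   which tends to 0. *)
have [N h] := qf_cholesky_lim x bi pi du (divr_gt0 e0 (ltr0Sn R 1)).
exists N => n /h {}h; rewrite nsqBC -cholesky_sum -/D in h *.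
apply: le_lt_trans (_ : _ <= e / 2) _; last by lra.
apply: le_trans h; rewrite -[leRHS]mul1r; apply: nsq_le_qf => // y.
  exact: (bD n).1.
by rewrite mul1r qf_cholesky gerBl sumr_ge0 // => i _; exact: abs2_ge0.
Qed.

End Cholesky.

(** * Series over Bessel systems and orthonormal bases *)

Section Series.
Context {R : realType}.

Lemma sum_ord_cat (V : nmodType) (f : nat -> V) p q : (p <= q)%N ->
  \sum_(n < q) f n = \sum_(n < p) f n + \sum_(p <= n < q) f n.
Proof.
move=> pq; rewrite -(big_mkord xpredT f) -(big_mkord xpredT f).
by rewrite (big_cat_nat (n := p)).
Qed.

Lemma partial_sums_cauchy (f : nat -> R) (S e : R) : (forall n, 0 <= f n) ->
  (forall N, \sum_(n < N) f n <= S) -> 0 < e ->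
  exists N : nat, forall p q : nat, (N <= p <= q)%N -> \sum_(p <= n < q) f n < e.
Proof.
move=> f0 fS e0; pose E := range (fun N => \sum_(n < N) f n).
have supE : has_sup E.
  by split; [exists (\sum_(n < 0) f n), 0%N|exists S => _ [N _ <-]].
have [_ [N _ <-] hN] := sup_adherent e0 supE.
exists N => p q /andP[Np pq].
have mono a b : (a <= b)%N -> \sum_(n < a) f n <= \sum_(n < b) f n.
  by move=> ab; rewrite (sum_ord_cat _ ab) lerDl sumr_ge0.
have : \sum_(n < q) f n <= sup E by apply: ub_le_sup; [case: supE|exists q].
rewrite (sum_ord_cat _ pq) => h.
have := mono _ _ Np; lra.
Qed.

Lemma sum_subrange (V : zmodType) (f : nat -> V) p q : (p <= q)%N ->
  \sum_(n < q) f n - \sum_(n < p) f n = \sum_(p <= n < q) f n.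
Proof. by move=> pq; rewrite (sum_ord_cat _ pq) addrAC subrr add0r. Qed.

Context {V : hilbertType R}.

(** The analysis map [y |-> (<y, v_n>)_n] into l^2 has squared norm at most [C]; dually,
    [sum c_n v_n] converges for square-summable [c]. *)
Definition bessel (C : R) (v : nat -> V) : Prop :=
  forall y N, \sum_(n < N) abs2 '[y, v n] <= C * nsq y.

Lemma dot_suml I (r : seq I) (P : pred I) (F : I -> V) y :
  '[\sum_(i <- r | P i) F i, y] = \sum_(i <- r | P i) '[F i, y].
Proof. by apply: (lin_sum (T := hdot^~ y)) => c u v; rewrite linearPl. Qed.

Lemma dot_sumr I (r : seq I) (P : pred I) (F : I -> V) y :
  '[y, \sum_(i <- r | P i) F i] = \sum_(i <- r | P i) '[y, F i].
Proof.
by rewrite hdotC dot_suml rmorph_sum; apply: eq_bigr => i _; rewrite [RHS]hdotC.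
Qed.

(* With w the sum on the left, [nsq w = Re (sum c_n <v_n, w>)] is bounded by
   AM-GM and the Bessel property applied to w. *)
Lemma bessel_combination (C : R) (v : nat -> V) (c : nat -> R[i]) p q : 0 < C ->
  bessel C v -> (p <= q)%N ->
  nsq (\sum_(p <= n < q) c n *: v n) <= C * \sum_(p <= n < q) abs2 (c n).
Proof.
move=> C0 bv pq; set w := \sum_(p <= n < q) _.
have ww : nsq w = \sum_(p <= n < q) complex.Re (c n * '[v n, w]).
  rewrite /nsq {1}/w dot_suml Re_sum; apply: eq_bigr => n _.
  by rewrite linearZl_LR.
have bw : \sum_(p <= n < q) abs2 '[w, v n] <= C * nsq w.
  apply: le_trans (bv w q); rewrite (sum_ord_cat (fun n => abs2 '[w, v n]) pq) lerDr.
  by rewrite sumr_ge0 // => i _; exact: abs2_ge0.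
have amgm (z y : R[i]) : C * complex.Re (z * y^*) * 2 <= C ^+ 2 * abs2 z + abs2 y.
  case: z y => a b [r s]; rewrite /abs2 /=.
  have := sqr_ge0 (C * a - r); have := sqr_ge0 (C * b - s); nra.
have : C * nsq w * 2 <= C ^+ 2 * (\sum_(p <= n < q) abs2 (c n)) + \sum_(p <= n < q) abs2 '[w, v n].
  rewrite ww !mulr_sumr mulr_suml -big_split /= ler_sum // => n _.
  by rewrite hdotC; exact: amgm.
rewrite -[nsq w <= _](ler_pM2l C0).
by move: (nsq w) bw (\sum_(p <= n < q) abs2 (c n)) => a bw s; rewrite expr2; lra.
Qed.

Lemma synthesis (C S : R) (v : nat -> V) (c : nat -> R[i]) : 0 < C -> bessel C v ->
  (forall N, \sum_(n < N) abs2 (c n) <= S) ->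
  exists2 l, tends (fun N => \sum_(n < N) c n *: v n) l & nsq l <= C * S.
Proof.
move=> C0 bv cS.
have [l h] : exists l, tends (fun N => \sum_(n < N) c n *: v n) l.
  apply: nsq_complete => e e0.
  have [N h] := partial_sums_cauchy (fun n => abs2_ge0 (c n)) cS (divr_gt0 e0 C0).
  exists N.
  have hlt p q : (N <= p)%N -> (p <= q)%N ->
      nsq (\sum_(n < q) c n *: v n - \sum_(n < p) c n *: v n) < e.
    move=> Np pq; rewrite (sum_subrange (fun n => c n *: v n) pq).
    apply: le_lt_trans (bessel_combination _ C0 bv pq) _.
    by rewrite mulrC -ltr_pdivlMr // h // Np.
  move=> p q Np Nq; have [pq|/ltnW qp] := leqP p q; last exact: hlt.
  by rewrite nsqBC; exact: hlt.
exists l => //; apply: (tends_nsq_le h); exists 0%N => N _.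
rewrite -(big_mkord xpredT (fun n => c n *: v n)).
apply: le_trans (bessel_combination _ C0 bv (leq0n N)) _.
by rewrite ler_pM2l // big_mkord.
Qed.

Definition orthosystem (e : nat -> V) : Prop :=
  (forall s t, s != t -> '[e s, e t] = 0) /\ forall s, e s = 0 \/ '[e s, e s] = 1.

Lemma onbasis_orthosystem e : onbasis e -> orthosystem e.
Proof. by case. Qed.

Lemma orthosystem_residue e x N : orthosystem e ->
  \sum_(n < N) abs2 '[x, e n] = nsq x - nsq (x - \sum_(n < N) '[x, e n] *: e n).
Proof.
move=> [eo e1]; elim: N => [|N IH]; first by rewrite !big_ord0 subr0 subrr.
rewrite !big_ord_recr /= IH; set r := x - \sum_(n < N) _.
have re : '[r, e N] = '[x, e N].
  rewrite /r linearBl /= dot_suml big1 ?subr0 // => i _.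
  by rewrite linearZl_LR /= eo ?mulr0 // neq_ltn ltn_ord.
have -> : x - (\sum_(i < N) '[x, e i] *: e i + '[x, e N] *: e N) = r - '[x, e N] *: e N.
  by rewrite opprD addrA.
clearbody r; rewrite nsqB nsqZ linearZr_LR /= re.
have [->|h] := e1 N; first by rewrite linear0r nsq0 abs2_0 /= !mulr0 /=; ring.
rewrite /(nsq (e N)) h /= [X in complex.Re X]mulrC -abs2E /=; ring.
Qed.

Lemma orthosystem_bessel e : orthosystem e -> bessel 1 e.
Proof.
by move=> eo x N; rewrite mul1r orthosystem_residue // gerBl nsq_ge0.
Qed.

(** Bessel's inequality makes the expansion of [x] converge; its limit has the coefficients of [x],
    so totality identifies the two. *)
Lemma orthosystem_total_onbasis e : orthosystem e ->
  (forall x, (forall n, '[x, e n] = 0) -> x = 0) -> onbasis e.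
Proof.
move=> eo tot; split; [exact: eo.1|exact: eo.2|move=> x].
have [l xl _] := synthesis (c := fun n => '[x, e n]) ltr01 (orthosystem_bessel eo)
  (orthosystem_bessel eo x).
suff xl' : x = l by rewrite {2}xl'.
apply/eqP; rewrite -subr_eq0; apply/eqP/tot => n; apply/eqP.
rewrite linearBl subr_eq0 /=; apply/eqP/esym.
apply: (tends_dot_eq xl); exists n.+1 => N nN.
rewrite dot_suml (bigD1 (Ordinal nN)) //= linearZl_LR /= big1 ?addr0.
  by have [->|->] := eo.2 n; rewrite ?linear0r ?mulr0 ?mulr1.
by move=> i ni; rewrite linearZl_LR /= eo.1 ?mulr0.
Qed.

(** The bridge from epsilon estimates on partial sums to unordered sums in [\bar R], in which all
    later energies are expressed. *)
Lemma esum_nat_lim (f : nat -> R) (S : R) : (forall n, 0 <= f n) ->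
  (forall N, \sum_(n < N) f n <= S) ->
  (forall e : R, 0 < e -> exists N : nat, S <= \sum_(n < N) f n + e) ->
  (\esum_(n in [set: nat]) (f n)%:E = S%:E)%E.
Proof.
move=> f0 fS Sf; rewrite -nneseries_esumT => [|n]; last by rewrite lee_fin.
have sumE N : (\sum_(0 <= n < N) (f n)%:E = (\sum_(n < N) f n)%:E)%E.
  by rewrite sumEFin big_mkord.
apply/eqP; rewrite eq_le; apply/andP; split.
  apply: lime_le; last by apply: nearW => N; rewrite sumE lee_fin.
  by apply: is_cvg_nneseries => n _ _; rewrite lee_fin.
apply/lee_addgt0Pr => e /Sf[N h].
apply: le_trans (_ : (\sum_(n < N) f n)%:E + e%:E <= _)%E; first by rewrite -EFinD lee_fin.
by rewrite leeD2r // -sumE; apply: nneseries_lim_ge => n _; rewrite lee_fin.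
Qed.

Lemma onbasis_parseval (e : nat -> V) (x : V) : onbasis e ->
  (\esum_(n in [set: nat]) (abs2 '[x, e n])%:E = (nsq x)%:E)%E.
Proof.
move=> he; have eo := onbasis_orthosystem he.
apply: esum_nat_lim => [n|N|r r0]; first exact: abs2_ge0.
  by have := orthosystem_bessel eo x N; rewrite mul1r.
have [_ _ /(_ x _ r0)[N /(_ N (leqnn N))]] := he.
by rewrite nsqBC => h; exists N; rewrite orthosystem_residue //; lra.
Qed.

End Series.

(** * Existence and calculus of adjoints *)

Section Adjoint.
Context {R : realType}.
Implicit Types U V W : hilbertType R.

(** Adjoints, weighted shifts and the intertwiners [L_t] are all obtained from this one
    construction. *)
Lemma synthesis_op U V (B C : R) (phi : nat -> U -> R[i]) (v : nat -> V) :
  0 < C -> 0 <= B -> bessel C v -> (forall n, scalar (phi n)) ->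
  (forall x N, \sum_(n < N) abs2 (phi n x) <= B * nsq x) ->
  exists2 A : U -> V, bounded_op A &
    forall x, tends (fun N => \sum_(n < N) phi n x *: v n) (A x).
Proof.
move=> C0 B0 bv lphi phiB.
have /choice[A hA] x : exists l, tends (fun N => \sum_(n < N) phi n x *: v n) l /\ nsq l <= C * (B * nsq x).
  by have [l] := synthesis (c := phi^~ x) C0 bv (phiB x); exists l.
exists A => [|x]; last by have [] := hA x.
apply/bounded_opP; split=> [c x y|].
  apply: tends_unique (proj1 (hA _)) _.
  have := tends_lin c (proj1 (hA x)) (proj1 (hA y)); congr tends.
  apply/funext => N; rewrite scaler_sumr -big_split /=; apply: eq_bigr => n _.
  by rewrite lphi scalerDl scalerA.
exists (C * B) => [|x]; first by rewrite mulr_ge0 // ltW.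
by rewrite -mulrA; case: (hA x).
Qed.

(** The adjoint is written down in a basis as [y |-> sum_n <y, T e_n> e_n]; the point is that these
    coefficients are square-summable. *)
Lemma adjoint_exists U V (T : U -> V) : bounded_op T ->
  exists2 A : V -> U, bounded_op A & forall x y, '[T x, y] = '[x, A y].
Proof.
move=> bT; have /bounded_opP[lT [c c0 Tc]] := bT.
have [e he] := exists_onbasis (V := U); have eo := onbasis_orthosystem he.
have [||A bA hA] := @synthesis_op V U c 1 (fun n y => '[y, T (e n)]) e ltr01 c0 (orthosystem_bessel eo).
- by move=> n a x y; rewrite linearPl.
(* Testing against [z = sum_{n<N} <y, T e_n> e_n] gives [<y, T z> = s], and Cauchy-Schwarz with
   [nsq z <= s] yields [s^2 <= c (nsq y) s], where one factor [s] cancels. *)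
- move=> y N; set s := \sum_(n < N) _.
  have s0 : 0 <= s by rewrite sumr_ge0 // => i _; exact: abs2_ge0.
  pose z := \sum_(n < N) '[y, T (e n)] *: e n.
  have zs : nsq z <= s.
    have := bessel_combination (fun n => '[y, T (e n)]) ltr01 (orthosystem_bessel eo) (leq0n N).
    by rewrite mul1r !big_mkord.
  have yTz : '[y, T z] = s%:C%C.
    rewrite (lin_sum lT) dot_sumr /s rmorph_sum; apply: eq_bigr => n _.
    by rewrite (linZ lT) linearZr_LR /= mulrC abs2E.
  have := abs2_dot y (T z); rewrite yTz abs2_real => h.
  have {}h : s * s <= (c * nsq y) * s.
    rewrite -expr2; apply: le_trans h _; rewrite mulrAC [leRHS]mulrC.
    by apply: ler_wpM2l; rewrite ?nsq_ge0 //; apply: le_trans (Tc z) _; rewrite ler_wpM2l.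
  have [<-|s1] := eqVneq 0 s; first by rewrite mulr_ge0 ?nsq_ge0.
  by move: h; rewrite ler_pM2r // lt_def eq_sym s1.
exists A => // x y; have [_ _ hx] := he.
have E N : '[T (\sum_(n < N) '[x, e n] *: e n), y] = '[x, \sum_(n < N) '[y, T (e n)] *: e n].
  rewrite (lin_sum lT) dot_suml dot_sumr; apply: eq_bigr => n _.
  by rewrite (linZ lT) linearZl_LR linearZr_LR /= mulrC -hdotC.
apply/eqP; rewrite -subr_eq0; apply/eqP; apply: (@abs2_eps0 R _ 4) => r r0.
have [N1 h1] := tends_dot y r0 (bounded_tends bT (hx x)).
have [N2 h2] := tends_dot x r0 (hA y).
have {}h1 := h1 _ (leq_maxl N1 N2); have {}h2 := h2 _ (leq_maxr N1 N2).
rewrite /= E in h1; rewrite -abs2J rmorphB /= -!hdotC in h2.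
rewrite -opprB abs2N in h1.
rewrite -['[T x, y]](subrK ('[x, \sum_(n < maxn N1 N2) '[y, T (e n)] *: e n])) -addrA.
apply: le_trans (abs2_leD _ _) _.
by move: h1 h2; move: (abs2 _) (abs2 _) => a b; lra.
Qed.

Lemma the_opP U V (P : set (U -> V)) T : P T -> P (the_op P).
Proof. by move=> PT; apply: (xgetPex _ (ex_intro _ T PT)). Qed.

Lemma dot_inj V (x y : V) : (forall z, '[x, z] = '[y, z]) -> x = y.
Proof.
move=> h; apply/eqP; rewrite -subr_eq0; apply/eqP/nsq_eq0.
by rewrite /nsq linearBl /= h subrr.
Qed.

Lemma dot_injr V (x y : V) : (forall z, '[z, x] = '[z, y]) -> x = y.
Proof. by move=> h; apply: dot_inj => z; rewrite hdotC h -hdotC. Qed.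

Lemma adjointE U V (T : U -> V) x y : bounded_op T -> '[T x, y] = '[x, adjoint T y].
Proof. by move=> /adjoint_exists[A _ hA]; apply: (the_opP (P := [set T1 | forall x y, _ = '[x, T1 y]]) hA). Qed.

Lemma adjoint_eq U V (T : U -> V) A : (forall x y, '[T x, y] = '[x, A y]) -> adjoint T = A.
Proof.
move=> hA; apply/funext => y; apply: dot_injr => z.
by rewrite -hA -(the_opP (P := [set T1 | forall x y, _ = '[x, T1 y]]) hA).
Qed.

Lemma adjointEr U V (T : U -> V) x y : bounded_op T -> '[adjoint T y, x] = '[y, T x].
Proof. by move=> bT; rewrite hdotC -adjointE // -hdotC. Qed.

Lemma adjoint_bounded U V (T : U -> V) : bounded_op T -> bounded_op (adjoint T).
Proof. by move=> /adjoint_exists[A bA /adjoint_eq ->]. Qed.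

Lemma adjoint_comp U V W (S : V -> W) (T : U -> V) : bounded_op S -> bounded_op T ->
  adjoint (S \o T) = adjoint T \o adjoint S.
Proof. by move=> bS bT; apply: adjoint_eq => x y; rewrite /= !adjointE. Qed.

Lemma adjoint_id V : adjoint (@id V) = id.
Proof. exact: adjoint_eq. Qed.

Lemma adjointK U V (T : U -> V) : bounded_op T -> adjoint (adjoint T) = T.
Proof. by move=> bT; apply: adjoint_eq => x y; rewrite adjointEr. Qed.

Definition total_set V (A : set V) : Prop :=
  forall z, (forall x, A x -> '[z, x] = 0) -> z = 0.

Lemma closed_span_total V (A : set V) : closed_span A = setT -> total_set A.
Proof.
move=> h z zA; have : closed_span A z by rewrite h.
move=> [u uA /hcvgP uz]; apply: nsq_eq0; rewrite /nsq (_ : '[z, z] = 0) //.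
apply: (tends_dot_eq uz); exists 0%N => N _.
have [d [c [v [Av ->]]]] := uA N; rewrite dot_suml big1 // => i _.
by rewrite linearZl_LR /= hdotC zA ?rmorph0 ?mulr0.
Qed.

(** Passing to adjoints turns agreement on [A] into orthogonality of the difference of the adjoints
    to [A], so no approximation by linear combinations has to be carried out. *)
Lemma total_eq U V (A : set U) (S T : U -> V) : total_set A -> bounded_op S ->
  bounded_op T -> (forall x, A x -> S x = T x) -> S = T.
Proof.
move=> tA bS bT ST; apply/funext => x; apply: dot_inj => y.
rewrite !adjointE //; congr '[_, _]; apply/eqP; rewrite -subr_eq0; apply/eqP/tA => a Aa.
by rewrite linearBl /= !adjointEr // ST // subrr.
Qed.

End Adjoint.

Section Projection.
Context {R : realType} {V : hilbertType R} (A : closedSubspace V).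
Let iota : hsubspace A -> V := val.

Lemma hsubspace_dotE (x y : hsubspace A) : '[x, y] = '[val x, val y].
Proof. by []. Qed.

Lemma hsubspace_nsqE (x : hsubspace A) : nsq x = nsq (val x).
Proof. by []. Qed.

Lemma val_bounded : bounded_op iota.
Proof.
apply/bounded_opP; split=> [c x y|]; first by rewrite /iota linearP.
by exists 1 => // x; rewrite mul1r.
Qed.

(** The existence of orthogonal projections is deduced from that of adjoints: the adjoint of the
    inclusion satisfies the defining condition. *)
Lemma orth_projE : orth_proj A = adjoint iota.
Proof.
apply/funext => x; apply: dot_inj => z; rewrite adjointEr; last exact: val_bounded.
have H : exists y : hsubspace A, forall z : hsubspace A, '[x - val y, val z] = 0.
  exists (adjoint iota x) => {}z; rewrite linearBl /= -hsubspace_dotE.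
  by rewrite adjointEr ?subrr //; exact: val_bounded.
have := xgetPex 0 H; rewrite -/(orth_proj A x) => /(_ z) /eqP.
by rewrite linearBl subr_eq0 /= => /eqP ->.
Qed.

Lemma orth_proj_bounded : bounded_op (orth_proj A).
Proof. by rewrite orth_projE; apply: adjoint_bounded; exact: val_bounded. Qed.

Lemma orth_proj_dot x (y : hsubspace A) : '[orth_proj A x, y] = '[x, val y].
Proof. by rewrite orth_projE adjointEr //; exact: val_bounded. Qed.

Lemma orth_proj_val (x : hsubspace A) : orth_proj A (val x) = x.
Proof. by apply: dot_inj => y; rewrite orth_proj_dot. Qed.

Lemma in_hsubspace x : cs_set A x -> exists y : hsubspace A, val y = x.
Proof.
move=> Ax; have h : x \in hsubspace_pred A by rewrite unfold_in in_setE.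
by exists (exist _ x h).
Qed.

Lemma orth_proj_in x : cs_set A x -> val (orth_proj A x) = x.
Proof. by move=> /in_hsubspace[y <-]; rewrite orth_proj_val. Qed.

Lemma orth_proj_orth x : orth_set A x -> orth_proj A x = 0.
Proof.
move=> Ax; apply: dot_inj => y; rewrite orth_proj_dot linear0l.
by apply: Ax; exact: hsubspace_val.
Qed.

Lemma projection_in x : cs_set A (projection A x).
Proof. exact: hsubspace_val. Qed.

Lemma projection_bounded : bounded_op (projection A).
Proof. exact: (bounded_comp val_bounded orth_proj_bounded). Qed.

Lemma projection_dot x y : '[projection A x, y] = '[orth_proj A x, orth_proj A y].
Proof. by rewrite hdotC -orth_proj_dot -hdotC. Qed.

Lemma projection_hermitian : hermitian_op (projection A).
Proof. by move=> x y; rewrite projection_dot hdotC -projection_dot -hdotC. Qed.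

Lemma qf_projection x : qf (projection A) x = nsq (orth_proj A x).
Proof. by rewrite /qf projection_dot. Qed.

Lemma projection_positive : positive_op (projection A).
Proof. by move=> x; rewrite projection_dot hdot_ge0. Qed.

Lemma nsq_orth_proj x : nsq (orth_proj A x) <= nsq x.
Proof.
have := nsq_ge0 (x - val (orth_proj A x)); rewrite nsqB -orth_proj_dot.
by rewrite -[nsq (val _)]hsubspace_nsqE -/(nsq _); lra.
Qed.

End Projection.

(** * The maps Phi as sums of quadratic forms *)

Section NonnegativeSums.
Context {R : realType}.
Local Open Scope ereal_scope.

Lemma esumZl (T : choiceType) (I : set T) (c : R) (f : T -> \bar R) : (0 <= c)%R ->
  (forall i, 0 <= f i) ->
  \esum_(i in I) (c%:E * f i) = c%:E * \esum_(i in I) f i.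
Proof.
have le (c' : R) (g : T -> \bar R) : (0 <= c')%R -> (forall i : T, 0 <= g i) ->
    \esum_(i in I) (c'%:E * g i) <= c'%:E * \esum_(i in I) g i.
  move=> c0 g0; apply: ge_ereal_sup => _ [X [finX XI]] <-.
  rewrite -ge0_mule_fsumr //; apply: lee_wpmul2l; first by rewrite lee_fin.
  by apply: ereal_sup_ubound; exists X.
move=> c0 f0; apply/eqP; rewrite eq_le le //=.
have [->|cn0] := eqVneq c 0%R.
  by rewrite mul0e esum_ge0 // => i _; rewrite mul0e.
have c1 : (0 < c)%R by rewrite lt_def cn0.
have c2 : (0 <= c^-1)%R by rewrite invr_ge0.
have cf0 i : 0 <= c%:E * f i by rewrite mule_ge0 ?lee_fin.
have := le c^-1%R (fun i => c%:E * f i) c2 cf0.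
under eq_esum do rewrite muleA -EFinM mulVf // mul1e.
move=> /(lee_wpmul2l (_ : 0 <= c%:E)); rewrite lee_fin => /(_ c0).
by rewrite muleA -EFinM mulfV // mul1e.
Qed.

Lemma esum_ord (N : nat) (f : nat -> \bar R) : (forall i, 0 <= f i) ->
  \esum_(i in [set l | (l < N)%N]) f i = \sum_(i < N) f i.
Proof. by move=> f0; rewrite esum_fset ?fsbig_ord //; exact: finite_II. Qed.

Lemma esum_fin (T : finType) (f : T -> \bar R) : (forall i, 0 <= f i) ->
  \esum_(i in [set: T]) f i = \sum_(i : T) f i.
Proof.
move=> f0; rewrite esum_fset //; last exact: finite_finset.
rewrite (fsbigE (index_enum T)) ?index_enum_uniq //.
  by apply: eq_bigl => i; rewrite in_setT.
by move=> i _; rewrite mem_index_enum.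
Qed.

Lemma esum_exchange (T U : choiceType) (f : T -> U -> \bar R) :
  (forall i j, 0 <= f i j) ->
  \esum_(i in [set: T]) \esum_(j in [set: U]) f i j =
  \esum_(j in [set: U]) \esum_(i in [set: T]) f i j.
Proof.
move=> f0; rewrite !esum_esum //.
rewrite (reindex_esum ([set: U] `*`` fun=> [set: T]) _ (fun k => (k.2, k.1))) //.
split; first by move=> [].
  by move=> [a b] [c d] _ _ [-> ->].
by move=> [a b] _; exists (b, a).
Qed.

(** The pairs of words with concatenation [w] are the [size w + 1] cuts of [w]; this turns iterated
    sums over words into convolutions. *)
Lemma esum_splits (A : choiceType) (G : seq A -> seq A -> \bar R) :
  (forall u v, 0 <= G u v) ->
  \esum_(u in [set: seq A]) \esum_(v in [set: seq A]) G u v =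
  \esum_(w in [set: seq A]) \sum_(l < (size w).+1) G (take l w) (drop l w).
Proof.
move=> G0; rewrite esum_esum //.
under [RHS]eq_esum do rewrite -(esum_ord _ (fun i => G0 (take i _) (drop i _))).
rewrite [RHS]esum_esum //.
rewrite (reindex_esum ([set: seq A] `*`` (fun w => [set l | (l < (size w).+1)%N])) _
  (fun k => (take k.2 k.1, drop k.2 k.1))) //.
split=> //.
  move=> [u i] [v j]; rewrite !inE /= !ltnS => -[_ iu] [_ jv] [h1 h2].
  have e : u = v by rewrite -(cat_take_drop i u) h1 h2 cat_take_drop.
  by move: (congr1 size h1); rewrite !size_takel // => ->; rewrite e.
move=> [u v] _; exists (u ++ v, size u); last by rewrite /= take_size_cat // drop_size_cat.
by rewrite /= ltnS size_cat leq_addr.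
Qed.

(** Groups words by length, in accordance with the order of summation in [Phi_partial]. *)
Lemma esum_words (n : nat) (f : word n -> \bar R) : (forall w, 0 <= f w) ->
  \esum_(w in [set: word n]) f w =
  \sum_(0 <= p <oo) \sum_(w : p.-tuple 'I_n) f w.
Proof.
move=> f0; rewrite nneseries_esumT => [|p]; last by rewrite sume_ge0.
have E p : \sum_(w : p.-tuple 'I_n) f w = \esum_(w in [set w | size w = p]) f w.
  rewrite -(esum_fin (fun w : p.-tuple 'I_n => f0 w)).
  rewrite (reindex_esum [set: p.-tuple 'I_n] _ (@tval p 'I_n)) //; split=> /=.
  - by move=> w _; exact: size_tuple.
  - by move=> u v _ _ /val_inj.
  - by move=> w /eqP wp; exists (Tuple wp).
under [RHS]eq_esum do rewrite E.
rewrite [RHS]esum_esum // (reindex_esum ([set: nat] `*`` (fun p => [set w : word n | size w = p])) _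
  snd) //; split=> //=.
- by move=> [p u] [q v]; rewrite !inE /= => -[_ <-] [_ <-] ->.
- by move=> w _; exists (size w, w).
Qed.

End NonnegativeSums.

Lemma tends_Re (R : realType) (V : hilbertType R) (u : nat -> V) l y (e : R) :
  0 < e -> tends u l -> exists N : nat, forall n, (N <= n)%N ->
    `|complex.Re '[u n, y] - complex.Re '[l, y]| < e.
Proof.
move=> e0 ul; have [N h] := tends_dot y (exprn_gt0 2 e0) ul.
exists N => n /h {}h; rewrite -ReB -(@ltr_sqr R) ?nnegrE ?(ltW e0) //.
rewrite real_normK ?num_real //; apply: le_lt_trans h.
by rewrite /abs2 lerDl sqr_ge0.
Qed.

Section MonotoneLimits.
Context {R : realType} {V : hilbertType R}.

Lemma positive_sub (Y Z : V -> V) : linear Y -> linear Z -> positive_op Y ->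
  positive_op Z -> (forall x, qf Y x <= qf Z x) ->
  positive_op (fun x => Z x - Y x).
Proof.
move=> lY lZ pY pZ YZ x.
by rewrite linearBl /= !positive_qf // -rmorphB /= ler0c subr_ge0.
Qed.

(** For a positive operator below [C], [nsq] of an image is at most [C] times the form. Applied to
    [A q - A p], this makes [A N x] Cauchy, because the increments of the bounded form telescope. *)
Lemma monotone_ops_limit (A : nat -> V -> V) (C : R) : 0 < C ->
  (forall N, bounded_op (A N)) -> (forall N, positive_op (A N)) ->
  (forall x p q, (p <= q)%N -> qf (A p) x <= qf (A q) x) ->
  (forall N x, qf (A N) x <= C * nsq x) ->
  exists Z, [/\ bounded_op Z, positive_op Z & forall x, tends (fun N => A N x) (Z x)].
Proof.
move=> C0 bA pA mA AC.
have /choice[Z hZ] x : exists l, tends (fun N => A N x) l.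
  apply: nsq_complete => e e0.
  have inc p q : (p <= q)%N -> nsq (A q x - A p x) <= C * (qf (A q) x - qf (A p) x).
    move=> pq; rewrite -qfB; apply: (@nsq_le_qf _ _ (fun x => A q x - A p x)) => // [||y].
    - exact: (bounded_sub (bA q) (bA p)).1.
    - by apply: positive_sub => // [||y]; [exact: (bA p).1|exact: (bA q).1|exact: mA].
    - by rewrite qfB; apply: le_trans (AC q y); rewrite gerBl qf_ge0.
  pose f n := qf (A n.+1) x - qf (A n) x.
  have f0 n : 0 <= f n by rewrite subr_ge0 mA.
  have fE p q : (p <= q)%N -> \sum_(p <= n < q) f n = qf (A q) x - qf (A p) x.
    by move=> pq; rewrite telescope_sumr.
  have fC N : \sum_(n < N) f n <= C * nsq x.
    rewrite -(big_mkord xpredT f) fE //; apply: le_trans (AC N x).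
    by rewrite gerBl qf_ge0.
  have [N hN] := partial_sums_cauchy f0 fC (divr_gt0 e0 C0).
  have hlt p q : (N <= p)%N -> (p <= q)%N -> nsq (A q x - A p x) < e.
    move=> Np pq; apply: le_lt_trans (inc _ _ pq) _.
    by rewrite -fE // mulrC -ltr_pdivlMr // hN // Np.
  exists N => p q Np Nq; have [pq|/ltnW qp] := leqP p q; last exact: hlt.
  by rewrite nsqBC; exact: hlt.
exists Z; split=> //; last first.
  move=> x; have : 0 <= complex.Re '[Z x, x].
    apply/ler_addgt0Pr => e e0; have [N /(_ N (leqnn N))] := tends_Re x e0 (hZ x).
    by have := qf_ge0 x (pA N); rewrite /qf ltr_norml => ? /andP[? ?]; lra.
  have : complex.Im '[Z x, x] ^+ 2 <= 0.
    apply: (@le_eps _ _ _ 1) => e e0; have [N /(_ N (leqnn N))] := tends_dot x e0 (hZ x).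
    rewrite positive_qf //; case: ('[Z x, x]) => r s; rewrite /abs2 /= sub0r sqrrN.
    by have := sqr_ge0 (qf (A N) x - r); lra.
  rewrite le_eqVlt ltNge sqr_ge0 orbF sqrf_eq0.
  by rewrite lecE /= => -> ->.
apply/bounded_opP; split=> [c x y|].
  apply: tends_unique (hZ _) _; have := tends_lin c (hZ x) (hZ y).
  by congr tends; apply/funext => N; rewrite (bA N).1.
exists (C * C) => [|x]; first by rewrite mulr_ge0 // ltW.
apply: (tends_nsq_le (hZ x)); exists 0%N => N _.
rewrite -mulrA; apply: le_trans (nsq_le_qf (bA N).1 (pA N) C0 (AC N) x) _.
by rewrite ler_pM2l.
Qed.

End MonotoneLimits.

Section WordOperators.
Context {R : realType} {n : nat} {V : hilbertType R}.
Context (X : 'I_n -> V -> V) (bX : forall j, bounded_op (X j)).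

Lemma word_op_cat u v : word_op X (u ++ v) = word_op X u \o word_op X v.
Proof. by elim: u => //= j u IH; rewrite IH. Qed.

Lemma word_op_bounded w : bounded_op (word_op X w).
Proof. by elim: w => [|j w IH]; [exact: bounded_id|exact: bounded_comp]. Qed.

Definition word_adj w : V -> V := adjoint (word_op X w).

Lemma word_adj_bounded w : bounded_op (word_adj w).
Proof. by apply: adjoint_bounded; exact: word_op_bounded. Qed.

Lemma word_adj_cat u v : word_adj (u ++ v) = word_adj v \o word_adj u.
Proof. by rewrite /word_adj word_op_cat adjoint_comp //; exact: word_op_bounded. Qed.

Lemma word_adj_nil : word_adj [::] = id.
Proof. exact: adjoint_id. Qed.

Lemma word_adj_dot w x y : '[word_adj w x, y] = '[x, word_op X w y].
Proof. by rewrite adjointEr //; exact: word_op_bounded. Qed.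

End WordOperators.

Lemma cvg_normcP (R : realType) (u : nat -> R[i]) :
  ((fun N => Normc.normc (u N)) @ \oo --> (0 : R)) <->
  forall e : R, 0 < e -> exists N : nat, forall n, (N <= n)%N -> abs2 (u n) < e.
Proof.
have E z : Normc.normc z = Num.sqrt (abs2 z) :> R by case: z.
split=> [/cvgrPdist_lt h e e0|h]; last first.
  apply/cvgrPdist_lt => e e0; have [N hN] := h _ (exprn_gt0 2 e0).
  exists N => // n Nn; rewrite /= sub0r normrN E ger0_norm ?sqrtr_ge0 //.
  rewrite -[ltRHS](gtr0_norm e0) -sqrtr_sqr ltr_sqrt ?exprn_gt0 //; exact: hN.
have e0' : 0 < Num.sqrt e by rewrite sqrtr_gt0.
have [N _ hN] := h _ e0'; exists N => n Nn.
have := hN n Nn; rewrite /= sub0r normrN E ger0_norm ?sqrtr_ge0 //.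
by rewrite ltr_sqrt.
Qed.

(** * Convergence of the series for [Phi] and its quadratic form *)

Section PhiForm.
Context {R : realType} {n : nat} {V : hilbertType R}.
Context (a : word n -> R) (X : 'I_n -> V -> V).
Hypotheses (a0 : forall w, 0 <= a w) (anil : a [::] = 0).
Hypothesis bX : forall j, bounded_op (X j).

(** The form of [Phi] applied to an operator with form [Q]. Allowing any [Q] with values in [\bar R]
    lets [Phi] be iterated and compared without asking whether an operator exists. *)
Definition word_form (c : word n -> R) (Q : V -> \bar R) (x : V) : \bar R :=
  (\esum_(w in [set: word n]) ((c w)%:E * Q (word_adj X w x)))%E.

Definition eqf (Y : V -> V) x : \bar R := (qf Y x)%:E.

Definition length_term (Y : V -> V) x p : R :=
  \sum_(w : p.-tuple 'I_n) a w * qf Y (word_adj X w x).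

Lemma length_term_ge0 Y x p : positive_op Y -> 0 <= length_term Y x p.
Proof. by move=> pY; rewrite sumr_ge0 // => w _; rewrite mulr_ge0 ?qf_ge0. Qed.

Lemma word_form_series Y x : positive_op Y ->
  (word_form a (eqf Y) x = \sum_(0 <= p <oo) (length_term Y x p)%:E)%E.
Proof.
move=> pY; rewrite /word_form esum_words => [|w]; last first.
  by rewrite -EFinM lee_fin mulr_ge0 ?qf_ge0.
by congr (limn _); apply/funext => N; apply: eq_bigr => p _; rewrite -sumEFin.
Qed.

Lemma length_term0 Y x : length_term Y x 0 = 0.
Proof. by rewrite /length_term big1 // => w _; rewrite tuple0 /= anil mul0r. Qed.

Lemma Phi_partial_bounded Y N : bounded_op Y -> bounded_op (Phi_partial a X Y N).
Proof.
move=> bY; apply: bounded_sum => p.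
apply: bounded_sum => w.
apply: bounded_scale; apply: (bounded_comp (word_op_bounded bX w)).
exact: (bounded_comp bY (word_adj_bounded bX w)).
Qed.

Lemma Phi_partial_dot Y N x : positive_op Y ->
  '[Phi_partial a X Y N x, x] = (\sum_(p < N.+1) length_term Y x p)%:C%C.
Proof.
(* [Phi_partial] starts at length 1; since [a [::] = 0], the term of length 0 may be added. *)
move=> pY; rewrite -(big_mkord xpredT) big_ltn // length_term0 add0r.
rewrite /Phi_partial dot_suml rmorph_sum; apply: eq_bigr => p _.
rewrite dot_suml rmorph_sum; apply: eq_bigr => w _.
rewrite linearZl_LR /= adjointE; last exact: word_op_bounded.
by rewrite -/(word_adj X w) positive_qf // rmorphM.
Qed.

(** The bound on the form makes the partial sums an increasing bounded sequence, hence strongly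
    convergent; uniqueness of weak limits identifies [Phi] with that limit. *)
Lemma PhiP Y (C : R) : bounded_op Y -> positive_op Y -> 0 < C ->
  (forall x, (word_form a (eqf Y) x <= (C * nsq x)%:E)%E) ->
  [/\ bounded_op (Phi a X Y), positive_op (Phi a X Y)
    & forall x, eqf (Phi a X Y) x = word_form a (eqf Y) x].
Proof.
move=> bY pY C0 YC.
pose A := Phi_partial a X Y.
have bA N : bounded_op (A N) by exact: Phi_partial_bounded.
have qfA N x : qf (A N) x = \sum_(p < N.+1) length_term Y x p.
  by rewrite /qf Phi_partial_dot.
have pA N : positive_op (A N).
  move=> x; rewrite Phi_partial_dot // ler0c sumr_ge0 // => p _.
  exact: length_term_ge0.
have mA x p q : (p <= q)%N -> qf (A p) x <= qf (A q) x.
  move=> pq; rewrite !qfA (sum_ord_cat (length_term Y x) (_ : p.+1 <= q.+1)%N) //.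
  by rewrite lerDl sumr_ge0 // => i _; exact: length_term_ge0.
have leA N x : ((\sum_(p < N) length_term Y x p)%:E <= word_form a (eqf Y) x)%E.
  rewrite word_form_series // -sumEFin -(big_mkord xpredT (fun p => (length_term Y x p)%:E)).
  by apply: nneseries_lim_ge => i _; rewrite lee_fin length_term_ge0.
have AC N x : qf (A N) x <= C * nsq x.
  by rewrite qfA -lee_fin; exact: le_trans (leA _ x) (YC x).
have [Z [bZ pZ hZ]] := monotone_ops_limit C0 bA pA mA AC.
have /the_opP[bP hP] : [set Z : V -> V | bounded_op Z /\ forall x y,
    (fun N => Normc.normc ('[Phi_partial a X Y N x, y] - '[Z x, y])) @ \oo
      --> (0 : R)] Z.
  split=> // x y; apply/cvg_normcP => e e0.
  by have [N h] := tends_dot y e0 (hZ x); exists N.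
have PZ : Phi a X Y = Z.
  apply/funext => x; apply: dot_inj => y; apply/eqP; rewrite -subr_eq0; apply/eqP.
  apply: (@abs2_eps0 R _ 4) => e e0.
  have [N1 h1] := tends_dot y e0 (hZ x).
  have /cvg_normcP/(_ _ e0)[N2 h2] := hP x y.
  have {}h1 := h1 _ (leq_maxl N1 N2); have {}h2 := h2 _ (leq_maxr N1 N2).
  rewrite -opprB abs2N in h2.
  rewrite -['[Phi a X Y x, y]](subrK ('[A (maxn N1 N2) x, y])) -addrA.
  apply: le_trans (abs2_leD _ _) _.
  by move: h1 h2; rewrite /A; move: (abs2 _) (abs2 _) => r s; lra.
have hq x : eqf Z x = word_form a (eqf Y) x.
  rewrite /eqf word_form_series // nneseries_esumT; last first.
    by move=> p; rewrite lee_fin length_term_ge0.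
  apply/esym/esum_nat_lim => [p|N|e e0]; first exact: length_term_ge0.
    apply/ler_addgt0Pr => e e0; have [M h] := tends_Re x e0 (hZ x).
    have := h (maxn M N) (leq_maxl _ _); rewrite -/(qf _ x) -/(qf _ x) qfA ltr_norml.
    rewrite (sum_ord_cat (length_term Y x) (leqW (leq_maxr M N))).
    have : 0 <= \sum_(N <= p < (maxn M N).+1) length_term Y x p.
      by rewrite sumr_ge0 // => i _; exact: length_term_ge0.
    by move=> ? /andP[? ?]; lra.
  have [M h] := tends_Re x e0 (hZ x); exists M.+1; rewrite -qfA.
  by have := h M (leqnn M); rewrite -/(qf _ x) -/(qf _ x) ltr_norml => /andP[? ?]; lra.
by rewrite PZ.
Qed.

End PhiForm.

(** Writes [D] as a sum of rank-one operators, the [d t] playing the role of the columns of a square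
    root. *)
Lemma cholesky_vectors (R : realType) (V : hilbertType R) (D : V -> V) :
  bounded_op D -> positive_op D -> exists d : nat -> V, forall x,
    (\esum_(t in [set: nat]) (abs2 '[x, d t])%:E = eqf D x)%E.
Proof.
move=> bD pD; have [u du] := nsq_dense (V := V).
exists (cholesky_vector D u) => x; apply: esum_nat_lim => [t|N|e e0].
- exact: abs2_ge0.
- by have := qf_ge0 x (cholesky_positive u bD pD N); rewrite qf_cholesky subr_ge0.
have [N /(_ N (leqnn N)) h] := qf_cholesky_lim x bD pD du e0.
by exists N; rewrite qf_cholesky in h; lra.
Qed.

(** * Weights and multishifts *)

Section Weights.
Context {R : realType} {n : nat} (a : word n -> R).
Hypotheses (a0 : forall w, 0 <= a w) (anil : a [::] = 0).

(** The product of formal power series in noncommuting variables, coefficientwise. *)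
Definition conv (c d : word n -> R) (w : word n) : R :=
  \sum_(l < (size w).+1) c (take l w) * d (drop l w).

Lemma conv_ge0 c d w : (forall u, 0 <= c u) -> (forall u, 0 <= d u) -> 0 <= conv c d w.
Proof. by move=> c0 d0; rewrite sumr_ge0 // => l _; rewrite mulr_ge0. Qed.

Definition factorizations p (w : word n) : set (p.-tuple (word n)) :=
  [set g | flatten g = w /\ all (fun s => s != [::]) g].

Arguments factorizations p w _ : clear implicits.

(** The coefficients of [f^p]; the unit series is the indicator of the empty word. *)
Fixpoint conv_power p : word n -> R :=
  if p is p'.+1 then conv a (conv_power p') else fun w => (w == [::])%:R.

Lemma conv_power_ge0 p w : 0 <= conv_power p w.
Proof. by elim: p w => [|p IH] w /=; [exact: ler0n|exact: conv_ge0]. Qed.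

Lemma conv_power_large p w : (size w < p)%N -> conv_power p w = 0.
Proof.
elim: p w => // p IH w wp; rewrite /= /conv big1 // => -[[|l] /= lw] _.
  by rewrite take0 anil mul0r.
by rewrite IH ?mulr0 // size_drop; move: lw wp; lia.
Qed.

(** Splits off the first factor, recorded by its length [l]; nonemptiness of that factor is
    [0 < l]. *)
Lemma factorizationsS p w : set_bij
  ([set l | (l < (size w).+1)%N] `*``
     (fun l => [set g | (0 < l)%N /\ factorizations p (drop l w) g]))
  (factorizations p.+1 w) (fun k => [tuple of take k.1 w :: k.2]).
Proof.
split.
- move=> [l g] /= [lw [l0 [gw ga]]]; split; first by rewrite /= gw cat_take_drop.
  by rewrite /= ga andbT -size_eq0 size_takel // -lt0n.
- move=> [l g] [l' g']; rewrite !inE /= => -[lw _] [lw' _] /(congr1 val) /= [h1 h2].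
  congr (_, _); last exact: val_inj.
  by move: (congr1 size h1); rewrite !size_takel.
- move=> g; case/tupleP: g => x g [] /= gw /andP[x0 ga]; exists (size x, g).
    split; rewrite /= -gw ?ltnS ?size_cat ?leq_addr //.
    by rewrite lt0n size_eq0 x0 drop_size_cat.
  by apply: val_inj; rewrite /= -gw take_size_cat.
Qed.

Lemma factorizations_finite p w : finite_set (factorizations p w).
Proof.
elim: p w => [|p IH] w.
  by apply: (sub_finite_set _ (finite_set1 [tuple])) => g _ /=; rewrite tuple0.
have [_ _ surj] := factorizationsS p w.
have fin : finite_set ([set l | (l < (size w).+1)%N] `*``
     (fun l => [set g | (0 < l)%N /\ factorizations p (drop l w) g])).
  apply: (@sub_finite_set _ _ (\bigcup_(l in [set l | (l < (size w).+1)%N])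
    (pair l @` factorizations p (drop l w)))).
    by move=> [l g] /= [lw [_ gw]]; exists l => //; exists g.
  apply: bigcup_finite; first exact: finite_II.
  by move=> l _; apply: finite_image; exact: IH.
exact: (sub_finite_set surj (finite_image _ fin)).
Qed.

Lemma conv_powerE p w :
  conv_power p w = \sum_(g \in factorizations p w) \prod_(s <- g) a s.
Proof.
have pa (s : seq (word n)) : 0 <= \prod_(u <- s) a u by rewrite prodr_ge0.
apply: EFin_inj; rewrite -fsumEFin; last exact: factorizations_finite.
rewrite -esum_fset; [|exact: factorizations_finite|by move=> g _; rewrite lee_fin].
elim: p w => [|p IH] w.
  rewrite /=; have [->|w0] := eqVneq w [::].
    have -> : factorizations 0 [::] = [set [tuple]].
      by apply/seteqP; split=> [g _|_ ->]; rewrite /factorizations /= ?tuple0.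
    by rewrite esum_set1 ?big_nil // lee_fin big_nil.
  have -> : factorizations 0 w = set0.
    by rewrite -subset0 => g []; rewrite tuple0 /= => h; move: w0; rewrite -h.
  by rewrite esum_set0.
rewrite (reindex_esum _ _ _ _ (factorizationsS p w)).
rewrite -(esum_esum (a := fun l (g : p.-tuple (word n)) => (\prod_(s <- take l w :: g) a s)%:E)); last by move=> *; rewrite lee_fin.
rewrite (esum_ord _ (f := fun l => \esum_(g in [set g | (0 < l)%N /\ factorizations p (drop l w) g]) (\prod_(s <- take l w :: g) a s)%:E)%E);
  last by move=> l; apply: esum_ge0 => g _; rewrite lee_fin.
(* The cut of length 0 has an empty first factor: no factorization allows it, and the convolution
   term is 0 by [a [::] = 0]. *)
rewrite /= /conv -sumEFin; apply: eq_bigr => -[[|l] /= lw] _.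
  by rewrite take0 anil mul0r esum1 // => g [].
rewrite EFinM IH; set S := [set g | _].
have -> : S = factorizations p (drop l.+1 w).
  by apply/seteqP; split=> [g []|g].
rewrite -esumZl // => [|g]; last by rewrite lee_fin.
by apply: eq_esum => g _; rewrite big_cons EFinM.
Qed.

Lemma conv_power_sum w N (f : nat -> R) : (size w <= N)%N ->
  \sum_(p < (size w).+1) conv_power p w * f p = \sum_(p < N.+1) conv_power p w * f p.
Proof.
move=> wN; rewrite (sum_ord_cat (fun p => conv_power p w * f p) (_ : (size w).+1 <= N.+1)%N) //.
rewrite [X in _ + X]big_nat [X in _ + X]big1 ?addr0 // => p /andP[wp _].
by rewrite conv_power_large ?mul0r.
Qed.

(** The binomial series of [(1 - f)^{-(m+1)}]. The upper limit [N] is free because [f^p] has no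
    words shorter than [p]. *)
Lemma weight_conv_power m w N : (size w <= N)%N ->
  weight a m.+1 w = \sum_(p < N.+1) conv_power p w * 'C(p + m, m)%:R.
Proof.
move=> wN; rewrite -(conv_power_sum (fun p => 'C(p + m, m)%:R) wN).
case: w wN => [|j w] wN.
  by rewrite /= big_ord_recl big_ord0 /= mul1r addr0 add0n binn.
rewrite -(big_mkord xpredT (fun p => conv_power p (j :: w) * 'C(p + m, m)%:R)).
rewrite big_ltn //= mul0r add0r; apply: eq_bigr => p _.
rewrite conv_powerE mulr_fsuml; apply: eq_fsbigr => g _.
by rewrite subn1 /= addnS subn1.
Qed.

(** The coefficients of [(1 - f)^{-r}]. The case [r = 0] is separate because truncated subtraction
    would make [weight a 0] equal to [weight a 1] instead of the unit series. *)
Definition wt (r : nat) (w : word n) : R :=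
  if r is 0 then (w == [::])%:R else weight a r w.

(* [(1 - f)^{-(r+1)} = (1 - f)^{-r} + f (1 - f)^{-(r+1)}], coefficientwise *)
Lemma wtS r w : wt r.+1 w = wt r w + conv a (wt r.+1) w.
Proof.
rewrite /wt (weight_conv_power _ (leqW (leqnn (size w)))).
have -> : conv a (weight a r.+1) w =
    \sum_(p < (size w).+1) conv_power p.+1 w * 'C(p + r, r)%:R.
  rewrite /conv.
  under eq_bigr => l _.
    rewrite (weight_conv_power _ (_ : (size (drop l w) <= size w)%N)); last by rewrite size_drop leq_subr.
    rewrite mulr_sumr; over.
  rewrite exchange_big /=; apply: eq_bigr => p _; rewrite mulr_suml.
  by apply: eq_bigr => l _; rewrite mulrA.
case: r => [|r].
  rewrite big_ord_recl /= bin0 mulr1; congr (_ + _).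
  by apply: eq_bigr => p _; rewrite !bin0.
rewrite (weight_conv_power _ (leqW (leqnn (size w)))).
rewrite big_ord_recl [X in _ = X + _]big_ord_recl -addrA -big_split /= !add0n !binn; congr (_ + _).
apply: eq_bigr => p _; rewrite /bump /= !add1n -mulrDr -natrD.
by congr (_ * _%:R); rewrite addnS binS addnC addSnnS.
Qed.

Lemma wt_ge0 r w : 0 <= wt r w.
Proof.
case: r => [|r]; first exact: ler0n.
rewrite /wt (weight_conv_power _ (leqnn _)) sumr_ge0 // => p _.
by rewrite mulr_ge0 ?conv_power_ge0.
Qed.

Lemma wt_nil r : wt r [::] = 1.
Proof. by case: r. Qed.

(** Keeps only the one-letter cut in the recursion [wtS]. It bounds the weight ratios by [1 / a_j],
    hence the weighted shifts. *)
Lemma wt_cons r j w : a [:: j] * wt r.+1 w <= wt r.+1 (j :: w).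
Proof.
rewrite [leRHS]wtS /conv.
have h : (1 < (size (j :: w)).+1)%N by [].
rewrite (bigD1 (Ordinal h)) // [take _ _]/= take0 [drop _ _]/= drop0 addrA addrAC lerDr.
rewrite addr_ge0 ?wt_ge0 // sumr_ge0 // => l _.
by rewrite mulr_ge0 // (wt_ge0 r.+1).
Qed.

Lemma wt_gt0 r w : (forall j, 0 < a [:: j]) -> 0 < wt r.+1 w.
Proof.
move=> aj; elim: w => [|j w IH]; first by rewrite wt_nil.
by apply: lt_le_trans (wt_cons r j w); rewrite mulr_gt0.
Qed.

End Weights.

(** * Tuples of words and sums over them *)

Section MultiWords.
Context {k : nat} {n : 'I_k -> nat}.
Implicit Types (g : @mword k n) (i : 'I_k).

Definition mupd g i (w : word (n i)) : @mword k n := [ffun j => dfwith g i w j].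

Arguments mupd g i w : clear implicits.

Lemma mupd_in g i w : mupd g i w i = w.
Proof. by rewrite ffunE dfwithin. Qed.

Lemma mupd_out g i (w : word (n i)) j : i != j -> mupd g i w j = g j.
Proof. by move=> ij; rewrite ffunE dfwithout. Qed.

Lemma mupd_mupd g i (v w : word (n i)) : mupd (mupd g i v) i w = mupd g i w.
Proof.
apply/ffunP => j; have [<-|ij] := eqVneq i j; first by rewrite !mupd_in.
by rewrite !mupd_out.
Qed.

Lemma mupd_id g i : mupd g i (g i) = g.
Proof.
apply/ffunP => j; have [<-|ij] := eqVneq i j; first by rewrite mupd_in.
by rewrite mupd_out.
Qed.

Lemma mupdC g i j (v : word (n i)) (w : word (n j)) : i != j ->
  mupd (mupd g i v) j w = mupd (mupd g j w) i v.
Proof.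
move=> ij; apply/ffunP => l; have [<-|il] := eqVneq i l.
  by rewrite mupd_out 1?eq_sym // !mupd_in.
have [<-|jl] := eqVneq j l; first by rewrite mupd_in mupd_out // mupd_in.
by rewrite !mupd_out.
Qed.

Context {R : realType}.
Local Open Scope ereal_scope.

(** Multiwords are grouped by their entries outside [i], each group being represented by its member
    with empty i-th word. *)
Lemma esum_mword_split i (f : @mword k n -> \bar R) : (forall g, 0 <= f g) ->
  \esum_(g in [set: @mword k n]) f g =
  \esum_(g in [set g : @mword k n | g i = [::]]) \esum_(v in [set: word (n i)]) f (mupd g i v).
Proof.
move=> f0; rewrite esum_esum //.
rewrite (reindex_esum ([set g : @mword k n | g i = [::]] `*`` fun=> [set: word (n i)]) _
  (fun k => mupd k.1 i k.2)) //; split=> //.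
  move=> [g v] [h w]; rewrite !inE /= => -[gi _] [hi _] e.
  have vw : v = w by rewrite -(mupd_in g v) e mupd_in.
  congr (_, _) => //; rewrite -(mupd_id g i) -(mupd_id h i) gi hi.
  by rewrite -(mupd_mupd g v) e mupd_mupd.
move=> g _; exists (mupd g i [::], g i) => /=; first by rewrite mupd_in.
by rewrite mupd_mupd mupd_id.
Qed.

(** On the left a multiword occurs once for every cut of its i-th word into [w] and an old entry,
    which produces the inner sum on the right. *)
Lemma esum_shift i (c : word (n i) -> @mword k n -> R) (s : @mword k n -> \bar R) :
  (forall w g, 0 <= c w g)%R -> (forall g, 0 <= s g) ->
  \esum_(w in [set: word (n i)]) \esum_(g in [set: @mword k n])
     ((c w g)%:E * s (mupd g i (w ++ g i))) =
  \esum_(g in [set: @mword k n])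
     ((\sum_(l < (size (g i)).+1) c (take l (g i)) (mupd g i (drop l (g i))))%:E * s g).
Proof.
move=> c0 s0.
have pos w g h : 0 <= (c w g)%:E * s h by rewrite mule_ge0 ?lee_fin.
under eq_esum => w _.
  rewrite (esum_mword_split i) //.
  under eq_esum => g _ do under eq_esum => v _ do rewrite mupd_in mupd_mupd.
  over.
rewrite [RHS](esum_mword_split i); last first.
  by move=> g; rewrite mule_ge0 // lee_fin sumr_ge0.
rewrite (esum_mkcond [set g : @mword k n | g i = [::]]).
under [LHS]eq_esum => w _ do rewrite esum_mkcond.
rewrite esum_exchange; last by move=> w g; case: ifP => // _; exact: esum_ge0.
apply: eq_esum => g _; case: ifP => [_|_]; last by rewrite esum1.
rewrite (esum_splits (G := fun w v => (c w (mupd g i v))%:E * s (mupd g i (w ++ v)))) //.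
apply: eq_esum => u _; rewrite mupd_in -sumEFin ge0_sume_distrl => [|l _]; last by rewrite lee_fin.
by apply: eq_bigr => l _; rewrite mupd_mupd cat_take_drop.
Qed.

End MultiWords.

Arguments mupd {k n} g i w.

(** * Diagonal forms in the model and the action of [Phi] on them *)

Section Symbols.
Context {R : realType} {k : nat} {n : 'I_k -> nat}.
Context (a : forall i, word (n i) -> R) (m : 'I_k -> nat).
Arguments a : clear implicits.
Hypothesis a0 : forall i w, 0 <= a i w.
Hypothesis anil : forall i, a i [::] = 0.
Hypothesis apos : forall i (j : 'I_(n i)), 0 < a i [:: j].
Hypothesis mpos : forall i, (0 < m i)%N.
Implicit Types (g : @mword k n) (d : @mword k n -> R).

Definition mwt i (w : word (n i)) : R := wt (a i) (m i) w.
Arguments mwt i w : clear implicits.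

Lemma mwt_gt0 i w : 0 < mwt i w.
Proof. by rewrite /mwt -(prednK (mpos i)); apply: wt_gt0 => //; exact: apos. Qed.

Lemma mwt_ge0 i w : 0 <= mwt i w. Proof. exact/ltW/mwt_gt0. Qed.

(** The symbol of [Phi_i] of a diagonal form: as [X_w eps_v = sqrt (b_v / b_{wv}) eps_{wv}], the
    coefficient at [u] is the sum of [a_w d_v b_v / b_u] over the cuts [u = w v]. *)
Definition phi_symbol i d g : R :=
  (\sum_(l < (size (g i)).+1)
     a i (take l (g i)) * (d (mupd g i (drop l (g i))) * mwt i (drop l (g i))))
  / mwt i (g i).

Lemma phi_symbol_ge0 i d g : (forall h, 0 <= d h) -> 0 <= phi_symbol i d g.
Proof.
move=> d0; apply: divr_ge0; last exact: mwt_ge0.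
by apply: sumr_ge0 => l _; rewrite !mulr_ge0 ?mwt_ge0.
Qed.

Lemma phi_symbol_le i d d' g : (forall h, d h <= d' h) ->
  phi_symbol i d g <= phi_symbol i d' g.
Proof.
move=> dd'; rewrite ler_wpM2r ?invr_ge0 ?mwt_ge0 // ler_sum // => l _.
by rewrite ler_wpM2l // ler_wpM2r // mwt_ge0.
Qed.

(* The symbol of [(id - Phi_1)^{q_1} ... (id - Phi_k)^{q_k} (I)]: in the free
   algebra [(1 - f)^q (1 - f)^{-m} = (1 - f)^{-(m - q)}]. *)
Definition symq (q : 'I_k -> nat) g : R :=
  \prod_i (wt (a i) (m i - q i) (g i) / mwt i (g i)).

Lemma symq_ge0 q g : 0 <= symq q g.
Proof.
by rewrite prodr_ge0 // => i _; rewrite divr_ge0 ?wt_ge0 ?mwt_ge0.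
Qed.

Lemma symq0 g : symq (fun=> 0%N) g = 1.
Proof.
by rewrite /symq big1 // => i _; rewrite subn0 -/(mwt i _) mulfV // gt_eqF ?mwt_gt0.
Qed.

Definition bump_at (q : 'I_k -> nat) i : 'I_k -> nat :=
  fun j => if j == i then (q j).+1 else q j.

(** In the i-th factor this is [f (1 - f)^{-r} = (1 - f)^{-r} - (1 - f)^{-(r-1)}] with
    [r = m i - q i], that is, [wtS]; [q i < m i] guarantees [r > 0]. *)
Lemma phi_symq i q g : (q i < m i)%N ->
  phi_symbol i (symq q) g = symq q g - symq (bump_at q i) g.
Proof.
move=> qm.
have E (q' : 'I_k -> nat) (h : @mword k n) : (forall j, j != i -> q' j = q j) -> (forall j, j != i -> h j = g j) ->
    symq q' h = wt (a i) (m i - q' i) (h i) / mwt i (h i) *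
      \prod_(j | j != i) (wt (a j) (m j - q j) (g j) / mwt j (g j)).
  move=> q'q hg; rewrite /symq (bigD1 i) //=; congr (_ * _).
  by apply: eq_bigr => j ji; rewrite q'q // hg.
set P := (\prod_(j | j != i) _) in E.
have -> : symq q g = wt (a i) (m i - q i) (g i) / mwt i (g i) * P by exact: E.
have -> : symq (bump_at q i) g = wt (a i) (m i - q i).-1 (g i) / mwt i (g i) * P.
  rewrite E //; first by rewrite /bump_at eqxx -subnS.
  by move=> j ji; rewrite /bump_at (negbTE ji).
have mq : (m i - q i)%N = (m i - q i).-1.+1 by rewrite prednK // subn_gt0.
rewrite {1}mq wtS // -mq -mulrBl -mulrBl [X in X / _ * _]addrAC subrr add0r.
rewrite /phi_symbol /conv mulr_suml !mulr_suml; apply: eq_bigr => l _.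
rewrite E // => [|j ji]; last by rewrite mupd_out // eq_sym.
rewrite mupd_in; have := mwt_gt0 (drop l (g i)).
by move: (mwt i (drop _ _)) => c c0; field; rewrite !gt_eqF ?mwt_gt0.
Qed.

(** On symbols, [Phi_i (id) <= id]: the difference is the symbol of [id - Phi_i], a quotient of
    nonnegative weights. *)
Lemma phi_symbol1 i g : phi_symbol i (fun=> 1) g <= 1.
Proof.
have -> : phi_symbol i (fun=> 1) g = phi_symbol i (symq (fun=> 0%N)) g.
  by congr (_ / _); apply: eq_bigr => l _; rewrite symq0.
by rewrite phi_symq // symq0 gerBl symq_ge0.
Qed.

(* Dominates the symbol of [Phi_i^s (I)], which therefore tends to 0. *)
Definition tail_symbol i (s : nat) g : R := (s <= size (g i))%N%:R.

(** As [a [::] = 0], every word prepended by [Phi_i] is nonempty, so the support moves to longer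
    words, while [phi_symbol1] keeps the values below 1. *)
Lemma phi_tail_symbol i s g :
  phi_symbol i (tail_symbol i s) g <= tail_symbol i s.+1 g.
Proof.
rewrite /tail_symbol; have [sg|gs] := ltnP s (size (g i)).
  apply: le_trans (phi_symbol1 i g); apply: phi_symbol_le => h.
  by rewrite -(ler_nat R) lern1 leq_b1.
rewrite /phi_symbol big1 ?mul0r // => -[[|l] lg] _ /=.
  by rewrite take0 anil mul0r.
rewrite mupd_in size_drop.
have -> : (s <= size (g i) - l.+1)%N = false by move: gs lg => /=; lia.
by rewrite mul0r mulr0.
Qed.

Context {V : hilbertType R} (X : forall i, 'I_(n i) -> V -> V).
Arguments X : clear implicits.
Context (eps : @mword k n -> nat -> V).

(** The second index of [eps] is a multiplicity: for [S (x) I] it runs through a basis of [H]. *)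
Definition energy (x : V) g : \bar R := (\esum_(t in [set: nat]) (abs2 '[x, eps g t])%:E)%E.

(** The form of [sum_g d_g sum_t <., eps g t> eps g t], diagonal with respect to a frame that need
    not be orthogonal. *)
Definition sym d (x : V) : \bar R :=
  (\esum_(g in [set: @mword k n]) ((d g)%:E * energy x g))%E.

(* The only property of W and of S (x) I on which the analysis of Delta relies *)
Definition model_frame : Prop :=
  [/\ forall i j, bounded_op (X i j),
      forall x, sym (fun=> 1) x = (nsq x)%:E
    & forall i j g t, X i j (eps g t) =
        (Num.sqrt (mwt i (g i) / mwt i (j :: g i)))%:C%C *: eps (mupd g i (j :: g i)) t].

Hypothesis XM : model_frame.
Let bX i j : bounded_op (X i j). Proof. by case: XM. Qed.

Lemma energy_ge0 x g : (0 <= energy x g)%E.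
Proof. by apply: esum_ge0 => t _; rewrite lee_fin abs2_ge0. Qed.

Lemma sym_ge0 d x : (forall g, 0 <= d g) -> (0 <= sym d x)%E.
Proof. by move=> d0; apply: esum_ge0 => g _; rewrite mule_ge0 ?lee_fin ?energy_ge0. Qed.

Lemma sym_le d d' x : (forall g, d g <= d' g) -> (sym d x <= sym d' x)%E.
Proof.
by move=> dd'; apply: le_esum => g _; rewrite lee_wpmul2r ?lee_fin ?energy_ge0.
Qed.

Lemma symD d d' x : (forall g, 0 <= d g) -> (forall g, 0 <= d' g) ->
  (sym (fun g => d g + d' g)%R x = sym d x + sym d' x)%E.
Proof.
move=> d0 d'0; rewrite -esumD => [|g _|g _]; try by rewrite mule_ge0 ?lee_fin ?energy_ge0.
by apply: eq_esum => g _; rewrite EFinD ge0_muleDl ?lee_fin.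
Qed.

Lemma word_op_eps i (w : word (n i)) g t :
  word_op (X i) w (eps g t) =
  (Num.sqrt (mwt i (g i) / mwt i (w ++ g i)))%:C%C *: eps (mupd g i (w ++ g i)) t.
Proof.
elim: w => [|j w IH]; first by rewrite /= mupd_id mulfV ?sqrtr1 ?scale1r // gt_eqF ?mwt_gt0.
rewrite /= IH (linZ (bX _).1); have [_ _ ->] := XM.
rewrite mupd_in mupd_mupd scalerA -rmorphM /= -sqrtrM; last first.
  by rewrite divr_ge0 ?mwt_ge0.
congr ((Num.sqrt _)%:C%C *: _); have := mwt_gt0 (w ++ g i).
by move: (mwt i (w ++ _)) => c c0; field; rewrite !gt_eqF ?mwt_gt0.
Qed.

Lemma energy_word_adj i (w : word (n i)) x g :
  energy (word_adj (X i) w x) g =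
  ((mwt i (g i) / mwt i (w ++ g i))%:E * energy x (mupd g i (w ++ g i)))%E.
Proof.
have c0 : 0 <= mwt i (g i) / mwt i (w ++ g i) by rewrite divr_ge0 ?mwt_ge0.
rewrite -esumZl // => [|t]; last by rewrite lee_fin abs2_ge0.
apply: eq_esum => t _; rewrite -EFinM; congr EFin.
rewrite word_adj_dot // word_op_eps linearZr_LR /= abs2M abs2J abs2_real.
by rewrite sqr_sqrtr.
Qed.

(** The adjoint of [X_w] shifts energies by [w]; regrouping by the resulting multiword collects
    exactly the cuts in [phi_symbol]. *)
Lemma word_form_sym i d x : (forall g, 0 <= d g) ->
  word_form (X i) (a i) (sym d) x = sym (phi_symbol i d) x.
Proof.
move=> d0; rewrite /word_form /sym.
pose c (w : word (n i)) g := a i w * (d g * (mwt i (g i) / mwt i (w ++ g i))).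
have c0 w g : 0 <= c w g by rewrite !mulr_ge0 ?invr_ge0 ?mwt_ge0.
transitivity (\esum_(w in [set: word (n i)]) \esum_(g in [set: @mword k n])
    ((c w g)%:E * energy x (mupd g i (w ++ g i))))%E.
  apply: eq_esum => w _; rewrite -esumZl // => [|g]; last first.
    by rewrite mule_ge0 ?lee_fin ?energy_ge0.
  by apply: eq_esum => g _; rewrite energy_word_adj !muleA -!EFinM /c !mulrA.
rewrite (esum_shift c0) => [|g]; last exact: energy_ge0.
apply: eq_esum => g _; congr ((_ %:E) * _)%E.
rewrite /phi_symbol mulr_suml; apply: eq_bigr => l _.
by rewrite /c mupd_in cat_take_drop !mulrA.
Qed.

Lemma word_form_le i (Q Q' : V -> \bar R) x : (forall y, (Q y <= Q' y)%E) ->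
  (word_form (X i) (a i) Q x <= word_form (X i) (a i) Q' x)%E.
Proof. by move=> QQ'; apply: le_esum => w _; rewrite lee_wpmul2l ?lee_fin. Qed.

Definition ensq (x : V) : \bar R := (nsq x)%:E.

Lemma word_form_nsq i x : (word_form (X i) (a i) ensq x <= ensq x)%E.
Proof.
have [_ h _] := XM.
have -> : ensq = sym (fun=> 1) by apply/funext => y; rewrite h.
rewrite word_form_sym //; apply: sym_le => g; exact: phi_symbol1.
Qed.

Lemma iter_word_form_tail i s x :
  (iter s (word_form (X i) (a i)) ensq x <= sym (tail_symbol i s) x)%E.
Proof.
elim: s x => [|s IH] x; first by have [_ h _] := XM; rewrite /= /ensq -h.
rewrite iterS; apply: le_trans (word_form_le _ _ IH) _.
rewrite word_form_sym //; apply: sym_le; exact: phi_tail_symbol.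
Qed.

(** The energies add up to [nsq x], so finitely many multiwords carry all but [e] of it; an [s]
    beyond their i-th lengths leaves only the rest. *)
Lemma sym_tail_small i x (e : R) : 0 < e ->
  exists s, (sym (tail_symbol i s) x <= e%:E)%E.
Proof.
move=> e0; have [_ h _] := XM; have hx := h x.
have : (ensq x - e%:E < sym (fun=> 1%R) x)%E by rewrite hx /ensq -EFinB lte_fin ltrBlDr ltrDl.
rewrite /sym => /ereal_sup_gt[_ [F [finF _] <-]] lt.
have [s hs] : exists s, forall g, F g -> (size (g i) < s)%N.
  have /finite_seqP[r Fr] := finF.
  exists (\max_(g <- r) size (g i)).+1 => g; rewrite Fr /= ltnS => gr.
  exact: (@leq_bigmax_seq _ r xpredT (fun g : @mword k n => size (g i))).
exists s; set B := (\esum_(g in [set: @mword k n] `&` ~` F) (1%:E * energy x g))%E.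
have pos g : (0 <= 1%:E * energy x g)%E by rewrite mul1e energy_ge0.
have tB : (sym (tail_symbol i s) x <= B)%E.
  rewrite /B esum_mkcondr; apply: le_esum => g _; rewrite in_setC.
  case: ifPn => [_|]; first by rewrite lee_wpmul2r ?energy_ge0 // lee_fin /tail_symbol lern1 leq_b1.
  rewrite negbK in_setE => /hs gs; rewrite /tail_symbol leqNgt gs /= mul0e.
  by [].
apply: le_trans tB _; move: hx; rewrite /sym (esumID F) // -/B setTI => hx.
have FA : (\sum_(g \in F) (1%:E * energy x g) <= \esum_(g in F) (1%:E * energy x g))%E.
  by rewrite esum_fset.
have := lt_le_trans lt FA; move: hx.
have : (0 <= B)%E by apply: esum_ge0.
case: B => [r||]; case: (\esum_(g in F) _)%E => [u||] //= _; rewrite /ensq.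
by move=> [hx]; rewrite -EFinB lte_fin lee_fin => ?; lra.
Qed.

(** * Positivity of [Delta] for pulled-back diagonal forms *)

Section Intertwined.
Context {V' : hilbertType R} (X' : forall i, 'I_(n i) -> V' -> V') (G : V' -> V).
Arguments X' : clear implicits.
Hypothesis bX' : forall i j, bounded_op (X' i j).
Hypothesis GX : forall i w x, G (word_adj (X' i) w x) = word_adj (X i) w (G x).

(** In the application [G] is the adjoint of a multi-analytic [Psi], so [Y] is a diagonal form
    compressed by [Psi]. *)
Definition has_symbol (Y : V' -> V') d : Prop :=
  [/\ bounded_op Y, positive_op Y & forall x, eqf Y x = sym d (G x)].

Let step i (Y : V' -> V') : V' -> V' := fun x => Y x - Phi (a i) (X' i) Y x.

(** [G] intertwines the adjoint words, so [Phi] can be computed on the symbol. Its form stays below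
    that of [Y], which gives both convergence of the series and positivity of the difference. *)
Lemma has_symbol_step i Y q : (q i < m i)%N ->
  has_symbol Y (symq q) -> has_symbol (step i Y) (symq (bump_at q i)).
Proof.
move=> qm [bY pY hY]; have [C C0 YC] := qf_bound bY.
have formE x : word_form (X' i) (a i) (eqf Y) x = sym (phi_symbol i (symq q)) (G x).
  rewrite -word_form_sym => [|g]; last exact: symq_ge0.
  by apply: eq_esum => w _; rewrite hY GX.
have symE x : eqf Y x = (sym (symq (bump_at q i)) (G x) + sym (phi_symbol i (symq q)) (G x))%E.
  rewrite hY -symD; [|by move=> g; exact: symq_ge0|].
    by apply: eq_esum => g _; rewrite phi_symq // addrC subrK.
  by move=> g; apply: phi_symbol_ge0 => h; exact: symq_ge0.
have sym0 x : (0 <= sym (symq (bump_at q i)) x)%E by apply: sym_ge0 => g; exact: symq_ge0.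
have le x : (word_form (X' i) (a i) (eqf Y) x <= eqf Y x)%E by rewrite formE symE leeDr.
have [|bP pP hP] := PhiP (a0 (i := i)) (anil i) (bX' (i := i)) bY pY C0.
  by move=> x; apply: le_trans (le x) _; rewrite lee_fin.
have PY x : qf (Phi (a i) (X' i) Y) x <= qf Y x.
  by rewrite -lee_fin -/(eqf _ x) -/(eqf _ x) hP.
split; [exact: bounded_sub|exact: (positive_sub bP.1 bY.1)|move=> x].
rewrite /eqf qfB EFinB -/(eqf _ x) -/(eqf _ x) symE -formE -hP.
by rewrite addeK.
Qed.

Lemma has_symbol_iter i Y q s : (q i + s <= m i)%N -> has_symbol Y (symq q) ->
  has_symbol (iter s (step i) Y) (symq (fun j => if j == i then (q j + s)%N else q j)).
Proof.
move=> qs hY; elim: s qs => [|s IH] qs.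
  rewrite (_ : (fun j => _) = q) //; apply/funext => j; case: eqP => // _.
  by rewrite addn0.
have {}IH := IH (leq_trans (leq_add (leqnn _) (leqnSn s)) qs).
rewrite iterS (_ : (fun j => _) = bump_at (fun j => if j == i then (q j + s)%N else q j) i).
  by apply: has_symbol_step => //; rewrite eqxx -addnS.
by apply/funext => j; rewrite /bump_at; case: eqP => // _; rewrite addnS.
Qed.

(** Induction over the index list, with exponent 0 for the variables not yet treated; the list has
    no duplicates, so each variable receives its exponent once. *)
Lemma has_symbol_Delta Y (p : 'I_k -> nat) : (forall i, (p i <= m i)%N) ->
  has_symbol Y (fun=> 1) -> has_symbol (Delta a X' p Y) (symq p).
Proof.
move=> pm hY; rewrite /Delta.
have : uniq (index_enum ('I_k : finType)) by exact: index_enum_uniq.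
have -> : symq p = symq (fun j => if j \in index_enum ('I_k : finType) then p j else 0%N).
  by apply/funext => g; apply: eq_bigr => i _; rewrite mem_index_enum.
elim: (index_enum _) => [_|i r IH /= /andP[ir ur]].
  rewrite big_nil /= (_ : symq _ = fun=> 1) //.
  by apply/funext => g; rewrite -(symq0 g); apply: eq_bigr.
rewrite big_cons /=; have {}IH := IH ur.
rewrite (_ : symq _ = symq (fun j => if j == i then ((if j \in r then p j else 0) + p i)%N
                           else if j \in r then p j else 0%N)).
  by apply: (has_symbol_iter _ IH); rewrite (negbTE ir) add0n.
congr symq; apply/funext => j; rewrite inE; case: eqP => //= ->.
by rewrite (negbTE ir) add0n.
Qed.

End Intertwined.

(** * Inversion of [(id - Phi_i)^{m_i}] in one variable *)

Section OneVariable.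
Context (i : 'I_k).
Let form := word_form (X i).
Implicit Types (c : word (n i) -> R) (Q : V -> \bar R).

Lemma word_formDl c c' Q x : (forall w, 0 <= c w) -> (forall w, 0 <= c' w) ->
  (forall y, (0 <= Q y)%E) ->
  (form (fun w => c w + c' w)%R Q x = form c Q x + form c' Q x)%E.
Proof.
move=> c0 c'0 Q0; rewrite -esumD => [|w _|w _]; try by rewrite mule_ge0 ?lee_fin.
by apply: eq_esum => w _; rewrite EFinD ge0_muleDl ?lee_fin.
Qed.

Lemma word_formDr c Q Q' x : (forall w, 0 <= c w) -> (forall y, (0 <= Q y)%E) ->
  (forall y, (0 <= Q' y)%E) ->
  (form c (fun y => Q y + Q' y) x = form c Q x + form c Q' x)%E.
Proof.
move=> c0 Q0 Q'0; rewrite -esumD => [|w _|w _]; try by rewrite mule_ge0 ?lee_fin.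
by apply: eq_esum => w _; rewrite ge0_muleDr.
Qed.

Lemma word_form_ge0 c Q x : (forall w, 0 <= c w) -> (forall y, (0 <= Q y)%E) ->
  (0 <= form c Q x)%E.
Proof. by move=> c0 Q0; apply: esum_ge0 => w _; rewrite mule_ge0 ?lee_fin. Qed.

Lemma word_form_lel c c' Q x : (forall w, c w <= c' w) -> (forall y, (0 <= Q y)%E) ->
  (form c Q x <= form c' Q x)%E.
Proof. by move=> cc' Q0; apply: le_esum => w _; rewrite lee_wpmul2r ?lee_fin. Qed.

Lemma word_form_delta Q x : (forall y, (0 <= Q y)%E) ->
  form (fun w => (w == [::])%:R) Q x = Q x.
Proof.
move=> Q0; rewrite /form /word_form.
transitivity (\esum_(w in [set [::] : word (n i)]) Q (word_adj (X i) w x))%E.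
  rewrite [RHS]esum_mkcond; apply: eq_esum => w _.
  have [->|w0] := eqVneq w [::]; first by rewrite mul1e ifT // inE.
  by rewrite mul0e ifF //; apply/negbTE; rewrite notin_setE => /eqP; rewrite (negbTE w0).
by rewrite esum_set1 ?word_adj_nil.
Qed.

(** Composition concatenates the words, and each word arises from all its cuts: forms compose as
    power series multiply. *)
Lemma word_form_conv c c' Q x : (forall w, 0 <= c w) -> (forall w, 0 <= c' w) ->
  (forall y, (0 <= Q y)%E) -> form c (form c' Q) x = form (conv c c') Q x.
Proof.
move=> c0 c'0 Q0; rewrite /form /word_form.
transitivity (\esum_(u in [set: word (n i)]) \esum_(v in [set: word (n i)])
   ((c u * c' v)%:E * Q (word_adj (X i) (u ++ v) x)))%E.
  apply: eq_esum => u _; rewrite -esumZl // => [|v]; last by rewrite mule_ge0 ?lee_fin.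
  by apply: eq_esum => v _; rewrite muleA -EFinM word_adj_cat.
rewrite (esum_splits (G := fun u v => (c u * c' v)%:E * Q (word_adj (X i) (u ++ v) x))%E);
  last by move=> u v; rewrite mule_ge0 ?lee_fin ?mulr_ge0.
apply: eq_esum => w _; rewrite /conv -sumEFin ge0_sume_distrl; last first.
  by move=> l _; rewrite lee_fin mulr_ge0.
by apply: eq_bigr => l _; rewrite cat_take_drop.
Qed.

Let trunc c N : word (n i) -> R := fun w => if (size w < N)%N then c w else 0.

(** An unordered sum is a supremum over finite sets, each of which has words of bounded length
    only. *)
Lemma word_form_le_truncated c Q (B : \bar R) x : (forall w, 0 <= c w) ->
  (forall y, (0 <= Q y)%E) ->
  (forall N : nat, (form (trunc c N) Q x <= B)%E) ->
  (form c Q x <= B)%E.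
Proof.
move=> c0 Q0 h; apply: ge_ereal_sup => _ [F [finF _] <-].
have /finite_seqP[r Fr] := finF.
pose N := (\max_(w <- r) size w).+1.
apply: le_trans (h N); apply: ereal_sup_ubound; exists F => //.
apply: eq_fsbigr => w; rewrite Fr inE /= => wr.
by rewrite /trunc /N ltnS (@leq_bigmax_seq _ r xpredT (fun w : word (n i) => size w)).
Qed.

Let step (Y : V -> V) : V -> V := fun x => Y x - Phi (a i) (X i) Y x.

(** [Y] lies below a multiple of the identity and [Phi_i (id) <= id], which supplies the bound that
    [PhiP] asks for. *)
Lemma model_Phi Y : bounded_op Y -> positive_op Y ->
  [/\ bounded_op (Phi (a i) (X i) Y), positive_op (Phi (a i) (X i) Y)
    & forall x, eqf (Phi (a i) (X i) Y) x = form (a i) (eqf Y) x].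
Proof.
move=> bY pY; have [C C0 YC] := qf_bound bY.
apply: (PhiP (a0 (i := i)) (anil i) (bX (i := i)) bY pY C0) => x.
apply: le_trans (_ : form (a i) (fun y => C%:E * ensq y)%E x <= _)%E.
  by apply: word_form_le => y; rewrite /eqf /ensq -EFinM lee_fin.
have -> : form (a i) (fun y => C%:E * ensq y)%E x = (C%:E * form (a i) ensq x)%E.
  rewrite /form /word_form -esumZl ?ltW // => [|w]; last first.
    by rewrite mule_ge0 ?lee_fin ?nsq_ge0.
  by apply: eq_esum => w _; rewrite muleCA.
by rewrite EFinM lee_wpmul2l ?lee_fin ?(ltW C0) //; exact: word_form_nsq.
Qed.

Section Iterates.
Context (Y : V -> V).
Hypothesis bY : bounded_op Y.
Hypothesis Y1 : forall x, (eqf Y x <= ensq x)%E.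
Hypothesis pY : forall s, (s <= m i)%N -> positive_op (iter s step Y).
Let Ys s := iter s step Y.

Lemma iterate_bounded s : (s <= m i)%N -> bounded_op (Ys s).
Proof.
elim: s => // s IH sm; have {}IH := IH (ltnW sm).
by have [bP _ _] := model_Phi IH (pY (ltnW sm)); exact: bounded_sub.
Qed.

Lemma iterate_eqf_ge0 s x : (s <= m i)%N -> (0 <= eqf (Ys s) x)%E.
Proof. by move=> sm; rewrite lee_fin qf_ge0 //; exact: pY. Qed.

Lemma iterateS s x : (s < m i)%N ->
  (eqf (Ys s) x = eqf (Ys s.+1) x + form (a i) (eqf (Ys s)) x)%E.
Proof.
move=> sm; have [_ _ h] := model_Phi (iterate_bounded (ltnW sm)) (pY (ltnW sm)).
by rewrite -h /eqf -EFinD; congr EFin; rewrite [Ys s.+1]iterS qfB subrK.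
Qed.

(** The iterates decrease: consecutive ones differ by [Phi] of a positive operator. *)
Lemma iterate_le1 s x : (s <= m i)%N -> (eqf (Ys s) x <= ensq x)%E.
Proof.
elim: s => [|s IH] sm; first exact: Y1.
apply: le_trans (IH (ltnW sm)); rewrite (iterateS x sm) leeDl //.
by apply: word_form_ge0 => // y; apply: iterate_eqf_ge0; exact: ltnW.
Qed.

(* [U = form (wt j.+1) Z] and [Y' = eqf (Ys s)] are both solutions of
   [U = Q + Phi U], where [Q = form (wt j) Z]; U is the minimal one, and the
   powers of Phi tend to 0 on Y'. *)
Lemma form_wt j : (j <= m i)%N -> forall x,
  form (wt (a i) j) (eqf (Ys (m i))) x = eqf (Ys (m i - j)) x.
Proof.
set Z := eqf (Ys (m i)).
have Z0 x : (0 <= Z x)%E by exact: iterate_eqf_ge0.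
have w0 l w : 0 <= wt (a i) l w by apply: wt_ge0.
elim: j => [|j IH] jm x; first by rewrite subn0; exact: word_form_delta.
have {}IH := IH (ltnW jm).
set s := (m i - j.+1)%N; have sm : (s < m i)%N by rewrite /s; lia.
have sE : (m i - j)%N = s.+1 by rewrite /s; lia.
have Y'0 y : (0 <= eqf (Ys s) y)%E by apply: iterate_eqf_ge0; exact: ltnW.
have Y'E y : (eqf (Ys s) y = form (wt (a i) j) Z y + form (a i) (eqf (Ys s)) y)%E.
  by rewrite IH sE; exact: iterateS.
pose U := form (wt (a i) j.+1) Z.
have U0 y : (0 <= U y)%E by exact: word_form_ge0.
have UE y : (U y = form (wt (a i) j) Z y + form (a i) U y)%E.
  rewrite /U word_form_conv // -word_formDl //; last by move=> w; exact: conv_ge0.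
  by apply: eq_esum => w _; rewrite {1}wtS.
apply/eqP; rewrite eq_le; apply/andP; split.
  (* Minimality, by induction on the truncation length: in the convolution with [a] the empty cut
     carries [a [::] = 0], so the other factor is shorter than the word and covered by the previous
     truncation. *)
  apply: word_form_le_truncated => // N.
  elim: N x => [|N IHN] x.
    by rewrite /form /word_form esum1 // => w _; rewrite /trunc ltn0 mul0e.
  rewrite Y'E; set c := trunc (wt (a i) j.+1) N.
  have c0 w : 0 <= c w by rewrite /c /trunc; case: ifP.
  apply: le_trans (_ : form (wt (a i) j) Z x + form (a i) (form c Z) x <= _)%E; last first.
    by rewrite leeD2l //; apply: word_form_le.
  rewrite word_form_conv // -word_formDl //; last by move=> w; exact: conv_ge0.
  apply: word_form_lel => // w; rewrite /trunc ltnS.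
  case: leqP => wN; last by rewrite addr_ge0 ?conv_ge0.
  rewrite wtS // lerD2l /conv ler_sum // => -[[|l] /= lw] _.
    by rewrite take0 anil !mul0r.
  by rewrite ler_wpM2l // /c /trunc size_drop ifT //; move: lw wN; lia.
(* Substituting the equation of [Y'] into itself [t] times leaves [Phi^t] applied to the initial
   bound [Y' <= id]. *)
have UF t y : (eqf (Ys s) y <= U y + iter t (form (a i)) ensq y)%E.
  elim: t y => [|t IHt] y.
    apply: le_trans (iterate_le1 _ (ltnW sm)) _.
    by rewrite leeDr.
  rewrite Y'E UE -addeA leeD2l // iterS -word_formDr //; first exact: word_form_le.
  move=> z; elim: t z {IHt} => [|t IHt] z; first by rewrite lee_fin nsq_ge0.
  by rewrite iterS; apply: word_form_ge0.
apply/lee_addgt0Pr => e e0; have [t ht] := sym_tail_small i x e0.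
apply: le_trans (UF t x) _; rewrite leeD2l //.
exact: le_trans (iter_word_form_tail i t x) ht.
Qed.

Lemma form_mwt x : eqf Y x = form (mwt i) (eqf (iter (m i) step Y)) x.
Proof. by have := form_wt (leqnn (m i)) x; rewrite subnn => <-. Qed.

End Iterates.
End OneVariable.

(** * Inversion of [Delta^m] in all variables *)

Section MultiVariable.

Definition multi_op (l : seq 'I_k) g : V -> V :=
  foldr (fun i T => word_op (X i) (g i) \o T) id l.

Definition multi_adj l g : V -> V := adjoint (multi_op l g).

Definition multi_wt (l : seq 'I_k) g : R := \prod_(i <- l) mwt i (g i).

Lemma multi_op_bounded l g : bounded_op (multi_op l g).
Proof.
elim: l => [|i l IH]; first exact: bounded_id.
by apply: bounded_comp IH; exact: (word_op_bounded (bX (i := i))).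
Qed.

Lemma multi_wt_ge0 l g : 0 <= multi_wt l g.
Proof. by rewrite /multi_wt prodr_ge0 // => i _; exact: mwt_ge0. Qed.

Lemma multi_op_mupd l i w g : i \notin l -> multi_op l (mupd g i w) = multi_op l g.
Proof.
elim: l => //= j l IH; rewrite inE negb_or => /andP[ij il].
by rewrite IH // mupd_out.
Qed.

Lemma multi_wt_mupd l i w g : i \notin l -> multi_wt l (mupd g i w) = multi_wt l g.
Proof.
move=> il; apply: eq_big_seq => j jl; rewrite mupd_out //.
by apply: contraNneq il => ->.
Qed.

Definition mword_support (l : seq 'I_k) : set (@mword k n) :=
  [set g | forall i, i \notin l -> g i = [::]].

Let step i (Y : V -> V) : V -> V := fun x => Y x - Phi (a i) (X i) Y x.
Let steps (p : 'I_k -> nat) (r : seq 'I_k) : (V -> V) -> V -> V :=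
  \big[(fun f f' => f \o f')/id]_(i <- r) iter (p i) (step i).
Let indices : seq 'I_k := index_enum ('I_k : finType).

Context (Y : V -> V).
Hypothesis bY : bounded_op Y.
Hypothesis Y1 : forall x, (eqf Y x <= ensq x)%E.
Hypothesis pD : forall p : 'I_k -> nat, (forall i, (p i <= m i)%N) ->
  positive_op (Delta a X p Y).

(** With exponent 0 for the variables in [pre], a partially applied composite is again a [Delta]; in
    this way positivity for all [p <= m] reaches every intermediate iterate. *)
Lemma steps_suffix t i pre r : indices = pre ++ i :: r ->
  iter t (step i) (steps m r Y) =
  Delta a X (fun j => if j == i then t else if j \in r then m j else 0%N) Y.
Proof.
move=> e; have : uniq indices by exact: index_enum_uniq.
rewrite e /Delta -/indices e; elim: pre {e} => [|j pre IH] /=.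
  move=> /andP[ir _]; rewrite big_cons eqxx /=; congr (iter t _ _).
  rewrite /steps; congr (_ Y); apply: eq_big_seq => j jr.
  by rewrite ifF ?jr //; apply: contraNF ir => /eqP <-.
rewrite mem_cat inE !negb_or => /andP[/and3P[_ ji jr] u].
by rewrite big_cons (negbTE ji) (negbTE jr) /= IH.
Qed.

Lemma iterate_positive i pre r t : indices = pre ++ i :: r -> (t <= m i)%N ->
  positive_op (iter t (step i) (steps m r Y)).
Proof.
move=> e tm; rewrite (steps_suffix _ e); apply: pD => j.
by case: eqP => [->|_]; last case: ifP.
Qed.

Lemma steps_suffix_bounded pre r : indices = pre ++ r ->
  bounded_op (steps m r Y) /\ forall x, (eqf (steps m r Y) x <= ensq x)%E.
Proof.
elim: r pre => [|i r IH] pre e; first by rewrite /steps big_nil.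
have [|b le1] := IH (rcons pre i); first by rewrite cat_rcons.
have it t : (t <= m i)%N -> positive_op (iter t (step i) (steps m r Y)).
  exact: iterate_positive e.
rewrite /steps big_cons -/(steps m r) /=; split; first exact: iterate_bounded.
by move=> x; exact: iterate_le1.
Qed.

Lemma Delta_bounded : bounded_op (Delta a X m Y).
Proof. by have [] := @steps_suffix_bounded [::] indices erefl. Qed.

(** [l] lists the variables already inverted. [form_mwt] undoes the factor of [i], outermost in
    [steps m (i :: r)]; weights multiply and word operators compose. *)
Lemma multi_form_list l r : indices = rev l ++ r -> forall x,
  eqf (steps m r Y) x =
  (\esum_(g in mword_support l)
     ((multi_wt l g)%:E * eqf (Delta a X m Y) (multi_adj l g x)))%E.
Proof.
have D0 y : (0 <= eqf (Delta a X m Y) y)%E by rewrite lee_fin qf_ge0 //; exact: pD.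
have u : uniq indices by exact: index_enum_uniq.
elim: l r => [|i l IH] r e x.
  have -> : mword_support [::] = [set [ffun=> [::]]].
    apply/seteqP; split=> [g h|_ -> i _]; last by rewrite ffunE.
    by apply/ffunP => i; rewrite ffunE h.
  rewrite esum_set1; last by rewrite mule_ge0 // lee_fin multi_wt_ge0.
  by rewrite /multi_wt big_nil mul1e /multi_adj adjoint_id /= /Delta -/indices e.
move: e; rewrite rev_cons cat_rcons => e.
have il : i \notin l.
  by move: u; rewrite e cat_uniq /= mem_rev => /and3P[_ /norP[]].
have e' : indices = rcons (rev l) i ++ r by rewrite cat_rcons.
have [b le1] := steps_suffix_bounded e'.
rewrite (form_mwt b le1 (fun t tm => iterate_positive e tm)).
have -> : iter (m i) (fun Y x => Y x - Phi (a i) (X i) Y x) (steps m r Y) = steps m (i :: r) Y.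
  by rewrite /steps big_cons.
pose G w g : \bar R := ((mwt i w * multi_wt l g)%:E *
  eqf (Delta a X m Y) (multi_adj l g (word_adj (X i) w x)))%E.
have G0 w g : (0 <= G w g)%E by rewrite mule_ge0 // lee_fin mulr_ge0 ?mwt_ge0 ?multi_wt_ge0.
transitivity (\esum_(w in [set: word (n i)]) \esum_(g in mword_support l) G w g)%E.
  apply: eq_esum => w _; rewrite IH // -esumZl ?mwt_ge0 // => [|g]; last first.
    by rewrite mule_ge0 // lee_fin multi_wt_ge0.
  by apply: eq_esum => g _; rewrite muleA -EFinM.
rewrite esum_esum //.
rewrite (reindex_esum ([set: word (n i)] `*`` fun=> mword_support l) _
  (fun q => mupd q.2 i q.1)).
  apply: eq_esum => -[w g] [_ /= gl]; rewrite /G /multi_wt big_cons mupd_in.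
  have := multi_wt_mupd w g il; rewrite /multi_wt => ->; congr (_ * eqf _ _)%E.
  rewrite /multi_adj /= mupd_in multi_op_mupd // adjoint_comp //.
    exact: (word_op_bounded (bX (i := i))).
  exact: multi_op_bounded.
split.
- move=> [w g] [_ /= gl] j; rewrite inE negb_or => /andP[ji jl].
  by rewrite mupd_out 1?eq_sym // gl.
- move=> [w g] [w' g']; rewrite !inE => -[_ /= gl] [_ /= gl'] h.
  have ww' : w = w' by rewrite -(mupd_in g w) h mupd_in.
  congr (_, _) => //; rewrite -(mupd_id g i) -(mupd_id g' i) gl // gl' //.
  by rewrite -(mupd_mupd g w) h mupd_mupd.
- move=> g gl; exists (g i, mupd g i [::]); last by rewrite /= mupd_mupd mupd_id.
  split=> //= j jl; have [<-|ij] := eqVneq i j; first by rewrite mupd_in.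
  by rewrite mupd_out // gl // inE negb_or eq_sym ij.
Qed.

(** The outermost factor of [Delta] is undone first, so the word operators accumulate in reverse
    order of the variables. *)
Definition indices_rev : seq 'I_k := rev (index_enum ('I_k : finType)).

Lemma multi_form x : (eqf Y x = \esum_(g in [set: @mword k n])
  ((multi_wt indices_rev g)%:E * eqf (Delta a X m Y) (multi_adj indices_rev g x)))%E.
Proof.
have e : indices = rev indices_rev ++ [::] by rewrite cats0 revK.
have := multi_form_list e x; rewrite {1}/steps big_nil /= => ->.
congr esum; apply/seteqP; split=> // g _ i.
by rewrite mem_rev mem_index_enum.
Qed.

End MultiVariable.

(** * The noncommutative Berezin kernel *)

Section Kernel.

Lemma frame_total x : (forall g t, '[x, eps g t] = 0) -> x = 0.
Proof.
move=> h; apply: nsq_eq0; apply: EFin_inj; have [_ <- _] := XM.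
rewrite /sym esum1 // => g _; rewrite /energy esum1 ?mule0 // => t _.
by rewrite h abs2_0.
Qed.

Lemma frame_eq (S T : V -> V) : bounded_op S -> bounded_op T ->
  (forall g t, S (eps g t) = T (eps g t)) -> S = T.
Proof.
move=> bS bT ST; apply: (@total_eq _ _ _ [set x | exists g t, x = eps g t]) => //.
  by move=> x h; apply: frame_total => g t; apply: h; exists g, t.
by move=> _ [g [t ->]].
Qed.

(** Both products send a frame vector to the same multiple of the same frame vector, and the frame
    is total. *)
Lemma model_commute i i' j j' : i != i' -> X i j \o X i' j' = X i' j' \o X i j.
Proof.
move=> ii'; apply: frame_eq; try exact: bounded_comp.
move=> g t /=; have [_ _ h] := XM; rewrite !h !(linZ (bX _).1) !h !scalerA.
rewrite (mupd_out g (j' :: g i')) 1?eq_sym // (mupd_out g (j :: g i)) //.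
by rewrite (mupdC _ _ _ ii') mulrC.
Qed.

Lemma word_op_commute i i' (w : word (n i)) j' : i != i' ->
  X i' j' \o word_op (X i) w = word_op (X i) w \o X i' j'.
Proof.
move=> ii'; elim: w => //= j w IH.
by rewrite compA (model_commute j' j) 1?eq_sym // -compA IH.
Qed.

Lemma multi_op_cons l i (j : 'I_(n i)) g : uniq l -> i \in l ->
  X i j \o multi_op l g = multi_op l (mupd g i (j :: g i)).
Proof.
elim: l => //= i' l IH /andP[il ul]; rewrite inE; case: eqVneq => [e _|ii' /= il'].
  by rewrite -e in il *; rewrite compA mupd_in multi_op_mupd.
by rewrite compA word_op_commute 1?eq_sym // -compA IH // mupd_out.
Qed.

Lemma multi_wt_cons l i (j : 'I_(n i)) g : uniq l -> i \in l ->
  multi_wt l g = mwt i (g i) / mwt i (j :: g i) * multi_wt l (mupd g i (j :: g i)).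
Proof.
move=> ul il; rewrite /multi_wt !(bigD1_seq i) //= mupd_in mulrA.
rewrite divfK ?gt_eqF ?mwt_gt0 //; congr (_ * _).
by apply: eq_bigr => i' ii'; rewrite mupd_out // eq_sym.
Qed.

Context (Y : V -> V) (d : nat -> V).
Hypothesis bY : bounded_op Y.
Hypothesis Y1 : forall x, (eqf Y x <= ensq x)%E.
Hypothesis pD : forall p : 'I_k -> nat, (forall i, (p i <= m i)%N) ->
  positive_op (Delta a X p Y).
Hypothesis hd : forall x,
  (\esum_(t in [set: nat]) (abs2 '[x, d t])%:E = eqf (Delta a X m Y) x)%E.

(* The image of [e_g] under the t-th component of the adjoint of the
   noncommutative Berezin kernel *)
Definition kernel_vec t g : V :=
  (Num.sqrt (multi_wt indices_rev g))%:C%C *: multi_op indices_rev g (d t).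

(** The weight ratio compensates the change of [multi_wt], so [X] acts on kernel vectors as [W] acts
    on its basis: [e_g |-> kernel_vec t g] intertwines. *)
Lemma kernel_vec_shift i j t g : X i j (kernel_vec t g) =
  (Num.sqrt (mwt i (g i) / mwt i (j :: g i)))%:C%C *: kernel_vec t (mupd g i (j :: g i)).
Proof.
have ul : uniq indices_rev by rewrite rev_uniq index_enum_uniq.
have il : i \in indices_rev by rewrite mem_rev mem_index_enum.
rewrite /kernel_vec (linZ (bX j).1) scalerA -rmorphM /= -sqrtrM; last first.
  by rewrite divr_ge0 ?mwt_ge0.
by rewrite -multi_wt_cons //; have /(congr1 (fun f => f (d t))) /= -> := multi_op_cons j g ul il.
Qed.

(** Combines [multi_form] with the expansion of [Delta^m (Y)] along [d]; the resulting family of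
    coefficients carries exactly the energy of [Y]. *)
Lemma kernel_energy x : (\esum_(t in [set: nat]) \esum_(g in [set: @mword k n])
  (abs2 '[x, kernel_vec t g])%:E = eqf Y x)%E.
Proof.
rewrite esum_exchange => [|t g]; last by rewrite lee_fin abs2_ge0.
rewrite (multi_form bY Y1 pD); apply: eq_esum => g _.
rewrite -hd -esumZl ?multi_wt_ge0 // => [|t]; last by rewrite lee_fin abs2_ge0.
apply: eq_esum => t _; rewrite -EFinM; congr EFin.
rewrite /kernel_vec linearZr_LR /= abs2M abs2J abs2_real sqr_sqrtr ?multi_wt_ge0 //.
by rewrite adjointEr //; exact: multi_op_bounded.
Qed.

End Kernel.
End Symbols.

(** * Tensor products *)

Section CountableBasis.
Context {R : realType} {V : hilbertType R} {I : countType} (e : I -> V).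
Hypothesis e1 : forall s t, '[e s, e t] = (s == t)%:R.
Hypothesis eT : forall x, (forall s, '[x, e s] = 0) -> x = 0.

Definition enumerated (W : lmodType R[i]) (f : I -> W) (n : nat) : W :=
  oapp f 0 (pickle_inv n).

Lemma pickle_inv_pickle (s : I) : pickle_inv (pickle s) = Some s.
Proof. exact: pickleK_inv. Qed.

Lemma enumerated_onbasis : onbasis (enumerated e).
Proof.
apply: orthosystem_total_onbasis; first split.
- move=> s t st; rewrite /enumerated.
  case es: (pickle_inv s) => [i|]; case et: (pickle_inv t) => [j|] /=;
    rewrite ?linear0l ?linear0r //.
  rewrite e1; case: eqP => // ij; move: st.
  have := @pickle_invK I s; have := @pickle_invK I t; rewrite es et /= => <- <-.
  by rewrite ij eqxx.
- move=> s; rewrite /enumerated; case: (pickle_inv s) => [i|] /=; last by left.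
  by right; rewrite e1 eqxx.
move=> x h; apply: eT => s; have := h (pickle s).
by rewrite /enumerated pickle_inv_pickle.
Qed.

Lemma esum_enumerated (f : I -> \bar R) : (forall s, (0 <= f s)%E) ->
  (\esum_(s in [set: I]) f s = \esum_(n in [set: nat]) oapp f 0%E (pickle_inv n))%E.
Proof.
move=> f0; pose g n := oapp f 0%E (pickle_inv n).
transitivity (\esum_(s in [set: I]) g (pickle s))%E.
  by apply: eq_esum => s _; rewrite /g pickle_inv_pickle.
rewrite -(esum_image [set: I] (@pickle I) g); last first.
  by move=> s t _ _; exact: (pcan_inj pickleK_inv).
rewrite esum_mkcond; apply: eq_esum => n _; rewrite -/(g n); case: ifPn => // nI.
rewrite /g; case en: (pickle_inv n) => [s|] //=; move: nI; rewrite notin_setE => -[].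
by exists s => //; have := @pickle_invK I n; rewrite en.
Qed.

Lemma basis_parseval x : (\esum_(s in [set: I]) (abs2 '[x, e s])%:E = (nsq x)%:E)%E.
Proof.
rewrite esum_enumerated => [|s]; last by rewrite lee_fin abs2_ge0.
rewrite -(onbasis_parseval x enumerated_onbasis); apply: eq_esum => n _.
by rewrite /enumerated; case: (pickle_inv n) => //=; rewrite linear0r abs2_0.
Qed.

Lemma basis_synthesis (W : hilbertType R) (v : I -> W) (C : R) : 0 < C ->
  (forall y, (\esum_(s in [set: I]) (abs2 '[y, v s])%:E <= (C * nsq y)%:E)%E) ->
  exists2 A : V -> W, bounded_op A & forall s, A (e s) = v s.
Proof.
move=> C0 vC; have eo := onbasis_orthosystem enumerated_onbasis.
have bv : bessel C (enumerated v).
  move=> y N; rewrite -lee_fin; apply: le_trans (vC y).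
  rewrite esum_enumerated => [|s]; last by rewrite lee_fin abs2_ge0.
  have E n : (abs2 '[y, enumerated v n])%:E = oapp (fun s => (abs2 '[y, v s])%:E) 0%E (pickle_inv n).
    by rewrite /enumerated; case: (pickle_inv n) => //=; rewrite linear0r abs2_0.
  under eq_esum do rewrite -E.
  rewrite -sumEFin -(big_mkord xpredT (fun n => (abs2 '[y, enumerated v n])%:E)).
  rewrite -nneseries_esumT => [|n]; last by rewrite lee_fin abs2_ge0.
  by apply: nneseries_lim_ge => n _; rewrite lee_fin abs2_ge0.
have lin n : scalar (fun x : V => '[x, enumerated e n]) by move=> c x y; rewrite linearPl.
have [A bA hA] := synthesis_op C0 ler01 bv lin (orthosystem_bessel eo).
exists A => // s; apply: tends_unique (hA (e s)) _ => r r0.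
exists (pickle s).+1 => N sN; rewrite (bigD1 (Ordinal sN)) //= {1}/enumerated.
rewrite pickle_inv_pickle /= e1 eqxx scale1r {1}/enumerated pickle_inv_pickle /=.
rewrite big1 ?addr0 ?subrr ?nsq0 // => -[t tN] /= ts.
suff -> : '[e s, enumerated e t] = 0 by rewrite scale0r.
have -> : e s = enumerated e (pickle s) by rewrite /enumerated pickle_inv_pickle.
by apply: eo.1; apply: contraNneq ts => st; apply/eqP/val_inj.
Qed.

End CountableBasis.

Section Tensor.
Context {R : realType}.
Implicit Types A B : hilbertType R.

Section OneTensor.
Context {A B : hilbertType R} (T : htensor A B).

Let elementary : set T := [set t | exists x y, t = tmap T x y].

Lemma tmap_total_set : total_set elementary.
Proof. by apply: closed_span_total; exact: tmap_total. Qed.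

Lemma tmap_eq (z z' : T) : (forall x y, '[z, tmap T x y] = '[z', tmap T x y]) -> z = z'.
Proof.
move=> h; apply/eqP; rewrite -subr_eq0; apply/eqP/tmap_total_set => _ [x [y ->]].
by rewrite linearBl /= h subrr.
Qed.

Lemma nsq_tmap x y : nsq (tmap T x y) = nsq x * nsq y.
Proof. by apply: complexI; rewrite -nsqE tmap_dot !nsqE rmorphM. Qed.

(** Linearity is forced by the inner products: both sides pair equally with every elementary tensor,
    and these are total. *)
Lemma tmap_boundedl y : bounded_op (fun x => tmap T x y).
Proof.
apply/bounded_opP; split=> [c u v|].
  apply: tmap_eq => x z; rewrite [RHS]linearPl /= !tmap_dot linearPl /= mulrDl.
  by rewrite -mulrA.
by exists (nsq y) => [|x]; rewrite ?nsq_ge0 // nsq_tmap mulrC.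
Qed.

Lemma tmap_boundedr x : bounded_op (tmap T x).
Proof.
apply/bounded_opP; split=> [c u v|].
  apply: tmap_eq => y z; rewrite [RHS]linearPl /= !tmap_dot linearPl /= mulrDr.
  by rewrite mulrCA.
by exists (nsq x) => [|y]; rewrite ?nsq_ge0 // nsq_tmap.
Qed.

Lemma tensor_eq (V : hilbertType R) (S S' : T -> V) : bounded_op S -> bounded_op S' ->
  (forall x y, S (tmap T x y) = S' (tmap T x y)) -> S = S'.
Proof.
move=> bS bS' h; apply: (total_eq tmap_total_set) => // _ [x [y ->]]; exact: h.
Qed.

(** The partial inner product with [y] in the second factor; it reduces statements on the tensor
    product to the first factor. *)
Definition slice y : T -> A := adjoint (fun x => tmap T x y).

Lemma slice_bounded y : bounded_op (slice y).
Proof. by apply: adjoint_bounded; exact: tmap_boundedl. Qed.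

Lemma slice_dot y z x : '[slice y z, x] = '[z, tmap T x y].
Proof. by rewrite adjointEr //; exact: tmap_boundedl. Qed.

Lemma slice_tmap y x y' : slice y (tmap T x y') = '[y', y] *: x.
Proof.
by apply: dot_inj => u; rewrite slice_dot tmap_dot linearZl_LR /= mulrC.
Qed.

Context (h : nat -> B).
Hypothesis hB : onbasis h.

Lemma tensor_orthogonal_sum (u : nat -> A) p q :
  nsq (\sum_(p <= t < q) tmap T (u t) (h t)) <= \sum_(p <= t < q) nsq (u t).
Proof.
have [ho h1 _] := hB; have [pq|/ltnW qp] := leqP p q; last first.
  by rewrite !big_geq // nsq0.
elim: q pq => [|q IH]; first by rewrite leqn0 => /eqP ->; rewrite !big_geq // nsq0.
rewrite leq_eqVlt => /predU1P[->|]; first by rewrite !big_geq // nsq0.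
rewrite ltnS => pq; rewrite !big_nat_recr //= nsqD dot_suml.
rewrite [X in complex.Re X]big_nat [X in complex.Re X]big1 => [|t /andP[_ tq]]; last first.
  by rewrite tmap_dot ho ?mulr0 // neq_ltn tq.
rewrite mul0r addr0 lerD ?IH // nsq_tmap.
have [->|e1] := h1 q; first by rewrite nsq0 mulr0 nsq_ge0.
by rewrite /(nsq (h q)) e1 mulr1.
Qed.

(** As for adjoints: with [w = sum_t slice_t z (x) h_t] one has [<z, w> = s] and [nsq w <= s], so
    Cauchy-Schwarz gives [s^2 <= (nsq z) s]. *)
Lemma slice_bessel z N : \sum_(t < N) nsq (slice (h t) z) <= nsq z.
Proof.
set s := \sum_(t < N) _.
have s0 : 0 <= s by apply: sumr_ge0 => t _; exact: nsq_ge0.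
pose w := \sum_(0 <= t < N) tmap T (slice (h t) z) (h t).
have ws : nsq w <= s.
  by have := tensor_orthogonal_sum (fun t => slice (h t) z) 0 N; rewrite [leRHS]big_mkord.
have zw : '[z, w] = s%:C%C.
  rewrite /w big_mkord dot_sumr /s rmorph_sum; apply: eq_bigr => t _.
  by rewrite -slice_dot nsqE.
have := abs2_dot z w; rewrite zw abs2_real => le.
have {}le : s * s <= nsq z * s.
  by rewrite -expr2; apply: le_trans le _; rewrite ler_wpM2l ?nsq_ge0.
have [<-|sn0] := eqVneq 0 s; first exact: nsq_ge0.
by move: le; rewrite ler_pM2r // lt_def eq_sym sn0.
Qed.

End OneTensor.

Arguments slice {A B} T y _.

(* [(f (x) id) z = sum_t f (slice_t z) (x) h_t] for an orthonormal basis h *)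
Lemma tensor_op_series A A' B (T : htensor A B) (T' : htensor A' B) (f : A -> A')
    (h : nat -> B) : onbasis h -> bounded_op f ->
  exists S : T -> T', [/\ bounded_op S, forall x y, S (tmap T x y) = tmap T' (f x) y
    & forall z, tends (fun N => \sum_(t < N) tmap T' (f (slice T (h t) z)) (h t)) (S z)].
Proof.
move=> hB bf; have /bounded_opP[lf [C C0 fC]] := bf.
pose SN N z := \sum_(t < N) tmap T' (f (slice T (h t) z)) (h t).
have bSN N : bounded_op (SN N).
  apply: bounded_sum => t; apply: (bounded_comp (tmap_boundedl T' (h t))).
  exact: (bounded_comp bf (slice_bounded T (h t))).
have SNsub z p q : (p <= q)%N -> nsq (SN q z - SN p z) <= C * \sum_(p <= t < q) nsq (slice T (h t) z).
  move=> pq; rewrite /SN (sum_subrange (fun t => tmap T' (f (slice T (h t) z)) (h t)) pq).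
  apply: le_trans (tensor_orthogonal_sum T' hB (fun t => f (slice T (h t) z)) p q) _.
  by rewrite mulr_sumr ler_sum.
have /choice[S hS] z : exists l, tends (fun N => SN N z) l.
  apply: nsq_complete => r r0.
  have [N hN] := partial_sums_cauchy (fun t => nsq_ge0 (slice T (h t) z)) (slice_bessel hB z)
    (divr_gt0 r0 (ltr_wpDl C0 (@ltr01 R))).
  have hlt p q : (N <= p)%N -> (p <= q)%N -> nsq (SN q z - SN p z) < r.
    move=> Np pq; apply: le_lt_trans (SNsub z p q pq) _.
    have := hN p q; rewrite Np pq ltr_pdivlMr ?ltr_wpDl // => /(_ isT).
    have : 0 <= \sum_(p <= t < q) nsq (slice T (h t) z).
      by apply: sumr_ge0 => t _; exact: nsq_ge0.
    by move: (\sum_(_ <= _ < _) _) => s; lra.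
  exists N => p q Np Nq; have [pq|/ltnW qp] := leqP p q; last exact: hlt.
  by rewrite nsqBC; exact: hlt.
exists S; split=> //.
  apply/bounded_opP; split=> [c x y|].
    apply: tends_unique (hS _) _; have := tends_lin c (hS x) (hS y).
    by congr tends; apply/funext => N; rewrite (bSN N).1.
  exists C => // z; apply: (tends_nsq_le (hS z)); exists 0%N => N _.
  have := SNsub z 0%N N (leq0n N); rewrite /SN big_ord0 subr0 => /le_trans; apply.
  by rewrite ler_wpM2l // big_mkord; exact: slice_bessel.
move=> x y; apply: tends_unique (hS _) _.
have [_ _ hy] := hB; have := bounded_tends (tmap_boundedr T' (f x)) (hy y).
congr tends; apply/funext => N /=; rewrite (lin_sum (tmap_boundedr T' (f x)).1).
apply: eq_bigr => t _; rewrite slice_tmap (linZ lf).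
by rewrite (linZ (tmap_boundedr T' (f x)).1) (linZ (tmap_boundedl T' (h t)).1).
Qed.

(** The slice series of the identity operator converges to [z]; pairing it with [z] produces the
    squared norms of the slices. *)
Lemma slice_parseval A B (T : htensor A B) (h : nat -> B) z : onbasis h ->
  (\esum_(t in [set: nat]) (nsq (slice T (h t) z))%:E = (nsq z)%:E)%E.
Proof.
move=> hB; have [S [bS hS Slim]] := tensor_op_series T T hB (bounded_id A).
have Sid : S = id by apply: tensor_eq => //; exact: bounded_id.
apply: esum_nat_lim => [t|N|e e0]; [exact: nsq_ge0|exact: slice_bessel|].
have [N /(_ N (leqnn N)) close] := tends_Re z e0 (Slim z); exists N; move: close.
rewrite Sid dot_suml Re_sum.
have -> : \sum_(t < N) complex.Re '[tmap T (slice T (h t) z) (h t), z] =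
          \sum_(t < N) nsq (slice T (h t) z).
  by apply: eq_bigr => t _; rewrite hdotC -slice_dot ReJ.
by rewrite -/(nsq z) ltr_norml => /andP[? ?]; lra.
Qed.

Lemma tensor_opP A A' B (T : htensor A B) (T' : htensor A' B) (f : A -> A') :
  bounded_op f -> bounded_op (tensor_op T T' f id) /\
    forall x y, tensor_op T T' f id (tmap T x y) = tmap T' (f x) y.
Proof.
move=> bf; have [h hB] := exists_onbasis (V := B).
have [S [bS hS _]] := tensor_op_series T T' hB bf.
by apply: (the_opP (P := [set S : T -> T' | bounded_op S /\
  forall x y, S (tmap T x y) = tmap T' (f x) y]) (conj bS hS)).
Qed.

Lemma tensor_op_slice A A' B (T : htensor A B) (T' : htensor A' B) (f : A -> A') y z :
  bounded_op f -> slice T' y (tensor_op T T' f id z) = f (slice T y z).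
Proof.
move=> bf; have [bS hS] := tensor_opP T T' bf.
have bl := bounded_comp (slice_bounded T' y) bS.
have br := bounded_comp bf (slice_bounded T y).
suff e : slice T' y \o tensor_op T T' f id = f \o slice T y.
  exact: (congr1 (fun S => S z) e).
by apply: (tensor_eq bl br) => u v /=; rewrite hS !slice_tmap (linZ bf.1).
Qed.

End Tensor.

Arguments slice {R A B} T y _.

Section ComplexLimits.
Context {R : realType}.
Implicit Types u v : nat -> R[i].

Definition climit u (l : R[i]) : Prop := forall e : R, 0 < e ->
  exists N : nat, forall n, (N <= n)%N -> abs2 (u n - l) < e.

Lemma climit_unique u l l' : climit u l -> climit u l' -> l = l'.
Proof.
move=> ul ul'; apply/eqP; rewrite -subr_eq0; apply/eqP.
apply: (@abs2_eps0 R _ 4) => e e0.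
have [N1 h1] := ul _ e0; have [N2 h2] := ul' _ e0.
have {}h1 := h1 _ (leq_maxl N1 N2); have {}h2 := h2 _ (leq_maxr N1 N2).
rewrite -opprB abs2N in h1; rewrite -[l](subrK (u (maxn N1 N2))) -addrA.
apply: le_trans (abs2_leD _ _) _.
by move: h1 h2; move: (abs2 _) (abs2 _) => r s; lra.
Qed.

Lemma climit_lin u v l l' c : climit u l -> climit v l' ->
  climit (fun n => c * u n + v n) (c * l + l').
Proof.
move=> ul vl e e0; have K0 : 0 < 4 * (abs2 c + 1) by rewrite mulr_gt0 // ltr_wpDl ?abs2_ge0.
have [N1 h1] := ul _ (divr_gt0 e0 K0).
have [N2 h2] := vl _ (divr_gt0 e0 (ltr0Sn R 3)).
exists (maxn N1 N2) => n; rewrite geq_max => /andP[/h1 {}h1 /h2 {}h2].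
have -> : c * u n + v n - (c * l + l') = c * (u n - l) + (v n - l').
  by rewrite mulrBr opprD addrACA.
apply: le_lt_trans (abs2_leD _ _) _; rewrite abs2M.
have a0 := abs2_ge0 c; have n0 := abs2_ge0 (u n - l).
rewrite ltr_pdivlMr // in h1; rewrite ltr_pdivlMr // in h2.
move: (abs2 c) (abs2 _) (abs2 _) a0 n0 h1 h2 => a r s a0 n0 h1 h2; nra.
Qed.

Lemma climitJ u l : climit u l -> climit (fun n => (u n)^*) l^*.
Proof.
move=> ul e /ul[N h]; exists N => n /h; by rewrite -rmorphB abs2J.
Qed.

Lemma bounded_sums_limit (f : nat -> R) (C : R) : (forall n, 0 <= f n) ->
  (forall N, \sum_(n < N) f n <= C) ->
  exists s, (forall N, \sum_(n < N) f n <= s) /\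
    forall e : R, 0 < e -> exists N : nat, forall n, (N <= n)%N -> s - \sum_(i < n) f i < e.
Proof.
move=> f0 fC; pose E := range (fun N => \sum_(n < N) f n).
have supE : has_sup E.
  by split; [exists (\sum_(n < 0) f n), 0%N|exists C => _ [N _ <-]].
have ub N : \sum_(n < N) f n <= sup E by apply: ub_le_sup; [case: supE|exists N].
exists (sup E); split=> // e e0; have [_ [N _ <-] hN] := sup_adherent e0 supE.
exists N => n Nn; rewrite (sum_ord_cat _ Nn).
have : 0 <= \sum_(N <= i < n) f i by apply: sumr_ge0.
by lra.
Qed.

End ComplexLimits.

(** * The Hilbert space l^2(N) *)

Section SquareSummable.
Context {R : realType} (N : hilbertType R).

Definition hl2_pred : {pred (nat -> N)} :=
  fun x => `[< exists C : R, forall K, \sum_(n < K) nsq (x n) <= C >].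

Lemma hl2_predP (x : nat -> N) :
  reflect (exists C : R, forall K, \sum_(n < K) nsq (x n) <= C) (x \in hl2_pred).
Proof. by rewrite unfold_in; exact: asboolP. Qed.

Lemma hl2_pred_closed : subsemimod_closed hl2_pred.
Proof.
split.
  split=> [|x y /hl2_predP[C xC] /hl2_predP[D yD]]; apply/hl2_predP.
    by exists 0 => K; rewrite big1 // => i _; rewrite nsq0.
  exists (2 * C + 2 * D) => K; apply: le_trans (_ : \sum_(n < K) (2 * nsq (x n) + 2 * nsq (y n)) <= _).
    by apply: ler_sum => i _; exact: nsq_leD.
  by rewrite big_split /= -!mulr_sumr; have := xC K; have := yD K; lra.
move=> c x /hl2_predP[C xC]; apply/hl2_predP; exists (abs2 c * C) => K.
rewrite (eq_bigr (fun i : 'I_K => abs2 c * nsq (x i))) => [|i _]; last by rewrite -nsqZ.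
rewrite -mulr_sumr; apply: ler_wpM2l; [exact: abs2_ge0|exact: xC].
Qed.

HB.instance Definition _ :=
  GRing.isSubmodClosed.Build R[i] (nat -> N) hl2_pred hl2_pred_closed.

Definition hl2 : Type := {x : nat -> N | x \in hl2_pred}.

HB.instance Definition _ := SubChoice.on hl2.
HB.instance Definition _ := [SubChoice_isSubLmodule of hl2 by <:].

Definition hl2_seq (x : hl2) : nat -> N := val x.

Lemma hl2_seqP (c : R[i]) (x y : hl2) n :
  hl2_seq (c *: x + y) n = c *: hl2_seq x n + hl2_seq y n.
Proof. by rewrite /hl2_seq linearP. Qed.

Lemma hl2_seqB (x y : hl2) n : hl2_seq (x - y) n = hl2_seq x n - hl2_seq y n.
Proof. by rewrite /hl2_seq raddfB. Qed.

Lemma hl2_eq (x y : hl2) : (forall n, hl2_seq x n = hl2_seq y n) -> x = y.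
Proof. by move=> h; apply/val_inj/funext. Qed.

Lemma hl2_mk (x : nat -> N) (C : R) : (forall K, \sum_(n < K) nsq (x n) <= C) ->
  exists z : hl2, hl2_seq z = x.
Proof.
move=> xC; have h : x \in hl2_pred by apply/hl2_predP; exists C.
by exists (exist _ x h).
Qed.

Lemma hl2_sum_limit (x : hl2) : exists s : R,
  (forall K, \sum_(n < K) nsq (hl2_seq x n) <= s) /\
  forall e : R, 0 < e -> exists K : nat, forall n, (K <= n)%N ->
    s - \sum_(i < n) nsq (hl2_seq x i) < e.
Proof.
have /hl2_predP[C xC] := valP x.
exact: (bounded_sums_limit (f := fun n => nsq (hl2_seq x n)) (fun n => nsq_ge0 _) xC).
Qed.

Definition partial_dot (x y : hl2) K : R[i] := \sum_(n < K) '[hl2_seq x n, hl2_seq y n].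

Definition rlimit (u : nat -> R) (r : R) : Prop := forall e : R, 0 < e ->
  exists K : nat, forall n, (K <= n)%N -> `|u n - r| < e.

(** Polarization: the real part is half a difference of three partial sums of squared norms, each of
    which converges. *)
Lemma Re_partial_dot (x y : hl2) :
  exists r, rlimit (fun K => complex.Re (partial_dot x y K)) r.
Proof.
have [sx [xs hx]] := hl2_sum_limit x; have [sy [ys hy]] := hl2_sum_limit y.
have [sz [zs hz]] := hl2_sum_limit (x + y).
exists ((sz - sx - sy) / 2) => e e0.
have e3 : 0 < e / 2 by rewrite divr_gt0.
have [K1 h1] := hx _ e3; have [K2 h2] := hy _ e3; have [K3 h3] := hz _ e3.
exists (maxn K1 (maxn K2 K3)) => n; rewrite !geq_max => /and3P[/h1 {}h1 /h2 {}h2 /h3 {}h3].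
have {xs hx} xs := xs n; have {ys hy} ys := ys n; have {zs hz} zs := zs n.
have E : complex.Re (partial_dot x y n) =
    (\sum_(i < n) nsq (hl2_seq (x + y) i) - \sum_(i < n) nsq (hl2_seq x i) -
     \sum_(i < n) nsq (hl2_seq y i)) / 2.
  rewrite /partial_dot Re_sum -!sumrB mulr_suml; apply: eq_bigr => i _.
  by rewrite -[x]scale1r hl2_seqP !scale1r nsqD; field.
rewrite E ltr_norml; move: h1 h2 h3 xs ys zs.
move: (\sum_(i < n) _) (\sum_(i < n) _) (\sum_(i < n) _) => p q r *; apply/andP; split; lra.
Qed.

Lemma partial_dotZ (x y : hl2) (c : R[i]) K :
  partial_dot (c *: x) y K = c * partial_dot x y K.
Proof.
rewrite /partial_dot mulr_sumr; apply: eq_bigr => n _.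
by rewrite -[c *: x]addr0 hl2_seqP linearPl linear0l addr0.
Qed.

(** Multiplication by [- i] turns the imaginary part into a real part, to which [Re_partial_dot]
    applies. *)
Lemma partial_dot_limit (x y : hl2) : exists l, climit (partial_dot x y) l.
Proof.
have [r hr] := Re_partial_dot x y; have [s hs] := Re_partial_dot ((- 'i)%C *: x) y.
exists (Complex r s) => e e0; have e2 : 0 < Num.sqrt (e / 2) by rewrite sqrtr_gt0 divr_gt0.
have [K1 h1] := hr _ e2; have [K2 h2] := hs _ e2.
exists (maxn K1 K2) => n; rewrite geq_max => /andP[/h1 {}h1 /h2 {}h2].
rewrite partial_dotZ in h2; case: (partial_dot x y n) h1 h2 => p q /=.
have sq z : `|z| < Num.sqrt (e / 2) -> z ^+ 2 < e / 2.
  move=> hz; rewrite -[e / 2]sqr_sqrtr ?divr_ge0 ?(ltW e0) // -(real_normK (num_real z)).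
  by rewrite ltr_pXn2r ?nnegrE ?sqrtr_ge0.
move=> /sq h1 /sq h2; rewrite /abs2 /=; move: h1 h2; rewrite !expr2; lra.
Qed.

Definition hl2_dot (x y : hl2) : R[i] := xget 0 [set l | climit (partial_dot x y) l].

Lemma hl2_dotP x y : climit (partial_dot x y) (hl2_dot x y).
Proof.
exact: (@xgetPex _ 0 [set l | climit (partial_dot x y) l] (partial_dot_limit x y)).
Qed.

Lemma hl2_dot_eq x y l : climit (partial_dot x y) l -> hl2_dot x y = l.
Proof. exact/climit_unique/hl2_dotP. Qed.

Lemma hl2_dot_bilinear :
  bilinear_for *%R (GRing.Scale.Law.clone _ _ (@Num.conj R[i] \; *%R) _) hl2_dot.
Proof.
split=> [y c x x'|x c y y']; apply: hl2_dot_eq.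
  have := climit_lin c (hl2_dotP x y) (hl2_dotP x' y); congr climit; apply/funext => K.
  rewrite /partial_dot mulr_sumr -big_split /=; apply: eq_bigr => n _.
  by rewrite hl2_seqP linearPl.
have := climit_lin c^* (hl2_dotP x y) (hl2_dotP x y'); congr climit; apply/funext => K.
rewrite /partial_dot mulr_sumr -big_split /=; apply: eq_bigr => n _.
by rewrite hl2_seqP linearPr.
Qed.

HB.instance Definition _ :=
  bilinear_isBilinear.Build _ _ _ _ _ _ hl2_dot hl2_dot_bilinear.

Lemma hl2_dot_herm (x y : hl2) : hl2_dot x y = (-1) ^+ false * (hl2_dot y x)^*.
Proof.
rewrite expr0 mul1r; apply: hl2_dot_eq; have := climitJ (hl2_dotP y x).
congr climit; apply/funext => K; rewrite /partial_dot rmorph_sum.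
by apply: eq_bigr => n _; rewrite [RHS]hdotC.
Qed.

HB.instance Definition _ :=
  isHermitianSesquilinear.Build _ _ _ _ hl2_dot hl2_dot_herm.

Lemma hl2_dot_limit (x : hl2) (s : R) :
  (forall K, \sum_(n < K) nsq (hl2_seq x n) <= s) ->
  (forall e : R, 0 < e -> exists K : nat, forall n, (K <= n)%N ->
    s - \sum_(i < n) nsq (hl2_seq x i) < e) -> hl2_dot x x = s%:C%C.
Proof.
move=> xs hs; apply: hl2_dot_eq => e e0.
have e2 : 0 < Num.sqrt e by rewrite sqrtr_gt0.
have [K h] := hs _ e2; exists K => n /h {}h.
have -> : partial_dot x x n = (\sum_(i < n) nsq (hl2_seq x i))%:C%C.
  by rewrite rmorph_sum; apply: eq_bigr => i _; rewrite nsqE.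
rewrite -rmorphB abs2_real -[ltRHS](sqr_sqrtr (ltW e0)) -sqrrN opprB.
by rewrite ltr_pXn2r ?nnegrE ?sqrtr_ge0 ?subr_ge0.
Qed.

Definition hl2_nsq (x : hl2) : R := complex.Re (hl2_dot x x).

Lemma hl2_nsqP (x : hl2) : [/\ hl2_dot x x = (hl2_nsq x)%:C%C,
  forall K, \sum_(n < K) nsq (hl2_seq x n) <= hl2_nsq x
  & forall e : R, 0 < e -> exists K : nat, forall n, (K <= n)%N ->
    hl2_nsq x - \sum_(i < n) nsq (hl2_seq x i) < e].
Proof.
have [s [xs hs]] := hl2_sum_limit x.
by rewrite /hl2_nsq (hl2_dot_limit xs hs).
Qed.

Lemma hl2_nsq_le (x : hl2) (C : R) :
  (forall K, \sum_(n < K) nsq (hl2_seq x n) <= C) -> hl2_nsq x <= C.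
Proof.
move=> xC; have [_ _ h] := hl2_nsqP x; apply/ler_addgt0Pr => e /h[K /(_ K (leqnn K))].
by have := xC K; lra.
Qed.

Lemma hl2_nsq_coord (x : hl2) n : nsq (hl2_seq x n) <= hl2_nsq x.
Proof.
have [_ /(_ n.+1) h _] := hl2_nsqP x; apply: le_trans h.
by rewrite big_ord_recr /= lerDr sumr_ge0 // => i _; exact: nsq_ge0.
Qed.

Lemma hl2_dot_gt0 (x : hl2) : x != 0 -> 0 < hl2_dot x x.
Proof.
have [-> _ _] := hl2_nsqP x => x0; rewrite ltcR lt_def.
have p : 0 <= hl2_nsq x := le_trans (nsq_ge0 _) (hl2_nsq_coord x 0).
rewrite p andbT; apply: contraNneq x0 => h; apply/eqP/hl2_eq => n.
have -> : hl2_seq 0 n = 0 by rewrite /hl2_seq raddf0.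
by apply: nsq_eq0; apply/eqP; rewrite eq_le nsq_ge0 andbT -h hl2_nsq_coord.
Qed.

HB.instance Definition _ := isDotProduct.Build _ _ hl2_dot hl2_dot_gt0.

Lemma hl2_normE (x : hl2) : dot_norm hl2_dot x = Num.sqrt (hl2_nsq x).
Proof. by []. Qed.

Lemma hl2_norm_lt (x : hl2) (e : R) : 0 < e ->
  (dot_norm hl2_dot x < e) = (hl2_nsq x < e ^+ 2).
Proof.
move=> e0; have p : 0 <= hl2_nsq x := le_trans (nsq_ge0 _) (hl2_nsq_coord x 0).
by rewrite hl2_normE -{2}(sqr_sqrtr p) ltr_pXn2r ?nnegrE ?sqrtr_ge0 ?ltW.
Qed.

Lemma hl2_complete (u : nat -> hl2) : dot_cauchy hl2_dot u -> exists l, dot_cvg hl2_dot u l.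
Proof.
move=> cu.
have cu' (e : R) : 0 < e -> exists K : nat, forall p q, (K <= p)%N -> (K <= q)%N ->
    hl2_nsq (u p - u q) < e.
  move=> e0; have e1 : 0 < Num.sqrt e by rewrite sqrtr_gt0.
  have [K h] := cu _ e1; exists K => p q Kp Kq.
  by have := h p q Kp Kq; rewrite hl2_norm_lt // sqr_sqrtr // ltW.
have /choice[l hl] n : exists l, tends (fun p => hl2_seq (u p) n) l.
  apply: nsq_complete => e /cu'[K h]; exists K => p q Kp Kq.
  by rewrite -hl2_seqB; apply: le_lt_trans (hl2_nsq_coord _ _) (h p q Kp Kq).
have close (e : R) : 0 < e -> exists K : nat, forall p, (K <= p)%N -> forall M,
    \sum_(n < M) nsq (hl2_seq (u p) n - l n) <= 2 * e.
  move=> e0; have [K h] := cu' _ e0; exists K => p Kp M.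
  (* For fixed [M], compare with a later [u q] whose first [M] coordinates are within [r] of the
     limit, then let [r] tend to 0. *)
  apply: (@le_eps _ _ _ (2 * M%:R)) => r r0.
  have [Q hQ] : exists Q : nat, forall q, (Q <= q)%N -> forall n, (n < M)%N ->
      nsq (hl2_seq (u q) n - l n) < r.
    elim: M => [|M [Q hQ]]; first by exists 0%N.
    have [Q' hQ'] := hl M _ r0; exists (maxn Q Q') => q; rewrite geq_max => /andP[Qq Q'q] n.
    by rewrite ltnS leq_eqVlt => /predU1P[->|]; [exact: hQ'|exact: hQ].
  pose q := maxn Q K.
  apply: le_trans (_ : \sum_(n < M) (2 * nsq (hl2_seq (u p - u q) n) + 2 * r) <= _).
    apply: ler_sum => n _.
    have -> : hl2_seq (u p) n - l n = hl2_seq (u p - u q) n + (hl2_seq (u q) n - l n).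
      by rewrite hl2_seqB addrA subrK.
    apply: le_trans (nsq_leD _ _) _; rewrite lerD2l ler_pM2l //.
    by apply/ltW/hQ; [exact: leq_maxl|exact: ltn_ord].
  rewrite big_split /= -mulr_sumr sumr_const card_ord -mulr_natr.
  have [_ /(_ M) h1 _] := hl2_nsqP (u p - u q).
  have := h p q Kp (leq_maxr _ _); move: h1.
  by move: (\sum_(_ < _) _) (hl2_nsq _) => s t; rewrite -!mulrA [M%:R * r]mulrC; lra.
(* Square summability is known only for differences from the coordinatewise limit, so the limit is
   recovered as [u K0] minus such a difference. *)
have [K0 h0] := close _ ltr01.
have [d hd] := hl2_mk (h0 _ (leqnn K0) : forall M, \sum_(n < M) nsq ((fun n => hl2_seq (u K0) n - l n) n) <= _).
exists (u K0 - d); apply/cvgrPdist_lt => e e0.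
have e1 : 0 < e ^+ 2 / 4 by rewrite divr_gt0 ?exprn_gt0.
have [K h] := close _ e1; exists K => // p Kp.
rewrite /= sub0r normrN ger0_norm ?sqrtr_ge0 // hl2_norm_lt //.
apply: le_lt_trans (_ : hl2_nsq _ <= 2 * (e ^+ 2 / 4)) _; last first.
  by have := exprn_gt0 2 e0; lra.
apply: hl2_nsq_le => M; apply: le_trans (h p Kp M).
by apply: ler_sum => n _; rewrite !hl2_seqB hd /= subKr.
Qed.

(** The dense sequence consists of the finitely supported sequences with entries from a dense
    sequence of [N], coded by finite lists of indices. *)
Lemma hl2_separable : exists u : nat -> hl2,
  forall (x : hl2) (e : R), 0 < e -> exists j, dot_norm hl2_dot (x - u j) < e.
Proof.
have [w dw] := nsq_dense (V := N).
pose f (s : seq nat) n : N := if (n < size s)%N then w (nth 0%N s n) else 0.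
have /choice[v hv] s : exists z : hl2, hl2_seq z = f s.
  apply: (@hl2_mk _ (\sum_(n < size s) nsq (f s n))) => K.
  have f0 n : 0 <= nsq (f s n) by exact: nsq_ge0.
  have [Ks|/ltnW sK] := leqP K (size s).
    by rewrite (sum_ord_cat (fun n => nsq (f s n)) Ks) lerDl sumr_ge0.
  rewrite (sum_ord_cat (fun n => nsq (f s n)) sK) [X in _ + X]big_nat.
  rewrite [X in _ + X]big1 ?addr0 // => n /andP[sn _].
  by rewrite /f ltnNge sn nsq0.
exists (fun j => if unpickle j is Some s then v s else 0) => x e e0.
have e1 : 0 < e ^+ 2 / 2 by rewrite divr_gt0 ?exprn_gt0.
have [_ _ /(_ _ e1)[K hK]] := hl2_nsqP x.
(* The tail beyond [K] costs less than [e^2 / 2]; a further [e^2 / 4] is shared by the first [K]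
   coordinates, with [K + 1] keeping the divisor nonzero. *)
have d0 : 0 < e ^+ 2 / 2 / (2 * (K%:R + 1)) by rewrite divr_gt0 // mulr_gt0 // ltr_wpDl.
have /choice[g hg] n : exists j, nsq (hl2_seq x n - w j) < e ^+ 2 / 2 / (2 * (K%:R + 1)).
  exact: dw.
exists (pickle (mkseq g K)); rewrite pickleK hl2_norm_lt //.
apply: le_lt_trans (_ : _ <= e ^+ 2 / 2 + e ^+ 2 / 2 / 2) _; last first.
  by have := exprn_gt0 2 e0; lra.
have [_ xs _] := hl2_nsqP x.
apply: hl2_nsq_le => M; pose L := maxn K M.
have z0 n : 0 <= nsq (hl2_seq (x - v (mkseq g K)) n) by exact: nsq_ge0.
apply: le_trans (_ : \sum_(n < L) nsq (hl2_seq (x - v (mkseq g K)) n) <= _).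
  rewrite (sum_ord_cat (fun n => nsq (hl2_seq (x - v (mkseq g K)) n)) (leq_maxr K M)).
  by rewrite lerDl sumr_ge0.
rewrite (sum_ord_cat (fun n => nsq (hl2_seq (x - v (mkseq g K)) n)) (leq_maxl K M)) addrC.
apply: lerD.
  apply: le_trans (_ : \sum_(K <= n < L) nsq (hl2_seq x n) <= _).
    rewrite !big_nat; apply: ler_sum => n /andP[Kn _].
    by rewrite hl2_seqB hv /f size_mkseq ltnNge Kn subr0.
  have := xs L; rewrite (sum_ord_cat (fun n => nsq (hl2_seq x n)) (leq_maxl K M)).
  by have := hK K (leqnn K); lra.
apply: le_trans (_ : \sum_(n < K) e ^+ 2 / 2 / (2 * (K%:R + 1)) <= _).
  apply: ler_sum => n _; rewrite hl2_seqB hv /f size_mkseq ltn_ord nth_mkseq ?ltn_ord //.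
  exact/ltW/hg.
rewrite sumr_const card_ord; move: (e ^+ 2 / 2) e1 => c c0.
have k0 : 0 <= K%:R :> R by rewrite ler0n.
rewrite -[leLHS]mulr_natr; move: K%:R k0 => r r0.
have k1 : 0 < 2 * (r + 1) by lra.
by rewrite mulrAC ler_pdivrMr //; nra.
Qed.

HB.instance Definition _ := isHilbert.Build R hl2 hl2_complete hl2_separable.

Lemma nsq_hl2 (x : hl2) : (\esum_(n in [set: nat]) (nsq (hl2_seq x n))%:E = (nsq x)%:E)%E.
Proof.
have [_ h1 h2] := hl2_nsqP x.
apply: esum_nat_lim => [n|//|e /h2[K /(_ K (leqnn K))]]; first exact: nsq_ge0.
by rewrite -/(nsq x) => h; exists K; move: h; rewrite -/(nsq x); lra.
Qed.

(** * l^2(N) as a realization of a tensor product *)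

Section HilbertTensor.
Context (E : hilbertType R) (eta : nat -> E).
Hypothesis etaB : onbasis eta.
Hypothesis eta1 : forall n, '[eta n, eta n] = 1.

Lemma hl2_tmap_exists (x : N) (y : E) :
  exists z : hl2, hl2_seq z = fun n => '[y, eta n] *: x.
Proof.
apply: (@hl2_mk _ (1 * nsq y * nsq x)) => K.
rewrite (eq_bigr (fun n : 'I_K => abs2 '[y, eta n] * nsq x)) => [|n _]; last by rewrite nsqZ.
by rewrite -mulr_suml ler_wpM2r ?nsq_ge0 // (orthosystem_bessel (onbasis_orthosystem etaB)).
Qed.

(** An elementary tensor is identified with the sequence of its slices along [eta]. No [eta n] may
    vanish, since coordinate [n] is reached only through [x (x) eta n]. *)
Definition hl2_tmap x y : hl2 := xget 0 [set z | hl2_seq z = fun n => '[y, eta n] *: x].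

Lemma hl2_tmapE x y n : hl2_seq (hl2_tmap x y) n = '[y, eta n] *: x.
Proof. by rewrite (xgetPex 0 (hl2_tmap_exists x y)). Qed.

Lemma hl2_tmap_dot x x' y y' : '[hl2_tmap x y, hl2_tmap x' y'] = '[x, x'] * '[y, y'].
Proof.
apply: hl2_dot_eq => e e0; have [_ _ hy] := etaB.
have K0 : 0 < abs2 '[x, x'] + 1 by rewrite ltr_wpDl ?abs2_ge0.
have [K h] := tends_dot y' (divr_gt0 e0 K0) (hy y); exists K => n /h {}h.
have -> : partial_dot (hl2_tmap x y) (hl2_tmap x' y') n =
    '[x, x'] * '[\sum_(i < n) '[y, eta i] *: eta i, y'].
  rewrite dot_suml mulr_sumr; apply: eq_bigr => i _; rewrite !hl2_tmapE.
  rewrite linearZl_LR linearZr_LR linearZl_LR /= -hdotC.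
  by rewrite mulrA mulrC mulrA.
rewrite -mulrBr abs2M; rewrite ltr_pdivlMr // in h.
have := abs2_ge0 '[x, x']; have := abs2_ge0 ('[\sum_(i < n) '[y, eta i] *: eta i, y'] - '[y, y']).
by move: (abs2 _) (abs2 _) h => p q; nra.
Qed.

Lemma hl2_tmap_coord x t (z : hl2) : '[hl2_tmap x (eta t), z] = '[x, hl2_seq z t].
Proof.
have [ort _ _] := etaB.
apply: hl2_dot_eq => e e0; exists t.+1 => M tM.
rewrite /partial_dot (bigD1 (Ordinal tM)) //= hl2_tmapE eta1 scale1r big1.
  by rewrite addr0 subrr abs2_0.
move=> i it; rewrite hl2_tmapE ort ?scale0r ?linear0l //.
by apply: contraNneq it => te; apply/eqP/val_inj.
Qed.

Lemma hl2_tmap_total : closed_span [set t | exists x y, t = hl2_tmap x y] = setT.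
Proof.
have [ort _ _] := etaB.
apply/seteqP; split=> // z _; exists (fun K => \sum_(n < K) hl2_tmap (hl2_seq z n) (eta n)).
  move=> K; exists K, (fun=> 1), (fun n : 'I_K => hl2_tmap (hl2_seq z n) (eta n)).
  split; first by move=> n; exists (hl2_seq z n), (eta n).
  by apply: eq_bigr => n _; rewrite scale1r.
apply/hcvgP => e e0; have [_ zs /(_ _ e0)[K hK]] := hl2_nsqP z.
exists K => M KM; have {}hK := hK M KM; rewrite nsqBC.
apply: le_lt_trans hK; apply: hl2_nsq_le => L.
set p := \sum_(n < M) _.
have pE n : hl2_seq p n = if (n < M)%N then hl2_seq z n else 0.
  have -> : hl2_seq p n = \sum_(i < M) hl2_seq (hl2_tmap (hl2_seq z i) (eta i)) n.
    rewrite /p; elim: (M) => [|m IH]; first by rewrite !big_ord0 /hl2_seq raddf0.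
    by rewrite !big_ord_recr /= -IH -[\sum_(i < m) _]scale1r hl2_seqP !scale1r.
  case: ifPn => nM.
    rewrite (bigD1 (Ordinal nM)) //= hl2_tmapE eta1 scale1r big1 ?addr0 // => i im.
    by rewrite hl2_tmapE ort ?scale0r.
  rewrite big1 // => i _; rewrite hl2_tmapE ort ?scale0r //.
  by apply: contraNneq nM => <-; exact: ltn_ord.
have z0 n : 0 <= nsq (hl2_seq (z - p) n) by exact: nsq_ge0.
apply: le_trans (_ : \sum_(n < maxn M L) nsq (hl2_seq (z - p) n) <= _).
  rewrite (sum_ord_cat (fun n => nsq (hl2_seq (z - p) n)) (leq_maxr M L)).
  by rewrite lerDl sumr_ge0.
rewrite (sum_ord_cat (fun n => nsq (hl2_seq (z - p) n)) (leq_maxl M L)).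
rewrite big1 ?add0r => [|i _]; last by rewrite hl2_seqB pE ltn_ord subrr nsq0.
have := zs (maxn M L); rewrite (sum_ord_cat (fun n => nsq (hl2_seq z n)) (leq_maxl M L)).
suff -> : \sum_(M <= n < maxn M L) nsq (hl2_seq (z - p) n) =
          \sum_(M <= n < maxn M L) nsq (hl2_seq z n) by rewrite -lerBrDl.
rewrite !big_nat; apply: eq_bigr => n /andP[Mn _].
by rewrite hl2_seqB pE ltnNge Mn subr0.
Qed.

Definition hl2_htensor : htensor N E := HTensor hl2_tmap_dot hl2_tmap_total.

End HilbertTensor.
End SquareSummable.

(** * Partial isometries *)

Section PartialIsometries.
Context {R : realType} {U V : hilbertType R}.

(** [adjoint Psi y] is orthogonal to the kernel of [Psi], so [Q] and its square have the same form
    and [Q] is idempotent. Then [v - Q v] is killed by [adjoint Psi], hence orthogonal to [M]. *)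
Lemma partial_isometry_projection (Psi : U -> V) (M : closedSubspace V) :
  bounded_op Psi -> partial_isometry Psi -> (M : set V) = range Psi ->
  projection M = Psi \o adjoint Psi.
Proof.
move=> bP iso MP; have bA := adjoint_bounded bP; set Q := Psi \o adjoint Psi.
have bQ : bounded_op Q := bounded_comp bP bA.
have hQ : hermitian_op Q by move=> x y; rewrite /Q /= adjointE // adjointEr.
have nQ y : nsq (Q y) = qf Q y.
  have iso' : nsq (Psi (adjoint Psi y)) = nsq (adjoint Psi y).
    by rewrite !nsq_hnorm iso // => z Pz; rewrite adjointEr // Pz linear0r.
  by rewrite [LHS]iso' /qf /Q /= adjointE.
have QQ y : Q (Q y) = Q y.
  have E : Q \o Q = Q.
    apply: qf_inj; [exact: (bounded_comp bQ bQ).1|exact: bQ.1| |exact: hQ|].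
      by move=> x z; rewrite /= !hQ.
    by move=> x; rewrite -nQ /qf /= hQ.
  exact: (congr1 (fun f => f y) E).
have A0 v : adjoint Psi (v - Q v) = 0.
  apply: nsq_eq0.
  have -> : nsq (adjoint Psi (v - Q v)) = qf Q (v - Q v) by rewrite /qf /Q /= adjointE.
  by rewrite /qf (linB bQ.1) QQ subrr linear0l.
apply/funext => v; rewrite -{1}[v](subrK (Q v)).
rewrite (linD (projection_bounded M).1) {1}/projection orth_proj_orth; last first.
  by rewrite MP => _ [x _ <-]; rewrite -adjointEr // A0 linear0l.
rewrite raddf0 add0r /projection orth_proj_in //.
by rewrite -/(cs_set M (Q v)) MP; exists (adjoint Psi v).
Qed.

(** Equal forms give [adjoint L \o L = projection M]; hence [L] kills [projection M x - x] and
    [adjoint L] has values in [M]. Off the kernel of [adjoint L], [z = L (adjoint L z)] yields the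
    norm identity. *)
Lemma projection_partial_isometry (L : V -> U) (M : closedSubspace V) :
  bounded_op L -> (forall x, nsq (L x) = nsq (orth_proj M x)) ->
  partial_isometry (adjoint L) /\ (M : set V) = range (adjoint L).
Proof.
move=> bL nL; have bA := adjoint_bounded bL.
have E : adjoint L \o L = projection M.
  apply: qf_inj; [exact: (bounded_comp bA bL).1|exact: (projection_bounded M).1| | |].
  - by move=> x y; rewrite /= adjointE ?adjointK // -adjointE.
  - exact: projection_hermitian.
  - by move=> x; rewrite qf_projection -nL /qf /= adjointEr.
have AP z : adjoint L (L (adjoint L z)) = adjoint L z.
  rewrite -[LHS]/((adjoint L \o L) _) E; apply: dot_inj => x.
  rewrite projection_hermitian !adjointEr //.
  apply/eqP; rewrite -subr_eq0 -linearBr /= -(linB bL.1); apply/eqP.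
  suff -> : L (projection M x - x) = 0 by rewrite linear0r.
  apply: nsq_eq0; rewrite nL (linB (orth_proj_bounded M).1).
  by rewrite orth_proj_val subrr nsq0.
split=> [z zk|].
  rewrite /dot_norm; congr (Num.sqrt (complex.Re _)); have := zk (z - L (adjoint L z)); rewrite (linB bA.1) AP subrr.
  move=> /(_ erefl); rewrite linearBr /= => /eqP; rewrite subr_eq0 => /eqP zz.
  by rewrite zz adjointEr.
apply/seteqP; split=> [x Mx|_ [z _ <-]].
  by exists (L x) => //; rewrite -[LHS]/((adjoint L \o L) x) E /projection orth_proj_in.
by rewrite -AP -[X in _ X]/((adjoint L \o L) _) E; exact: projection_in.
Qed.

End PartialIsometries.

(** The double orthogonal complement serves as the closed span: a vector of it that is orthogonal to
    the sequence is orthogonal to itself. *)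
Lemma orthonormal_sequence_space (R : realType) (V : hilbertType R) (e : nat -> V) :
  (forall s t, '[e s, e t] = (s == t)%:R) ->
  exists (E : hilbertType R) (eta : nat -> E),
    onbasis eta /\ forall t, '[eta t, eta t] = 1.
Proof.
move=> e1; pose A := orth_compl (orth_compl (range e)).
have eA t : cs_set A (e t).
  by move=> x Ax; rewrite hdotC (Ax (e t)) ?rmorph0 //; exists t.
have /choice[eta he] t := in_hsubspace (eA t).
have eta1 s t : '[eta s, eta t] = (s == t)%:R by rewrite hsubspace_dotE !he e1.
exists (hsubspace A), eta; split=> [|t]; last by rewrite eta1 eqxx.
apply: orthosystem_total_onbasis; first split.
- by move=> s t /negbTE st; rewrite eta1 st.
- by move=> t; right; rewrite eta1 eqxx.
move=> x xe; apply: nsq_eq0; apply: complexI; rewrite -nsqE hsubspace_dotE.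
apply: (hsubspace_val x) => _ [t _ <-].
by rewrite -he -hsubspace_dotE xe.
Qed.

Lemma partial_sum_esum (R : realType) (f : nat -> R) (s : R) N : (forall t, 0 <= f t) ->
  (\esum_(t in [set: nat]) (f t)%:E = s%:E)%E -> \sum_(t < N) f t <= s.
Proof.
move=> f0 fs; rewrite -lee_fin -fs -nneseries_esumT => [|t]; last by rewrite lee_fin.
rewrite -sumEFin -(big_mkord xpredT (fun t => (f t)%:E)).
by apply: nneseries_lim_ge => t _; rewrite lee_fin.
Qed.

Lemma esum_ge_term (R : realType) (I : choiceType) (f : I -> \bar R) t :
  (forall s, (0 <= f s)%E) -> (f t <= \esum_(s in [set: I]) f s)%E.
Proof.
by move=> f0; apply: esum_ge; exists [set t]; rewrite ?fsbig_set1 //; split.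
Qed.

Lemma esum_inj_le (R : realType) (I J : choiceType) (f : J -> \bar R) (phi : I -> J) :
  injective phi -> (forall t, (0 <= f t)%E) ->
  (\esum_(s in [set: I]) f (phi s) <= \esum_(t in [set: J]) f t)%E.
Proof.
move=> inj f0; rewrite -(esum_image [set: I] phi f) => [|s t _ _]; last exact: inj.
by rewrite esum_mkcond; apply: le_esum => t _; case: ifP.
Qed.

(** Since [phi] is injective, the coefficients along [e (phi s)] form a part of Parseval's sum, so
    the prescribed images are a Bessel system. *)
Lemma basis_shift (R : realType) (V : hilbertType R) (I : countType) (e : I -> V)
    (phi : I -> I) (c : I -> R) (C : R) :
  (forall s t, '[e s, e t] = (s == t)%:R) ->
  (forall x, (forall s, '[x, e s] = 0) -> x = 0) ->
  injective phi -> 0 < C -> (forall s, c s ^+ 2 <= C) ->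
  exists2 A : V -> V, bounded_op A & forall s, A (e s) = (c s)%:C%C *: e (phi s).
Proof.
move=> e1 eT inj C0 cC; apply: (basis_synthesis e1 eT C0) => y.
rewrite EFinM -(basis_parseval e1 eT y) -esumZl ?(ltW C0) // => [|s]; last first.
  by rewrite lee_fin abs2_ge0.
apply: le_trans (esum_inj_le (f := fun s => (C%:E * (abs2 '[y, e s])%:E)%E) inj _); last first.
  by move=> s; rewrite -EFinM lee_fin mulr_ge0 ?abs2_ge0 // ltW.
apply: le_esum => s _; rewrite -EFinM lee_fin linearZr_LR /= abs2M abs2J abs2_real.
by rewrite ler_wpM2r ?abs2_ge0.
Qed.

(** * The universal model *)

Section Polynomials.
Context {R : realType} {k : nat} {n : 'I_k -> nat}.

Lemma mword_op_list (V : hilbertType R) (W : forall i, 'I_(n i) -> V -> V) u :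
  mword_op W u = multi_op W (index_enum ('I_k : finType)) u.
Proof.
rewrite /mword_op; elim: (index_enum _) => [|i r IH]; first by rewrite big_nil.
by rewrite big_cons IH.
Qed.

Lemma poly_evalE (V : hilbertType R) (W : forall i, 'I_(n i) -> V -> V) q
    (r : seq (@mword k n)) x :
  uniq r -> (forall u, q u != 0 -> u \in r) ->
  poly_eval W q x = \sum_(u <- r) q u *: mword_op W u x.
Proof.
move=> ur qr; rewrite /poly_eval (fsbigE r) //.
  by apply: eq_bigl => u; rewrite in_setT.
by move=> u _; apply: contraNeq; case: (eqVneq (q u) 0) => [->|/qr //]; rewrite scale0r eqxx.
Qed.

Lemma is_poly_seq (q : @mword k n -> R[i]) : is_poly q ->
  exists r, uniq r /\ forall u, q u != 0 -> u \in r.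
Proof.
move=> /finite_seqP[r qr]; exists (undup r); split; first exact: undup_uniq.
by move=> u qu; rewrite mem_undup; have : [set u | q u != 0] u by []; rewrite qr.
Qed.

Lemma mword_op_bounded (V : hilbertType R) (W : forall i, 'I_(n i) -> V -> V) u :
  (forall i j, bounded_op (W i j)) -> bounded_op (mword_op W u).
Proof.
move=> bW; rewrite mword_op_list; elim: (index_enum _) => [|i r IH]; first exact: bounded_id.
by apply: bounded_comp IH; exact: (word_op_bounded (bW i)).
Qed.

Lemma poly_eval_bounded (V : hilbertType R) (W : forall i, 'I_(n i) -> V -> V) q :
  (forall i j, bounded_op (W i j)) -> is_poly q -> bounded_op (poly_eval W q).
Proof.
move=> bW /is_poly_seq[r [ur qr]].
have -> : poly_eval W q = fun x => \sum_(u <- r) q u *: mword_op W u x.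
  by apply/funext => x; exact: poly_evalE.
by apply: bounded_sum => u; apply: bounded_scale; exact: mword_op_bounded.
Qed.

Lemma poly_eval_intertwine (V V' : hilbertType R) (W : forall i, 'I_(n i) -> V -> V)
    (W' : forall i, 'I_(n i) -> V' -> V') (L : V -> V') q x : linear L ->
  (forall i j y, L (W i j y) = W' i j (L y)) -> is_poly q ->
  L (poly_eval W q x) = poly_eval W' q (L x).
Proof.
move=> lL LW /is_poly_seq[r [ur qr]]; rewrite !(poly_evalE _ _ ur qr) (lin_sum lL).
apply: eq_bigr => u _; rewrite (linZ lL) !mword_op_list; congr (_ *: _).
elim: (index_enum _) x => //= i l IH x; rewrite -IH.
by elim: (u i) (multi_op _ _ _ _) => //= j w IHw y; rewrite LW IHw.
Qed.

End Polynomials.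

Section DependentUpdate.
Context {I : eqType} {T : I -> Type}.
Implicit Types x : forall i, T i.

Lemma dfwith_id x i : dfwith x i (x i) = x.
Proof.
apply: functional_extensionality_dep => j; have [<-|ij] := eqVneq i j.
  by rewrite dfwithin.
by rewrite dfwithout.
Qed.

Lemma dfwith_dfwith x i (u v : T i) : dfwith (dfwith x i u) i v = dfwith x i v.
Proof.
apply: functional_extensionality_dep => j; have [<-|ij] := eqVneq i j.
  by rewrite !dfwithin.
by rewrite !dfwithout.
Qed.

Lemma dfwithC x i j (u : T i) (v : T j) : i != j ->
  dfwith (dfwith x i u) j v = dfwith (dfwith x j v) i u.
Proof.
move=> ij; apply: functional_extensionality_dep => l; have [<-|il] := eqVneq i l.
  by rewrite dfwithout 1?eq_sym // !dfwithin.
have [<-|jl] := eqVneq j l; first by rewrite dfwithin dfwithout // dfwithin.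
by rewrite !dfwithout.
Qed.

End DependentUpdate.

(** * The universal model on the tensor product of Fock spaces *)

Section FockModel.
Context {R : realType} {k : nat} {n : 'I_k -> nat}.
Context (a : forall i, word (n i) -> R) (m : 'I_k -> nat).
Arguments a : clear implicits.
Hypothesis a0 : forall i w, 0 <= a i w.
Hypothesis anil : forall i, a i [::] = 0.
Hypothesis apos : forall i (j : 'I_(n i)), 0 < a i [:: j].
Hypothesis mpos : forall i, (0 < m i)%N.
Context (F : forall i, fock R (n i)) (K : big_htensor (fun i => F i)).
Arguments F : clear implicits.

Lemma wt_weight i (w : word (n i)) : weight (a i) (m i) w = mwt a m w.
Proof. by rewrite /mwt /wt; case: (m i) (mpos i). Qed.

Lemma shift_ratio_ge0 i j (w : word (n i)) : 0 <= mwt a m w / mwt a m (j :: w).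
Proof. by rewrite divr_ge0 ?(mwt_ge0 a0 anil apos mpos). Qed.

Lemma shift_ratio_le i j (w : word (n i)) :
  mwt a m w / mwt a m (j :: w) <= (a i [:: j])^-1.
Proof.
rewrite ler_pdivrMr ?(mwt_gt0 a0 anil apos mpos) // mulrC ler_pdivlMr // mulrC.
by rewrite /mwt -(prednK (mpos i)); exact: wt_cons.
Qed.

Lemma fock_orthonormal i s t : '[fock_basis (F i) s, fock_basis (F i) t] = (s == t)%:R.
Proof. by have [-> _] := fock_basisP (F i). Qed.

Lemma fock_total_set i : total_set (range (fock_basis (F i))).
Proof. by apply: closed_span_total; have [_ ->] := fock_basisP (F i). Qed.

Lemma fock_total i (x : F i) : (forall w, '[x, fock_basis (F i) w] = 0) -> x = 0.
Proof. by move=> h; apply: fock_total_set => _ [w _ <-]. Qed.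

Lemma weighted_shiftP i j : bounded_op (weighted_shift (a i) (m i) (F i) j) /\
  forall w, weighted_shift (a i) (m i) (F i) j (fock_basis (F i) w) =
    (Num.sqrt (mwt a m w / mwt a m (j :: w)))%:C%C *: fock_basis (F i) (j :: w).
Proof.
have inj : injective (cons j) by move=> u v [].
have C0 : 0 < (a i [:: j])^-1 by rewrite invr_gt0.
have [|A bA hA] := @basis_shift R (F i) (word (n i)) (fock_basis (F i)) (cons j)
  (fun w => Num.sqrt (mwt a m w / mwt a m (j :: w))) _ (fock_orthonormal (i := i))
  (fock_total (i := i)) inj C0.
  by move=> w; rewrite sqr_sqrtr ?shift_ratio_ge0 // shift_ratio_le.
have /the_opP[bS hS] : [set T : F i -> F i | bounded_op T /\
    forall w, T (fock_basis (F i) w) =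
      (Num.sqrt (weight (a i) (m i) w / weight (a i) (m i) (j :: w)))%:C%C
        *: fock_basis (F i) (j :: w)] A.
  by split=> // w; rewrite !wt_weight.
by split=> // w; have := hS w; rewrite !wt_weight.
Qed.

Let basis_family (g : @mword k n) : forall i, F i := fun i => fock_basis (F i) (g i).

(** Induction on the slots not yet holding a basis vector: a property of elementary tensors that may
    be tested on a basis in each slot separately reduces to products of basis vectors. *)
Lemma slot_ind (Q : (forall i, F i) -> Prop) :
  (forall x l, (forall w, Q (dfwith x l (fock_basis (F l) w))) -> Q x) ->
  (forall g, Q (basis_family g)) -> forall x, Q x.
Proof.
move=> step base.
have main (r : seq 'I_k) : forall x,
    (forall l, l \notin r -> exists w, x l = fock_basis (F l) w) -> Q x.
  elim: r => [|l r IH] x hx.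
    pose g : @mword k n := [ffun l => xget [::] [set w | x l = fock_basis (F l) w]].
    suff -> : x = basis_family g by exact: base.
    apply: functional_extensionality_dep => l; rewrite /basis_family ffunE.
    have [w hw] := hx l isT.
    by apply: (@xgetPex _ [::] [set w | x l = fock_basis (F l) w]); exists w.
  apply: (step x l) => w; apply: IH => l' l'r; have [<-|ll'] := eqVneq l l'.
    by exists w; rewrite dfwithin.
  by rewrite dfwithout //; apply: hx; rewrite inE negb_or eq_sym ll'.
by move=> x; apply: (main (index_enum 'I_k)) => l; rewrite mem_index_enum.
Qed.

Lemma big_tmap_total_set : total_set (range (big_tmap K)).
Proof. by apply: closed_span_total; exact: big_tmap_total. Qed.

Lemma big_tmap_slot (x : forall i, F i) l : bounded_op (fun y => big_tmap K (dfwith x l y)).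
Proof.
have E y z : '[big_tmap K (dfwith x l y), big_tmap K z] =
    '[y, z l] * \prod_(i < k | i != l) '[x i, z i].
  rewrite big_tmap_dot (bigD1 l) //= dfwithin; congr (_ * _).
  by apply: eq_bigr => i il; rewrite dfwithout // eq_sym.
apply/bounded_opP; split=> [c u v|].
  apply/eqP; rewrite -subr_eq0; apply/eqP/big_tmap_total_set => _ [z _ <-].
  by rewrite linearBl linearPl /= !E linearPl /= mulrDl mulrA subrr.
exists (\prod_(i < k | i != l) nsq (x i)) => [|y].
  by rewrite prodr_ge0 // => i _; exact: nsq_ge0.
rewrite le_eqVlt; apply/orP; left; apply/eqP/complexI.
rewrite -nsqE big_tmap_dot (bigD1 l) //= dfwithin mulrC rmorphM /= -nsqE rmorph_prod.
by congr (_ * _); apply: eq_bigr => i il; rewrite dfwithout 1?eq_sym // nsqE.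
Qed.

Definition Kbasis (g : @mword k n) : K := big_tmap K (basis_family g).

Lemma Kbasis_orthonormal g h : '[Kbasis g, Kbasis h] = (g == h)%:R.
Proof.
rewrite /Kbasis big_tmap_dot.
under eq_bigr => i _ do rewrite fock_orthonormal.
case: eqVneq => [->|gh]; first by rewrite big1 // => i _; rewrite eqxx.
have [i ghi] : exists i, g i != h i.
  apply: contrapT => ne; move: gh => /eqP; apply; apply/ffunP => i.
  by apply/eqP; apply: contrapT => /negP ghi; apply: ne; exists i.
by rewrite (bigD1 i) //= (negbTE ghi) mul0r.
Qed.

Lemma Kbasis_total x : (forall g, '[x, Kbasis g] = 0) -> x = 0.
Proof.
move=> h; apply: big_tmap_total_set => _ [z _ <-]; move: z.
apply: slot_ind => [z l hz|g]; last exact: h.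
have bS := adjoint_bounded (big_tmap_slot z l).
rewrite -[z](dfwith_id z l) -(adjointEr _ _ (big_tmap_slot z l)).
suff -> : adjoint (fun y => big_tmap K (dfwith z l y)) x = 0 by rewrite linear0l.
by apply: fock_total => w; rewrite (adjointEr _ _ (big_tmap_slot z l)).
Qed.

Lemma mupd_cons_inj i (j : 'I_(n i)) : injective (fun g : @mword k n => mupd g i (j :: g i)).
Proof.
move=> g h e; have : g i = h i.
  by have := congr1 (fun f : @mword k n => f i) e; rewrite /= !mupd_in => -[].
by move=> gh; rewrite -(mupd_id g i) -(mupd_mupd g (j :: g i)) e mupd_mupd gh mupd_id.
Qed.

(** An operator is first built from its values on the product basis; [slot_ind] shows that it acts
    as the weighted shift in slot [i] of every elementary tensor, so it is the one chosen by
    [ampliation]. *)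
Lemma universal_modelP i (j : 'I_(n i)) : bounded_op (universal_model a m K i j) /\
  forall g, universal_model a m K i j (Kbasis g) =
    (Num.sqrt (mwt a m (g i) / mwt a m (j :: g i)))%:C%C *: Kbasis (mupd g i (j :: g i)).
Proof.
have C0 : 0 < (a i [:: j])^-1 by rewrite invr_gt0.
have [|A bA hA] := @basis_shift R K (@mword k n) Kbasis (fun g => mupd g i (j :: g i))
  (fun g => Num.sqrt (mwt a m (g i) / mwt a m (j :: g i))) _ Kbasis_orthonormal
  Kbasis_total (@mupd_cons_inj i j) C0.
  by move=> g; rewrite sqr_sqrtr ?shift_ratio_ge0 // shift_ratio_le.
have [bw hw] := weighted_shiftP j.
set w := weighted_shift (a i) (m i) (F i) j in bw hw.
have Aslot : forall x : (forall i, F i), A (big_tmap K x) = big_tmap K (dfwith x i (w (x i))).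
  apply: slot_ind => [x l hx|g].
    have [e|li] := eqVneq l i.
      move: hx; rewrite e => hx; have b1 := bounded_comp bA (big_tmap_slot x i).
      have b2 := bounded_comp (big_tmap_slot x i) bw.
      rewrite -{1}[x](dfwith_id x i).
      apply: (congr1 (fun f => f (x i)) (total_eq (@fock_total_set i) b1 b2 _)).
      by move=> _ [v _ <-] /=; rewrite hx dfwithin dfwith_dfwith.
    have b1 := bounded_comp bA (big_tmap_slot x l).
    have b2 := big_tmap_slot (dfwith x i (w (x i))) l.
    have Ex : dfwith (dfwith x i (w (x i))) l (x l) = dfwith x i (w (x i)).
      by rewrite dfwithC 1?eq_sym // dfwith_id.
    rewrite -{1}[x](dfwith_id x l) -Ex.
    apply: (congr1 (fun f => f (x l)) (total_eq (@fock_total_set l) b1 b2 _)).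
    by move=> _ [v _ <-] /=; rewrite hx (dfwithout _ _ li) (dfwithC _ _ _ li).
  rewrite -/(Kbasis g) hA [basis_family g i]/(fock_basis _ _) hw.
  rewrite (linZ (big_tmap_slot _ i).1); congr (_ *: big_tmap K _).
  apply: functional_extensionality_dep => l; rewrite /basis_family.
  have [<-|il] := eqVneq i l; first by rewrite mupd_in dfwithin.
  by rewrite mupd_out // dfwithout.
have /the_opP[bS hS] : [set S : K -> K | bounded_op S /\
    forall x : forall i, F i, S (big_tmap K x) = big_tmap K (dfwith x i (w (x i)))] A by [].
have -> : universal_model a m K i j = A; last by [].
apply: (total_eq big_tmap_total_set) => // _ [x _ <-].
by rewrite Aslot; exact: hS.
Qed.

Let W := universal_model a m K.
Arguments W : clear implicits.
Let bW i j : bounded_op (W i j). Proof. by have [] := universal_modelP j. Qed.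

(** Presents [W] itself as a model frame of multiplicity one, so that the word calculus of
    [model_frame] applies to it. *)
Definition Keps (g : @mword k n) (t : nat) : K := if t is 0 then Kbasis g else 0.

Lemma Kmodel_frame : model_frame a m W Keps.
Proof.
split=> [i j|x|i j g [|t]]; first exact: bW.
- rewrite -(basis_parseval Kbasis_orthonormal Kbasis_total x).
  apply: eq_esum => g _; rewrite mul1e /energy.
  transitivity (\esum_(t in [set 0%N]) (abs2 '[x, Keps g t])%:E)%E.
    rewrite [RHS]esum_mkcond; apply: eq_esum => -[|t] _; first by rewrite mem_set.
    by rewrite memNset // linear0r abs2_0.
  by rewrite esum_set1 // lee_fin abs2_ge0.
- by have [_ hW] := universal_modelP j; exact: hW.
- by rewrite /= scaler0 (lin0 (bW j).1).
Qed.

Let letter i (j : 'I_(n i)) : @mword k n := mupd [ffun=> [::]] i [:: j].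

Lemma mword_op_cons i j u : mword_op W (mupd u i (j :: u i)) = W i j \o mword_op W u.
Proof.
rewrite !mword_op_list (multi_op_cons Kmodel_frame) //.
  exact: index_enum_uniq.
exact: mem_index_enum.
Qed.

Lemma mword_op_nil : mword_op W [ffun=> [::]] = id.
Proof.
rewrite mword_op_list; elim: (index_enum _) => //= i r ->.
by rewrite ffunE.
Qed.

Definition letter_poly i (j : 'I_(n i)) : @mword k n -> R[i] := fun u => (u == letter j)%:R.

Lemma letter_poly_is_poly i (j : 'I_(n i)) : is_poly (letter_poly j).
Proof.
apply: (sub_finite_set _ (finite_set1 (letter j))) => u /=.
by rewrite /letter_poly; case: (eqVneq u (letter j)) => // _; rewrite eqxx.
Qed.

Lemma poly_eval_letter i j : poly_eval W (letter_poly j) = W i j.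
Proof.
apply/funext => x; rewrite (@poly_evalE _ _ _ _ W _ [:: letter j]) // => [|u]; last first.
  by rewrite /letter_poly inE; case: (eqVneq u (letter j)) => // _; rewrite eqxx.
rewrite big_seq1 /letter_poly eqxx scale1r /letter.
have -> : [:: j] = j :: ([ffun=> [::]] : @mword k n) i by rewrite ffunE.
by rewrite mword_op_cons mword_op_nil.
Qed.

Lemma letter_cat i (j : 'I_(n i)) u : mword_cat (letter j) u = mupd u i (j :: u i).
Proof.
apply/ffunP => l; rewrite ffunE /letter; have [<-|il] := eqVneq i l; first by rewrite !mupd_in.
by rewrite !mupd_out // ffunE.
Qed.

Lemma poly_mul_letter i (j : 'I_(n i)) r u :
  poly_mul (letter_poly j) r (mupd u i (j :: u i)) = r u.
Proof.
rewrite /poly_mul (fsbigE [:: (letter j, u)]) //.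
- rewrite big_mkcond big_seq1 mem_set /=; last exact: letter_cat.
  by rewrite /letter_poly eqxx mul1r.
- by move=> vv' /=; rewrite inE => /eqP -> /=; exact: letter_cat.
- move=> [v v'] /= e; rewrite inE /letter_poly => h.
  case: (eqVneq v (letter j)) => vl; last by rewrite mul0r.
  by move: e h; rewrite vl letter_cat => /mupd_cons_inj ->; rewrite eqxx.
Qed.

Lemma poly_mul_letter0 i (j : 'I_(n i)) r w :
  (forall u, w <> mupd u i (j :: u i)) -> poly_mul (letter_poly j) r w = 0.
Proof.
move=> hw; rewrite /poly_mul fsbig1 // => -[v v'] /= e; rewrite /letter_poly.
case: (eqVneq v (letter j)) => vl; last by rewrite mul0r.
by case: (hw v'); rewrite -letter_cat -vl.
Qed.

(** Multiplication by a letter relabels the multiwords along an injection, so the two sums match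
    term by term. *)
Lemma poly_eval_mul_letter i j r : is_poly r ->
  poly_eval W (poly_mul (letter_poly j) r) = W i j \o poly_eval W r.
Proof.
move=> /is_poly_seq[l [ul lr]]; apply/funext => x; rewrite /= (poly_evalE _ _ ul lr).
rewrite (lin_sum (bW j).1).
rewrite (@poly_evalE _ _ _ _ W _ [seq mupd u i (j :: u i) | u <- l]).
- rewrite big_map; apply: eq_bigr => u _.
  by rewrite poly_mul_letter mword_op_cons (linZ (bW j).1).
- by rewrite map_inj_uniq //; exact: mupd_cons_inj.
move=> w; apply: contraNT => wl; apply/eqP.
have [[u hu]|hw] := pselect (exists u, w = mupd u i (j :: u i)).
  rewrite hu poly_mul_letter; apply/eqP; apply: contraNT wl => /lr ul'.
  by rewrite hu; apply: map_f.
by apply: poly_mul_letter0 => u hu; apply: hw; exists u.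
Qed.

(** * The space [N_J] and the compressed model *)

Section Variety.
Context (J : variety_ideal W).

Lemma letter_in_algebra i j : poly_algebra W (W i j).
Proof. by exists (letter_poly j); [exact: letter_poly_is_poly|exact: poly_eval_letter]. Qed.

Lemma poly_algebra_bounded S : poly_algebra W S -> bounded_op S.
Proof. by move=> [q pq <-]; exact: poly_eval_bounded. Qed.

(** Each of the four kinds of left ideal absorbs a letter from the left, which makes [N_J] invariant
    under the adjoints of [W]. *)
Lemma ideal_ops_letter i j g : ideal_ops J g -> ideal_ops J (W i j \o g).
Proof.
have hnorm0' (x : K) : hnorm (x - x) = 0 by rewrite subrr hnorm0.
case: J => I [sub _ _ mul] /=.
- move=> [q Iq <-]; rewrite -poly_eval_mul_letter; last exact: sub.
  by exists (poly_mul (letter_poly j) q) => //; apply: mul => //; exact: letter_poly_is_poly.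
- by apply: mul; exact: letter_in_algebra.
- apply: mul; split=> // e e0; exists (W i j); first exact: letter_in_algebra.
  by move=> x; rewrite hnorm0' mulr_ge0 ?hnorm_ge0 // ltW.
- apply: mul; split=> //; exists (fun=> W i j) => [_|x]; first exact: letter_in_algebra.
  by apply/hcvgP; exact: tends_cst.
Qed.

(** Unifies the four kinds of ideal: a polynomial is a constant sequence, and norm approximations
    with tolerance [1 / (N + 1)] converge pointwise. *)
Lemma ideal_ops_hardy g : ideal_ops J g -> hardy_algebra W g.
Proof.
have poly S : poly_algebra W S -> hardy_algebra W S.
  move=> pS; split; first exact: poly_algebra_bounded.
  by exists (fun=> S) => // x; apply/hcvgP; exact: tends_cst.
case: J => I [sub _ _ _] /=.
- by move=> [q Iq <-]; apply: poly; exists q => //; exact: sub.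
- by move=> Ig; apply: poly; exact: sub.
- move=> /sub[bg hg]; split=> //.
  have /choice[S hS] (N : nat) : exists S, poly_algebra W S /\
      forall x, hnorm (g x - S x) <= N.+1%:R^-1 * hnorm x.
    by have [|S pS hS] := hg N.+1%:R^-1; [rewrite invr_gt0|exists S].
  exists S => [N|x]; first by have [] := hS N.
  apply/cvgrPdist_le => e e0; exists (Num.bound (hnorm x / e)) => // N /= xN.
  rewrite sub0r normrN ger0_norm ?hnorm_ge0 //.
  rewrite hnormBC; have [_ /(_ x) /le_trans] := hS N; apply.
  rewrite mulrC ler_pdivrMr // mulrC -ler_pdivrMr //.
  have /archi_boundP/ltW/le_trans : 0 <= hnorm x / e by rewrite divr_ge0 ?hnorm_ge0 // ltW.
  by apply; rewrite ler_nat (leq_trans xN).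
- exact: sub.
Qed.

Let N := variety_space J.

Lemma variety_memP x : cs_set N x <-> forall g u, ideal_ops J g -> '[x, g u] = 0.
Proof.
split=> [Nx g u Jg|h z [v vspan /hcvgP vz]].
  apply: Nx; exists (fun=> g u) => [_|]; last by apply/hcvgP; exact: tends_cst.
  exists 1%N, (fun=> 1), (fun=> g u); split; first by move=> _; exists g, u.
  by rewrite big_ord1 scale1r.
rewrite hdotC (tends_dot_eq vz (c := 0)) ?rmorph0 //; exists 0%N => M _.
have [d [c [y [hy ->]]]] := vspan M; rewrite dot_suml big1 // => s _.
have [g [u [Jg ->]]] := hy s.
by rewrite linearZl_LR /= hdotC h // rmorph0 mulr0.
Qed.

Lemma variety_coinvariant i j x : cs_set N x -> cs_set N (adjoint (W i j) x).
Proof.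
move=> /variety_memP Nx; apply/variety_memP => g u Jg.
by rewrite adjointEr // (Nx _ u (ideal_ops_letter j Jg)).
Qed.

Let S := compression W N.
Arguments S : clear implicits.

Lemma compression_bounded i j : bounded_op (S i j).
Proof.
apply: (bounded_comp (orth_proj_bounded N)).
exact: (bounded_comp (bW j) (val_bounded N)).
Qed.

(** For [z] in [N_J] the vector [adjoint (W i j) z] is in [N_J] again, so the part of [y] outside
    [N_J] contributes nothing. *)
Lemma compression_proj i j y : S i j (orth_proj N y) = orth_proj N (W i j y).
Proof.
apply: dot_inj => z; rewrite /S /compression !orth_proj_dot !(adjointE _ _ (bW j)).
have [z' zz'] := in_hsubspace (variety_coinvariant j (hsubspace_val z)).
by rewrite -zz' -hsubspace_dotE orth_proj_dot.
Qed.

Lemma compression_poly q y : is_poly q ->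
  orth_proj N (poly_eval W q y) = poly_eval S q (orth_proj N y).
Proof.
move=> pq; apply: (poly_eval_intertwine _ (orth_proj_bounded N).1 _ pq) => i j z.
by rewrite compression_proj.
Qed.

Lemma ideal_ops_proj0 g y : ideal_ops J g -> orth_proj N (g y) = 0.
Proof.
move=> Jg; apply: orth_proj_orth => z /variety_memP Nz.
by rewrite hdotC Nz // rmorph0.
Qed.

Section TensorModel.
Context {H : hilbertType R} (T : htensor (hsubspace N) H).
Let X := tensor_tuple T S.
Arguments X : clear implicits.

Lemma tensor_tuple_bounded i j : bounded_op (X i j).
Proof. by have [] := tensor_opP T T (compression_bounded j). Qed.

Lemma tensor_tuple_tmap i j x y : X i j (tmap T x y) = tmap T (S i j x) y.
Proof. by have [_ hX] := tensor_opP T T (compression_bounded j); exact: hX. Qed.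

Lemma tensor_tuple_slice i j y z : slice T y (X i j z) = S i j (slice T y z).
Proof. exact: tensor_op_slice (compression_bounded j). Qed.

Definition tensor_eps (h : nat -> H) (g : @mword k n) t : T :=
  tmap T (orth_proj N (Kbasis g)) (h t).

(** A vector of [N_J] has the same coefficients against [P e_g] as against [e_g], so Parseval's
    identity survives the projection; slicing along [h] reduces the tensor product to this case. *)
Lemma tensor_model_frame h : onbasis h -> model_frame a m X (tensor_eps h).
Proof.
move=> hB; split=> [|x|i j g t]; first exact: tensor_tuple_bounded.
- rewrite -(slice_parseval x hB) /sym.
  under eq_esum => g _ do rewrite mul1e /energy.
  rewrite esum_exchange => [|g t]; last by rewrite lee_fin abs2_ge0.
  apply: eq_esum => t _; rewrite hsubspace_nsqE.
  rewrite -(basis_parseval Kbasis_orthonormal Kbasis_total).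
  apply: eq_esum => g _; rewrite /tensor_eps -slice_dot.
  by rewrite abs2_dotC orth_proj_dot abs2_dotC.
rewrite tensor_tuple_tmap compression_proj; have [_ hW] := universal_modelP j.
rewrite [W i j _]hW.
by rewrite (linZ (orth_proj_bounded N).1) (linZ (tmap_boundedl T (h t)).1).
Qed.

End TensorModel.

Lemma intertwiner_ideal (L : K -> hsubspace N) g u : bounded_op L ->
  (forall i j y, L (W i j y) = S i j (L y)) -> ideal_ops J g -> L (g u) = 0.
Proof.
move=> bL iL Jg; have [bg [Sq pS hS]] := ideal_ops_hardy Jg.
have /choice[q hq] M : exists q, is_poly q /\ Sq M = poly_eval W q.
  by have [q pq <-] := pS M; exists q.
have t1 : tends (fun M => poly_eval S (q M) (L u)) (L (g u)).
  have /hcvgP Su := hS u; have := bounded_tends bL Su.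
  congr tends; apply/funext => M /=; have [pq ->] := hq M.
  exact: (poly_eval_intertwine _ bL.1 iL pq).
have t2 : tends (fun M => poly_eval S (q M) (L u)) (orth_proj N (g (val (L u)))).
  have /hcvgP Su := hS (val (L u)); have := bounded_tends (orth_proj_bounded N) Su.
  congr tends; apply/funext => M /=; have [pq ->] := hq M.
  by rewrite compression_poly // orth_proj_val.
by rewrite (tends_unique t1 t2) ideal_ops_proj0.
Qed.

Section Intertwiners.
Context {H : hilbertType R} (T : htensor (hsubspace N) H).
Let X := tensor_tuple T S.
Arguments X : clear implicits.
Context (L : K -> T).
Hypothesis bL : bounded_op L.
Hypothesis iL : forall i j y, L (W i j y) = X i j (L y).

(** [L] vanishes on the ranges of the ideal. This is tested slice by slice, because
    [intertwiner_ideal] concerns maps into [N_J] itself. *)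
Lemma intertwiner_adjoint z : cs_set N (adjoint L z).
Proof.
apply/variety_memP => g u Jg; rewrite adjointEr //.
suff -> : L (g u) = 0 by rewrite linear0r.
apply: tmap_eq => x y; rewrite linear0l -slice_dot.
suff -> : slice T y (L (g u)) = 0 by rewrite linear0l.
apply: (@intertwiner_ideal (slice T y \o L)) => //.
  exact: bounded_comp (slice_bounded T y) bL.
by move=> i j v; rewrite /= iL tensor_tuple_slice.
Qed.

Lemma intertwiner_proj x : L (val (orth_proj N x)) = L x.
Proof.
apply: dot_inj => z; rewrite !(adjointE _ _ bL).
have [y <-] := in_hsubspace (intertwiner_adjoint z).
by rewrite -hsubspace_dotE orth_proj_dot.
Qed.

Lemma intertwiner_compression i j (x : hsubspace N) : L (val (S i j x)) = X i j (L (val x)).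
Proof. by rewrite intertwiner_proj iL. Qed.

End Intertwiners.

(** * The two directions of the characterization *)

Section Beurling.
Context {H : hilbertType R} (T : htensor (hsubspace N) H) (M : closedSubspace T).
Let X := tensor_tuple T S.
Arguments X : clear implicits.

Lemma beurling_positive p : (forall i, (p i <= m i)%N) ->
  beurling_type S T M -> positive_op (Delta a X p (projection M)).
Proof.
move=> pm [E [TE [Psi [[bP iP] iso MP]]]].
have PE := partial_isometry_projection bP iso MP.
have [h hB] := exists_onbasis (V := E).
have XM := tensor_model_frame TE hB.
have bX := @tensor_tuple_bounded H T; have bXE := @tensor_tuple_bounded E TE.
have iw i (w : word (n i)) x : Psi (word_op (tensor_tuple TE S i) w x) =
    word_op (tensor_tuple T S i) w (Psi x).
  by elim: w => //= j w IH; rewrite iP IH.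
have GX i (w : word (n i)) x : adjoint Psi (word_adj (tensor_tuple T S i) w x) =
    word_adj (tensor_tuple TE S i) w (adjoint Psi x).
  by apply: dot_inj => z; rewrite adjointEr // !word_adj_dot // adjointEr // iw.
(* The form of the projection at [x] is the squared norm of [adjoint Psi x], which is the constant
   symbol 1. *)
have hs : has_symbol (tensor_eps TE h) (adjoint Psi) (projection M) (fun=> 1).
  split; [exact: projection_bounded|exact: projection_positive|move=> x].
  by have [_ -> _] := XM; rewrite /eqf PE /qf /= adjointE.
by have [] := has_symbol_Delta a0 anil apos mpos XM bX GX pm hs.
Qed.

Hypothesis pD : forall p : 'I_k -> nat, (forall i, (p i <= m i)%N) ->
  positive_op (Delta a X p (projection M)).

Lemma exists_intertwiners : exists L : nat -> K -> T,
  [/\ forall t, bounded_op (L t), forall t i j y, L t (W i j y) = X i j (L t y)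
    & forall z, (\esum_(t in [set: nat]) (nsq (adjoint (L t) z))%:E =
                 (nsq (orth_proj M z))%:E)%E].
Proof.
have [h hB] := exists_onbasis (V := H); have XM := tensor_model_frame T hB.
have bY := projection_bounded M.
have Y1 x : (eqf (projection M) x <= ensq x)%E.
  by rewrite lee_fin qf_projection nsq_orth_proj.
have bD := Delta_bounded a0 anil apos mpos XM bY Y1 pD.
have [d hd] := cholesky_vectors bD (pD (fun i => leqnn (m i))).
have en := kernel_energy a0 anil apos mpos XM bY Y1 pD hd.
have /choice[L hL] t : exists L, bounded_op L /\
    forall g, L (Kbasis g) = kernel_vec a m X d t g.
  have [|L bL hL] := basis_synthesis Kbasis_orthonormal Kbasis_total
    (v := kernel_vec a m X d t) ltr01; last by exists L.
  (* The energy of a single [t] is at most the total, which is the form of the projection and so at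
     most [nsq y]. *)
  move=> y; rewrite mul1r; apply: le_trans (Y1 y); rewrite -en.
  apply: (esum_ge_term t (f := fun t => (\esum_(g in [set: @mword k n])
    (abs2 '[y, kernel_vec a m X d t g])%:E)%E)) => s.
  by apply: esum_ge0 => g _; rewrite lee_fin abs2_ge0.
have bL t : bounded_op (L t) by have [] := hL t.
exists L; split=> // [t i j y|z].
  suff /(congr1 (fun f => f y)) : L t \o W i j = X i j \o L t by [].
  apply: (@total_eq _ _ _ (range Kbasis)).
  - by move=> x hx; apply: Kbasis_total => g; apply: hx; exists g.
  - exact: bounded_comp (bL t) (bW j).
  - exact: bounded_comp (tensor_tuple_bounded T j) (bL t).
  - move=> _ [g _ <-] /=; have [_ hW] := universal_modelP j; have [_ h'] := hL t.
    rewrite [W i j _]hW (linZ (bL t).1) !h'.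
    by rewrite /X (kernel_vec_shift a0 anil apos mpos XM).
rewrite -qf_projection -/(eqf _ _) -en; apply: eq_esum => t _.
rewrite -(basis_parseval Kbasis_orthonormal Kbasis_total); apply: eq_esum => g _.
by have [_ h'] := hL t; rewrite adjointEr // h'.
Qed.

Lemma positive_beurling (E : hilbertType R) (eta : nat -> E) : onbasis eta ->
  (forall t, '[eta t, eta t] = 1) -> beurling_type S T M.
Proof.
move=> etaB eta1; have [L [bL iL nL]] := exists_intertwiners.
have LN t z := intertwiner_adjoint (bL t) (iL t) z.
have nP t z : nsq (orth_proj N (adjoint (L t) z)) = nsq (adjoint (L t) z).
  by rewrite hsubspace_nsqE orth_proj_in.
(* By [LN] the projection onto [N_J] loses nothing, so the squared norms of the components add up to
   that of [orth_proj M z]. *)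
have /choice[A hA] z : exists y : hl2 (hsubspace N),
    hl2_seq y = fun t => orth_proj N (adjoint (L t) z).
  apply: (@hl2_mk _ _ _ (nsq (orth_proj M z))) => P.
  under eq_bigr do rewrite nP.
  by apply: partial_sum_esum (nL z) => t; exact: nsq_ge0.
have nA z : nsq (A z) = nsq (orth_proj M z).
  apply: EFin_inj; rewrite -nsq_hl2 -nL; apply: eq_esum => t _.
  by rewrite hA nP.
have bA : bounded_op A.
  apply/bounded_opP; split=> [c x y|].
    apply: hl2_eq => t; rewrite hl2_seqP !hA.
    by rewrite (adjoint_bounded (bL t)).1 (orth_proj_bounded N).1.
  by exists 1 => // z; rewrite nA mul1r nsq_orth_proj.
have [iso MA] := projection_partial_isometry bA nA.
have bB := adjoint_bounded bA.
pose TE := hl2_htensor (hsubspace N) etaB eta1.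
(* On [x (x) eta t] the adjoint of [A] is [L t]; these tensors are total, so intertwining reduces to
   that of each [L t] with the compressions. *)
have At t x : adjoint A (hl2_tmap eta x (eta t)) = L t (val x).
  apply: dot_inj => z; rewrite adjointEr // hl2_tmap_coord // hA.
  by rewrite (adjointE _ _ (bL t)) [LHS]hdotC orth_proj_dot -hdotC.
exists E, TE, (adjoint A); split=> //; split=> // i j z.
suff /(congr1 (fun f => f z)) :
    (adjoint A : TE -> T) \o tensor_tuple TE S i j = X i j \o adjoint A by [].
apply: (@total_eq _ _ _ [set y | exists t x, y = hl2_tmap eta x (eta t)]).
- move=> y hy; apply: hl2_eq => t; apply: dot_inj => x.
  rewrite hdotC -(hl2_tmap_coord etaB eta1) -hdotC hy; last by exists t, x.
  by rewrite /hl2_seq raddf0 linear0l.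
- exact: bounded_comp bB (tensor_tuple_bounded TE j).
- exact: bounded_comp (tensor_tuple_bounded T j) bB.
move=> _ [t [x ->]] /=; rewrite (tensor_tuple_tmap TE) /= !At.
exact: (intertwiner_compression (bL t) (iL t)).
Qed.

End Beurling.
End Variety.
End FockModel.

Theorem corollary2p6 (R : realType) (k : nat) (hk : (1 <= k)%N)
    (n m : 'I_k -> nat)
    (hn : forall i, (1 <= n i)%N) (hm : forall i, (1 <= m i)%N)
    (a : forall i, word (n i) -> R) (ha : forall i, positive_regular (a i))
    (F : forall i, fock R (n i)) (K : big_htensor (fun i => F i))
    (J : variety_ideal (universal_model a m K))
    (hN : exists x : K, (variety_space J : set K) x /\ x <> 0)
    (H : hilbertType R) (T : htensor (hsubspace (variety_space J)) H)
    (M : closedSubspace T) :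
  let S := compression (universal_model a m K) (variety_space J) in
  invariant_subspace (tensor_tuple T S) M ->
  (beurling_type S T M <->
   forall p : 'I_k -> nat, (forall i, (p i <= m i)%N) ->
     positive_op (Delta a (tensor_tuple T S) p (projection M))).
Proof.
move=> S _.
have a0 i (w : word (n i)) : 0 <= a i w by have [] := ha i.
have anil i : a i [::] = 0 by have [] := ha i.
have apos i (j : 'I_(n i)) : 0 < a i [:: j] by have [] := ha i.
split=> [bM p pm|pD]; first exact: (beurling_positive a0 anil apos hm pm bM).
pose i := Ordinal hk; pose j : 'I_(n i) := Ordinal (hn i).
have [|E [eta [etaB eta1]]] :=
    @orthonormal_sequence_space R (F i) (fun r => fock_basis (F i) (nseq r j)).
  move=> s t; have [-> _] := fock_basisP (F i); congr (nat_of_bool _)%:R.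
  by apply/eqP/eqP => [/(congr1 size)|->//]; rewrite !size_nseq.
exact: (positive_beurling a0 anil apos hm pD etaB eta1).
Qed.
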